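(* The following computational problem is \#P-hard: given a sound, acyclic and free-choice TPWN $W=(N,w,\tau)$ with $N=(P,T,F,i,o)$ in which every transition $t$ satisfies $w(t)=1$, $\tau(t)\in\{0,1\}$ and $|({}^\bullet t)^\bullet|\le 2$, and given a rational $\epsilon>0$, compute a rational $r$ such that $r-\epsilon<ET_W<r+\epsilon$.
   Context: A workflow net is $N=(P,T,F,i,o)$: $P,T$ disjoint finite sets of places and transitions, $F\subseteq(P\times T)\cup(T\times P)$, $i$ without incoming and $o$ without outgoing arcs, $(P\cup T,F\cup\{(o,i)\})$ strongly connected. ${}^\bullet x=\{y:(y,x)\in F\}$, $x^\bullet=\{y:(x,y)\in F\}$, extended to sets by union. Markings, firing $M\xrightarrow{t}M'$ (remove one token from each place of ${}^\bullet t$, add one to each place of $t^\bullet$), firing sequences, reachability as usual; $\mathbf{i}$ ($\mathbf{o}$) has one token in $i$ (in $o$). Sound: $\mathbf{o}$ reachable from every reachable marking. Acyclic: the graph $(P\cup T,F)$ has no cycle. Free-choice: for all places $p_1,p_2$, $p_1^\bullet\cap p_2^\bullet\ne\emptyset$ implies $p_1^\bullet=p_2^\bullet$. 1-safe: every reachable marking has at most one token per place (identified with a set of places). Two transitions are independent if their presets are disjoint, dependent otherwise; at a 1-safe marking $M$ two enabled transitions are concurrent if independent, in conflict if dependent; $C(t,M)$ = set of transitions in conflict with $t$ at $M$ (contains $t$), $\mathcal{C}(M)=\{C(t,M): t\text{ enabled at }M\}$. Confusion-free: for every reachable $M$, enabled $t$, $u$ concurrent with $t$ at $M$: $C(u,M)=C(u,M\setminus{}^\bullet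 t)=C(u,(M\setminus{}^\bullet t)\cup t^\bullet)$. A TPWN is $W=(N,w,\tau)$ with $N$ 1-safe and confusion-free, $w:T\to\mathbb{Q}_{>0}$, $\tau:T\to\mathbb{N}$. Timing: $\mathbb{N}_\bot=\{\bot\}\cup\mathbb{N}$, $\bot\le x$, $\bot+x=\bot$; $upd(\vec x,t)_p=\max_{q\in{}^\bullet t}\vec x_q+\tau(t)$ if $p\in t^\bullet$, $\bot$ if $p\in{}^\bullet t\setminus t^\bullet$, $\vec x_p$ otherwise; $\mu(\epsilon)_i=0$, $\mu(\epsilon)_p=\bot$ ($p\ne i$), $\mu(\sigma t)=upd(\mu(\sigma),t)$; $\mathit{time}(\sigma)=\max_p\mu(\sigma)_p$. MDP semantics: states are 1-safe markings $M$ and pairs $(M,t)$ with $t$ enabled at $M$, initial $\mathbf{i}$; at $M$ with no enabled transition a Dirac self-loop; otherwise one distribution per $C\in\mathcal{C}(M)$ giving $(M,t)$ probability $w(t)/\sum_{u\in C}w(u)$ for $t\in C$; from $(M,t)$ probability 1 to $M'$ with $M\xrightarrow{t}M'$. A scheduler $S$ chooses an available distribution based on the path so far, inducing $\mathit{Prob}^S$ on infinite paths. $\mathit{time}(\mathbf{o},\pi)$ is $\infty$ if $\pi$ never visits $\mathbf{o}$, else $\mathit{time}$ of the transition sequence along the shortest prefix of $\pi$ ending in $\mathbf{o}$; $ET^S_W$ is its expectation; it is independent of $S$, and $ET_W$ denotes the common value. \#P-hardness is with respect to polynomial-time (Turing) reductions, with numbers encoded in binary. *)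

(* Defs.v *)
From HB Require Import structures.
From mathcomp Require Import all_boot all_order all_algebra.
Set Implicit Arguments.
Unset Strict Implicit.
Unset Printing Implicit Defensive.
Import Order.TTheory GRing.Theory Num.Theory.

Notation word := (seq bool).

(* [None] is the blank. *)
Notation symbol := (option bool).

Inductive move := GoLeft | Stay | GoRight.

(* The tape [(l, r)] is two-way infinite: [r] lists the cells from the scanned
   one rightwards, [l] the cells to its left, nearest first; all other cells
   are blank. *)
Definition tape := (seq symbol * seq symbol)%type.

Definition tape_of_word (x : word) : tape := ([::], map Some x).

Definition scanned (c : tape) : symbol := head None c.2.

Definition act (c : tape) (a : symbol * move) : tape :=
  let: (s, d) := a in
  match d with
  | GoLeft => (behead c.1, head None c.1 :: s :: behead c.2)
  | Stay => (c.1, s :: behead c.2)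
  | GoRight => (s :: c.1, behead c.2)
  end.

Fixpoint blank_free_prefix (s : seq symbol) : word :=
  if s is Some b :: s' then b :: blank_free_prefix s' else [::].

Definition word_of_tape (c : tape) : word := blank_free_prefix c.2.

(* A deterministic multitape machine over {0, 1, blank}. Tape [ord0] carries
   the input and the output, tape [ord_max] is the oracle tape. In a control
   state [q] with [ask q = Some q'], the word on the oracle tape is replaced in
   one step by the oracle's answer and control passes to [q']. *)
Record machine := Machine {
  extra_tapes : nat;
  ctrl : finType;
  start : ctrl;
  final : pred ctrl;
  ask : ctrl -> option ctrl;
  delta : ctrl -> {ffun 'I_extra_tapes.+2 -> symbol} ->
          ctrl * {ffun 'I_extra_tapes.+2 -> symbol * move} }.

Section Run.
Variables (M : machine) (O : word -> word).

Definition config := (ctrl M * {ffun 'I_(extra_tapes M).+2 -> tape})%type.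

Definition init_config (x : word) : config :=
  (start M, [ffun i => if i == ord0 then tape_of_word x else ([::], [::])]).

Definition step (c : config) : config :=
  let: (q, tp) := c in
  if final q then c
  else if ask q is Some q' then
    (q', [ffun i => if i == ord_max
                    then tape_of_word (O (word_of_tape (tp i))) else tp i])
  else
    let: (q', a) := delta q [ffun i => scanned (tp i)] in
    (q', [ffun i => act (tp i) (a i)]).

Definition outputs_within (t : nat) (x y : word) : Prop :=
  let c := iter t step (init_config x) in
  final c.1 /\ word_of_tape (c.2 ord0) = y.

End Run.

Definition oracle_free (M : machine) : Prop := forall q : ctrl M, ask q = None.

(* Every bit is preceded by a 1 and the word is closed by a 0, so that
   concatenated codes can be parsed uniquely. *)
Definition delimit (x : word) : word :=
  flatten [seq [:: true; b] | b <- x] ++ [:: false].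

Definition encode_words (xs : seq word) : word := flatten (map delimit xs).

Definition polytime_decidable (A : pred word) : Prop :=
  exists (M : machine) (p : {poly nat}), oracle_free M /\
    forall x, outputs_within M id p.[size x]%R x [:: A x].

Definition sharpP (f : word -> nat) : Prop :=
  exists (V : pred word) (p : {poly nat}), polytime_decidable V /\
    forall x, f x =
      #|[set y : (p.[size x]%R).-tuple bool | V (encode_words [:: x; val y])]|.

(* Binary notation, least significant bit first; [bits 0] is empty. *)
Definition bits (n : nat) : word :=
  [seq odd (n %/ 2 ^ i) | i <- iota 0 (up_log 2 n.+1)].

Definition value_of_bits (x : word) : nat :=
  foldr (fun (b : bool) v => b + v.*2) 0 x.

(* A search problem relates an input word to its admissible answers. *)
Definition search_problem := word -> word -> Prop.

Definition solves (O : word -> word) (Pb : search_problem) : Prop :=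
  forall x, Pb x (O x).

Definition poly_length (O : word -> word) : Prop :=
  exists q : {poly nat}, forall x, size (O x) <= q.[size x]%R.

(* Hardness under polynomial-time Turing reductions. Since answers of a search
   problem are neither unique nor a priori short, the oracle is an arbitrary
   solver whose answers have polynomially bounded length; the reduction does
   not depend on the solver, its running time may depend on that length
   bound. *)
Definition sharpP_hard (Pb : search_problem) : Prop :=
  forall f : word -> nat, sharpP f ->
  exists M : machine,
  forall O : word -> word, solves O Pb -> poly_length O ->
  exists p : {poly nat}, forall x : word,
  exists2 y : word, outputs_within M O p.[size x]%R x y & value_of_bits y = f x.

(* The flow relation is split into its place-transition and
   transition-place parts. *)
Record net (P T : finType) := Net {
  flow_pt : {set P * T};
  flow_tp : {set T * P};
  source : P;
  sink : P }.

Section Nets.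
Variables (P T : finType) (N : net P T).

Definition flow : rel (P + T) := fun x y =>
  match x, y with
  | inl p, inr t => (p, t) \in flow_pt N
  | inr t, inl p => (t, p) \in flow_tp N
  | _, _ => false
  end.

Definition pre (t : T) : {set P} := [set p | (p, t) \in flow_pt N].
Definition post (t : T) : {set P} := [set p | (t, p) \in flow_tp N].
Definition place_post (p : P) : {set T} := [set t | (p, t) \in flow_pt N].

Definition workflow_net : Prop :=
  [/\ forall x, ~~ flow x (inl (source N)),
      forall x, ~~ flow (inl (sink N)) x
    & forall x y, connect
        (fun u v => flow u v || ((u, v) == (inl (sink N), inl (source N)))) x y].

Definition marking := {ffun P -> nat}.

Definition mark (A : {set P}) : marking := [ffun p => (p \in A : nat)].

Definition enabled_at (M : marking) (t : T) : bool :=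
  [forall p in pre t, 0 < M p].

Definition fire (M : marking) (t : T) : marking :=
  [ffun p => M p - (p \in pre t) + (p \in post t)].

Fixpoint fire_seq (M : marking) (s : seq T) : option marking :=
  if s is t :: s' then
    if enabled_at M t then fire_seq (fire M t) s' else None
  else Some M.

Definition reachable (M M' : marking) : Prop :=
  exists s : seq T, fire_seq M s = Some M'.

Definition sound : Prop :=
  forall M, reachable (mark [set source N]) M ->
            reachable M (mark [set sink N]).

Definition acyclic : Prop := forall x y, flow x y -> ~~ connect flow y x.

Definition free_choice : Prop :=
  forall p1 p2, place_post p1 :&: place_post p2 != set0 ->
                place_post p1 = place_post p2.

Definition one_safe : Prop :=
  forall M, reachable (mark [set source N]) M -> forall p, M p <= 1.

(* From here on markings are 1-safe and identified with sets of places. *)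
Definition enabled (A : {set P}) (t : T) : bool := enabled_at (mark A) t.

Definition fire_set (A : {set P}) (t : T) : {set P} :=
  (A :\: pre t) :|: post t.

Definition independent (t u : T) : bool := [disjoint pre t & pre u].

Definition conflict_set (t : T) (A : {set P}) : {set T} :=
  [set u | enabled A u && ~~ independent t u].

Definition conflict_sets (A : {set P}) : {set {set T}} :=
  [set conflict_set t A | t : T & enabled A t].

Definition confusion_free : Prop :=
  forall (A : {set P}), reachable (mark [set source N]) (mark A) ->
  forall t u, enabled A t -> enabled A u -> independent t u ->
    conflict_set u A = conflict_set u (A :\: pre t) /\
    conflict_set u A = conflict_set u (fire_set A t).

End Nets.

Record tpwn (P T : finType) := TPWN {
  net_of :> net P T;
  weight : T -> rat;
  tau : T -> nat }.

Definition is_tpwn (P T : finType) (W : tpwn P T) : Prop :=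
  [/\ workflow_net W, one_safe W, confusion_free W
    & forall t, (0 < weight W t)%R].

(* [None] is bottom. *)
Definition max_bot (a b : option nat) : option nat :=
  match a, b with
  | Some m, Some n => Some (maxn m n)
  | Some _, None => a
  | None, _ => b
  end.

Section Timing.
Variables (P T : finType) (W : tpwn P T).

Definition timestamps := {ffun P -> option nat}.

Definition upd (x : timestamps) (t : T) : timestamps :=
  [ffun p =>
     if p \in post W t then
       omap (addn (tau W t)) (\big[max_bot/None]_(q in pre W t) x q)
     else if p \in pre W t then None
     else x p].

Definition init_timestamps : timestamps :=
  [ffun p => if p == source W then Some 0 else None].

Definition time_of (s : seq T) : option nat :=
  \big[max_bot/None]_(p : P) foldl upd init_timestamps s p.

End Timing.

(* [inl A] is the marking [A], [inr (A, t)] the pair of [A] and a transition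
   [t] chosen at [A]. *)
Definition state (P T : finType) := ({set P} + {set P} * T)%type.

HB.instance Definition _ (P T : finType) := Finite.on (state P T).

Definition fired (P T : finType) (h : seq (state P T)) : seq T :=
  pmap (fun s : state P T => if s is inr (_, t) then Some t else None) h.

Section MDP.
Variables (P T : finType) (W : tpwn P T).

Definition init_state : state P T := inl [set source W].
Definition sink_state : state P T := inl [set sink W].

(* The distribution available after a finite path is named by its conflict
   set; [S (s0 :: h)] is the one chosen after the path [s0 :: h]. *)
Definition scheduler (S : seq (state P T) -> {set T}) : Prop :=
  forall (s0 : state P T) (h : seq (state P T)) (A : {set P}),
    last s0 h = inl A -> [exists t, enabled W A t] ->
    S (s0 :: h) \in conflict_sets W A.

Definition next_prob (S : seq (state P T) -> {set T})
    (s0 : state P T) (h : seq (state P T)) (s : state P T) : rat :=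
  match last s0 h with
  | inl A =>
      if [exists t, enabled W A t] then
        let C := S (s0 :: h) in
        if s is inr (B, t) then
          if (B == A) && (t \in C) then
            (weight W t / \sum_(u in C) weight W u)%R
          else 0%R
        else 0%R
      else ((s == inl A)%:R)%R
  | inr (A, t) => ((s == inl (fire_set W A t))%:R)%R
  end.

End MDP.

Record instance := Instance {
  nplaces : nat;
  ntrans : nat;
  wnet : tpwn 'I_nplaces 'I_ntrans;
  eps : rat }.

Definition admissible (I : instance) : Prop :=
  let W := wnet I in
  [/\ is_tpwn W, [/\ sound W, acyclic W & free_choice W],
      forall t, [/\ weight W t = 1%R, tau W t <= 1
                  & #|\bigcup_(p in pre W t) place_post W p| <= 2]
    & (0 < eps I)%R].

(* The numerator is encoded without its sign: only positive rationals occur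
   in admissible instances. *)
Definition rat_words (q : rat) : seq word :=
  [:: bits (absz (numq q)); bits (absz (denq q))].

Definition encode (I : instance) : word :=
  let W := wnet I in
  encode_words (
    [:: bits (nplaces I); bits (ntrans I);
        bits (source W); bits (sink W);
        [seq (pt \in flow_pt W) | pt <- [seq (p, t) | p <- enum 'I_(nplaces I),
                                                     t <- enum 'I_(ntrans I)]];
        [seq (tp \in flow_tp W) | tp <- [seq (t, p) | t <- enum 'I_(ntrans I),
                                                     p <- enum 'I_(nplaces I)]]]
    ++ flatten [seq rat_words (weight W t) | t <- enum 'I_(ntrans I)]
    ++ [seq bits (tau W t) | t <- enum 'I_(ntrans I)]
    ++ rat_words (eps I)).

Definition denotes_rat (y : word) (r : rat) : Prop :=
  exists (s : bool) (n d : word),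
    [/\ y = encode_words [:: [:: s]; n; d], 0 < value_of_bits d
      & r = ((-1) ^+ s * (value_of_bits n)%:R / (value_of_bits d)%:R)%R].

From mathcomp Require Import all_classical all_reals all_analysis.

HB.instance Definition _ (P T : finType) :=
  isPointed.Build (state P T) (inl finset.set0).

Section ExpectedTime.
Variables (P T : finType) (W : tpwn P T) (R : realType).

Definition cylinder (h : seq (state P T)) : set (nat -> state P T) :=
  [set pi | mkseq pi (size h) = h]%classic.

Definition cylinders : set (set (nat -> state P T)) := range cylinder.

Definition path_space := g_sigma_algebraType cylinders.

(* [Pr] is the measure Prob^S: the probability measure on infinite paths that
   gives every cylinder the product of the one-step probabilities. *)
Definition induced_by (S : seq (state P T) -> {set T})
    (Pr : probability path_space R) : Prop :=
  (forall s, Pr (cylinder [:: s]) = ((s == init_state W)%:R)%:E) /\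
  (forall s0 h s, Pr (cylinder (rcons (s0 :: h) s)) =
     (Pr (cylinder (s0 :: h)) * (ratr (next_prob W S s0 h s))%:E)%E).

(* [time_of] is never bottom at the sink marking, so the default of [odflt] is
   immaterial. *)
Definition time_to_sink (pi : path_space) : \bar R :=
  match pselect (exists n, pi n == sink_state W) with
  | left visit =>
      ((odflt 0 (time_of W (fired (mkseq pi (ex_minn visit).+1))))%:R)%:E
  | right _ => +oo%E
  end.

Definition expected_time (Pr : probability path_space R) : \bar R :=
  (\int[Pr]_(pi in setT) time_to_sink pi)%E.

(* ET_W is the common value of the expected times under all schedulers. *)
Definition approximates_ET (r e : rat) : Prop :=
  forall (S : seq (state P T) -> {set T}) (Pr : probability path_space R),
    scheduler W S -> induced_by S Pr ->
    ((ratr (r - e))%:E < expected_time Pr < (ratr (r + e))%:E)%E.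

End ExpectedTime.

(* Words that encode no admissible instance carry no requirement. *)
Definition ET_approximation (R : realType) : search_problem := fun x y =>
  forall I : instance, admissible I -> x = encode I ->
  exists2 r : rat, denotes_rat y r & approximates_ET (wnet I) R r (eps I).

(* Main.v *)
(* The Cook-Levin tableau turns a #P function into a number of satisfying
   assignments: the tableau of an accepting computation is determined by the
   witness. A conjunction of [m] clauses over [n] variables becomes a free-choice
   net that chooses the values of the variables by fair coins and draws one more
   coin per clause; its running time is 2 if some satisfied clause has its coin
   up, and 1 otherwise (one clause being a tautology). An assignment [s] leaves
   the running time at 1 with probability [2 ^ (unsat s - m)], so
     ET = 2 - 2 ^ (- (n + m)) * sum_s 2 ^ (unsat s),
   where [unsat s] is the number of clauses violated by [s]. When every clause is
   repeated [n + 1] times, all terms of the sum but those of the satisfying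
   assignments are divisible by [2 ^ (n + 1)], so the count is the sum modulo
   [2 ^ (n + 1)], and an approximation of ET to within [2 ^ (- (n + m) - 1)]
   determines the sum.

   The polynomial-time bound is obtained by composing functions on words that
   are computed by programs for registers, each of which is a tape. *)
From HB Require Import structures.
Require Import Defs.
From mathcomp Require Import all_boot all_order all_algebra.
From mathcomp Require Import all_classical all_reals all_analysis.
From mathcomp Require Import measurable_realfun zify ring lra.

Set Implicit Arguments.
Unset Strict Implicit.
Unset Printing Implicit Defensive.
Import Order.TTheory GRing.Theory Num.Theory.

(** * Register programs and their compilation to machines *)

(** Synchronisation takes maxima, so delays by themselves compute only disjunctions: over the
    literals of a clause, then over the clauses. The coin of a clause is what turns the number of
    satisfied clauses into a probability. A delay belongs to a transition and not to an arc, so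
    every message from a variable to a clause gets a transition of its own.

    The oracle's promise quantifies over all schedulers and all measures that they induce. To
    extract a number from it, one such pair has to be exhibited, so the analytic obstacle is to
    construct a probability measure on infinite paths. Once all coins are tossed in advance the run
    is deterministic, and an average of finitely many Dirac measures has the right cylinder
    probabilities; these become counts of coin assignments, and the expectation becomes a finite
    sum.

    The tolerance is exponentially small, but in binary it costs only polynomially many bits. The
    numbers of nodes, steps and columns are polynomially bounded, which is why programs may compute
    with them in unary; long binary arithmetic occurs only in reading the answer. *)

Definition store := nat -> word.

Definition upd_reg (s : store) (r : nat) (w : word) : store :=
  fun r' => if r' == r then w else s r'.

(* Register [1] is the one that holds queries and answers. *)
Inductive cmd :=
| Skip
| Push of nat & bool
| Pop of nat
| Ask
| Seq of cmd & cmd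
| Case of nat & cmd & cmd & cmd
| While of nat & cmd.

(* The step count is the exact number of steps of the compiled machine. *)
Inductive exec (O : word -> word) : cmd -> store -> nat -> store -> Prop :=
| ExecSkip s : exec O Skip s 1 s
| ExecPush r b s : exec O (Push r b) s 2 (upd_reg s r (b :: s r))
| ExecPop r s : exec O (Pop r) s 1 (upd_reg s r (behead (s r)))
| ExecAsk s : exec O Ask s 1 (upd_reg s 1 (O (s 1)))
| ExecSeq c1 c2 s n1 s1 n2 s2 : exec O c1 s n1 s1 -> exec O c2 s1 n2 s2 ->
    exec O (Seq c1 c2) s (n1 + n2) s2
| ExecCase r c c0 c1 s n s' :
    exec O (if s r is b :: _ then if b then c1 else c0 else c) s n s' ->
    exec O (Case r c c0 c1) s n.+1 s'
| ExecWhileEnd r c s : s r = [::] -> exec O (While r c) s 1 s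
| ExecWhile r c s n1 s1 n2 s2 : s r != [::] -> exec O c s n1 s1 ->
    exec O (While r c) s1 n2 s2 -> exec O (While r c) s (n1 + n2).+1 s2.

(** Program points become control states. [Push] has two of them because [act] writes before it
    moves: one step moves left, the next one writes. The additional [None] of [Case] and [While] is
    the test. *)
Fixpoint points (c : cmd) : finType :=
  match c with
  | Push _ _ => bool
  | Seq c1 c2 => (points c1 + points c2)%type
  | Case _ c c0 c1 => option (points c + (points c0 + points c1))
  | While _ c => option (points c)
  | _ => unit
  end.

Fixpoint entry (c : cmd) : points c :=
  match c return points c with
  | Push _ _ => true
  | Seq c1 _ => inl (entry c1)
  | Case _ _ _ _ => None
  | While _ _ => None
  | _ => tt
  end.

(** [None] stands for leaving a command; [e] is the point at which the enclosing command then
    continues. *)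
Definition goto (A B : Type) (f : A -> B) (e : option B) (x : option A) : option B :=
  if x is Some a then Some (f a) else e.

Fixpoint next_point (c : cmd) : points c -> (nat -> symbol) -> option (points c) :=
  match c return points c -> (nat -> symbol) -> option (points c) with
  | Push _ _ => fun p _ => if p then Some false else None
  | Seq c1 c2 => fun p v =>
      match p with
      | inl p1 => goto inl (Some (inr (entry c2))) (next_point p1 v)
      | inr p2 => goto inr None (next_point p2 v)
      end
  | Case r c c0 c1 => fun p v =>
      match p with
      | None => Some (Some (match v r with
                            | None => inl (entry c)
                            | Some false => inr (inl (entry c0))
                            | Some true => inr (inr (entry c1))
                            end))
      | Some (inl q) => goto (Some \o inl) None (next_point q v)
      | Some (inr (inl q)) => goto (Some \o (inr \o inl)) None (next_point q v)
      | Some (inr (inr q)) => goto (Some \o (inr \o inr)) None (next_point q v)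
      end
  | While r c => fun p v =>
      match p with
      | None => if v r is Some _ then Some (Some (entry c)) else None
      | Some q => goto Some (Some None) (next_point q v)
      end
  | _ => fun _ _ => None
  end.

Fixpoint asks (c : cmd) : points c -> bool :=
  match c return points c -> bool with
  | Ask => fun _ => true
  | Seq c1 c2 => fun p => match p with inl q => asks q | inr q => asks q end
  | Case r c c0 c1 => fun p =>
      match p with
      | None => false
      | Some (inl q) => asks q
      | Some (inr (inl q)) => asks q
      | Some (inr (inr q)) => asks q
      end
  | While r c => fun p => if p is Some q then asks q else false
  | _ => fun _ => false
  end.

Definition act_on (r : nat) (a : symbol * move) (v : nat -> symbol) (r' : nat) :=
  if r' == r then a else (v r', Stay).

Fixpoint action (c : cmd) : points c -> (nat -> symbol) -> nat -> symbol * move :=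
  match c return points c -> (nat -> symbol) -> nat -> symbol * move with
  | Push r b => fun p v =>
      act_on r (if p then (v r, GoLeft) else (Some b, Stay)) v
  | Pop r => fun _ v => act_on r (None, GoRight) v
  | Seq c1 c2 => fun p => match p with inl q => action q | inr q => action q end
  | Case r c c0 c1 => fun p v =>
      match p with
      | None => fun r' => (v r', Stay)
      | Some (inl q) => action q v
      | Some (inr (inl q)) => action q v
      | Some (inr (inr q)) => action q v
      end
  | While r c => fun p v =>
      if p is Some q then action q v else fun r' => (v r', Stay)
  | _ => fun _ v r' => (v r', Stay)
  end.

(** Explicit blanks may trail the word, since each step rewrites the scanned cell and thereby
    materialises a blank. The cells on the left are unconstrained: a push overwrites the cell that
    it enters. *)
Definition holds (c : tape) (w : word) : Prop :=
  exists k, c.2 = map Some w ++ nseq k None.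

Definition holds_all (tp : nat -> tape) (s : store) : Prop :=
  forall r, holds (tp r) (s r).

Lemma holds_stay c w : holds c w -> holds (act c (scanned c, Stay)) w.
Proof.
case: c => l r [k /= ->]; case: w => [|b w] /=.
  by case: k => [|k]; [exists 1 | exists k.+1].
by exists k.
Qed.

Lemma holds_scanned c w : holds c w -> scanned c = ohead w.
Proof. by case: c => l r [k]; rewrite /scanned /= => ->; case: w => //; case: k. Qed.

Lemma holds_word c w : holds c w -> word_of_tape c = w.
Proof.
case: c => l r [k]; rewrite /word_of_tape /= => ->.
by elim: w => [|b w /= ->] //; case: k.
Qed.

Lemma holds_tape_of_word w : holds (tape_of_word w) w.
Proof. by exists 0; rewrite cats0. Qed.

Lemma holds_pop c w : holds c w -> holds (act c (None, GoRight)) (behead w).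
Proof.
case: c => l r [k /= ->]; case: w => [|b w] /=; last by exists k.
by exists k.-1; case: k.
Qed.

Lemma holds_push c w b : holds c w ->
  holds (act (act c (scanned c, GoLeft)) (Some b, Stay)) (b :: w).
Proof.
by move=> /holds_stay; case: c => l r [k]; rewrite /act /holds /= => ->; exists k.
Qed.

Section Simulation.
Variable O : word -> word.

Definition point_step (c : cmd) (p : points c) (tp : nat -> tape) :
    option (points c) * (nat -> tape) :=
  let v := scanned \o tp in
  (next_point p v,
   if asks p then
     fun r => if r == 1 then tape_of_word (O (word_of_tape (tp 1))) else tp r
   else fun r => act (tp r) (action p v r)).

Inductive runs (c : cmd) : option (points c) -> (nat -> tape) -> nat ->
    option (points c) -> (nat -> tape) -> Prop :=
| RunsStop q tp : runs q tp 0 q tp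
| RunsStep p tp n q' tp' :
    runs (point_step p tp).1 (point_step p tp).2 n q' tp' ->
    runs (Some p) tp n.+1 q' tp'.

Lemma runs_trans c (q1 q2 q3 : option (points c)) tp1 tp2 tp3 n1 n2 :
  runs q1 tp1 n1 q2 tp2 -> runs q2 tp2 n2 q3 tp3 -> runs q1 tp1 (n1 + n2) q3 tp3.
Proof.
elim=> [//|p tp n q' tp' _ IH h]; rewrite addSn; apply: RunsStep; exact: IH.
Qed.

Lemma runs_embed c d (f : points c -> points d) e q tp n q' tp' :
  (forall p tp, point_step (f p) tp = (goto f e (point_step p tp).1, (point_step p tp).2)) ->
  runs q tp n q' tp' -> runs (goto f e q) tp n (goto f e q') tp'.
Proof.
move=> hf; elim=> [*|p {}tp {}n {}q' {}tp' _ IH]; first exact: RunsStop.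
by apply: RunsStep; rewrite hf.
Qed.

(** By induction on the execution: [runs_embed] transports the run of a part into the points of the
    whole, with the exit of the part redirected by [goto]. *)
Lemma exec_runs c s n s' : exec O c s n s' -> forall tp, holds_all tp s ->
  exists2 tp', runs (Some (entry c)) tp n None tp' & holds_all tp' s'.
Proof.
have one d (p : points d) tp : next_point p (scanned \o tp) = None ->
    runs (Some p) tp 1 None (point_step p tp).2.
  by move=> h; apply: RunsStep; rewrite /= h; exact: RunsStop.
elim => {c s n s'}.
- move=> s tp h; eexists; first exact: one.
  by move=> r /=; apply: holds_stay.
- move=> r b s tp h; eexists.
    by apply: RunsStep => /=; apply: one.
  move=> r' /=; rewrite /upd_reg /act_on; have [->|/negPf n] := eqVneq r' r.
    by rewrite ?eqxx; exact: holds_push.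
  by rewrite /= n; exact: (holds_stay (holds_stay (h r'))).
- move=> r s tp h; eexists; first exact: one.
  move=> r' /=; rewrite /upd_reg /act_on; case: eqP => [->|_]; first exact: holds_pop.
  exact: holds_stay.
- move=> s tp h; eexists; first exact: one.
  move=> r /=; rewrite /upd_reg; case: eqP => // _.
  by rewrite (holds_word (h 1)); exact: holds_tape_of_word.
- move=> c1 c2 s n1 s1 n2 s2 _ IH1 _ IH2 tp /IH1[tp1 r1 /IH2[tp2 r2 h2]].
  exists tp2 => //; apply: (@runs_trans (Seq c1 c2) _ (Some (inr (entry c2)))).
    exact: (@runs_embed c1 (Seq c1 c2) inl (Some (inr (entry c2))) _ _ _ _ _ _ r1).
  exact: (@runs_embed c2 (Seq c1 c2) inr None _ _ _ _ _ _ r2).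
- move=> r c c0 c1 s n s' _ IH tp h.
  have h0 : holds_all (point_step (entry (Case r c c0 c1)) tp).2 s.
    by move=> r'; apply: holds_stay.
  have [tp' r1 h1] := IH _ h0; exists tp' => //; apply: RunsStep.
  rewrite [X in runs X]/= (holds_scanned (h r)).
  case: (s r) r1 => [|[] w] /= r1.
  + exact: (@runs_embed c (Case r c c0 c1) (Some \o inl) None _ _ _ _ _ _ r1).
  + exact: (@runs_embed c1 (Case r c c0 c1) (Some \o (inr \o inr)) None _ _ _ _ _ _ r1).
  + exact: (@runs_embed c0 (Case r c c0 c1) (Some \o (inr \o inl)) None _ _ _ _ _ _ r1).
- move=> r c s sr tp h; eexists.
    by apply: one; rewrite /= (holds_scanned (h r)) sr.
  by move=> r'; apply: holds_stay.
- move=> r c s n1 s1 n2 s2 sr _ IH1 _ IH2 tp h.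
  have h0 : holds_all (point_step (entry (While r c)) tp).2 s.
    by move=> r'; apply: holds_stay.
  have [tp1 r1 /IH2[tp2 r2 h2]] := IH1 _ h0.
  exists tp2 => //; apply: RunsStep.
  rewrite [X in runs X]/= (holds_scanned (h r)).
  case: (s r) sr => [|b w] //= _.
  apply: runs_trans r2.
  exact: (@runs_embed c (While r c) Some (Some None) _ _ _ _ _ _ r1).
Qed.

End Simulation.

(** * Compilation to a machine with finitely many tapes *)

Fixpoint max_reg (c : cmd) : nat :=
  match c with
  | Push r _ | Pop r => r
  | Seq c1 c2 => maxn (max_reg c1) (max_reg c2)
  | Case r c c0 c1 => maxn r (maxn (max_reg c) (maxn (max_reg c0) (max_reg c1)))
  | While r c => maxn r (max_reg c)
  | _ => 0
  end.

(** Programs may name any register, whereas a machine has a fixed number of tapes; tests therefore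
    must not depend on registers above [max_reg]. *)
Lemma next_point_ext c (p : points c) (v v' : nat -> symbol) :
  (forall r, r <= max_reg c -> v r = v' r) -> next_point p v = next_point p v'.
Proof.
elim: c p => //=.
- by move=> c1 IH1 c2 IH2 [p|p] h; rewrite (IH1, IH2) // => r hr; apply: h;
    rewrite leq_max hr ?orbT.
- move=> r c IH c0 IH0 c1 IH1 [[p|[p|p]]|] h.
  + by rewrite IH // => r' hr; apply: h; rewrite !leq_max hr !orbT.
  + by rewrite IH0 // => r' hr; apply: h; rewrite !leq_max hr !orbT.
  + by rewrite IH1 // => r' hr; apply: h; rewrite !leq_max hr !orbT.
  + by rewrite h // leq_maxl.
- move=> r c IH [p|] h; last by rewrite h // leq_maxl.
  by rewrite IH // => r' hr; apply: h; rewrite !leq_max hr !orbT.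
Qed.

Lemma action_ext c (p : points c) (v v' : nat -> symbol) r :
  v r = v' r -> action p v r = action p v' r.
Proof.
elim: c p => //=.
- by move=> _ h; rewrite h.
- by move=> r' b [] h; rewrite /act_on; case: eqP h => [->|_] h; rewrite ?h.
- by move=> r' _ h; rewrite /act_on; case: eqP h => [->|_] h; rewrite ?h.
- by move=> _ h; rewrite h.
- by move=> c1 IH1 c2 IH2 [p|p]; [exact: IH1|exact: IH2].
- by move=> r' c IH c0 IH0 c1 IH1 [[p|[p|p]]|] h; [exact: IH|exact: IH0|exact: IH1|rewrite h].
- by move=> r' c IH [p|] h; [exact: IH|rewrite h].
Qed.

(** An oracle state has to name its successor without seeing the tapes, so [compile] computes that
    successor from the blank view. *)
Lemma next_point_asks c (p : points c) v v' : asks p -> next_point p v = next_point p v'.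
Proof.
elim: c p => //=.
- by move=> c1 IH1 c2 IH2 [p|p] h; rewrite (IH1, IH2).
- by move=> r c IH c0 IH0 c1 IH1 [[p|[p|p]]|] // h; rewrite ?IH ?IH0 ?IH1.
- by move=> r c IH [p|] // h; rewrite IH.
Qed.

Section Compile.
Variable c : cmd.
Let k := max_reg c.

(* An involution on [0, k + 1] that gives register [1] the last tape. *)
Definition swap_tape (i : nat) : nat :=
  if i == k.+1 then 1 else if i == 1 then k.+1 else i.

Lemma swap_tapeK i : swap_tape (swap_tape i) = i.
Proof. by rewrite /swap_tape; do !case: eqP; move=> *; lia. Qed.

Lemma swap_tape_lt i : i < k.+2 -> swap_tape i < k.+2.
Proof. by rewrite /swap_tape; do !case: eqP; move=> *; lia. Qed.

Definition tape_view (v : {ffun 'I_k.+2 -> symbol}) (r : nat) : symbol :=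
  v (inord (swap_tape r)).

Definition compile : machine :=
  @Machine k (option (points c)) (Some (entry c)) (fun q => q == None)
    (fun q => if q is Some p then
                if asks p then Some (next_point p (fun=> None)) else None
              else None)
    (fun q v => if q is Some p then
                  (next_point p (tape_view v),
                   [ffun i : 'I_k.+2 => action p (tape_view v) (swap_tape i)])
                else (None, [ffun i => (v i, Stay)])).

Lemma runs_machine O q tp n q' tp' :
  runs O q tp n q' tp' -> forall m : {ffun 'I_k.+2 -> tape},
  (forall i, m i = tp (swap_tape i)) ->
  exists2 m' : {ffun 'I_k.+2 -> tape},
    iter n (@step compile O) (q, m) = (q', m') & forall i, m' i = tp' (swap_tape i).
Proof.
elim=> [{}q {}tp|p {}tp {}n {}q' {}tp' _ IH] m hm; first by exists m.
rewrite iterSr.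
set tpn := (point_step O p tp).2 in IH *.
have [m1 e1 hm1] : exists2 m1, @step compile O (Some p, m) = ((point_step O p tp).1, m1)
    & forall i, m1 i = tpn (swap_tape i).
  rewrite /step /= /tpn /point_step /=.
  case pa: (asks p).
    rewrite (next_point_asks _ (scanned \o tp) pa); eexists; first by [].
    move=> i; rewrite ffunE -val_eqE /=.
    case: eqP => [ei|ni].
      by rewrite hm /swap_tape ei !eqxx.
    rewrite hm; case: eqP => // e; case: ni.
    have := swap_tapeK i; rewrite e /swap_tape; case: eqP; [lia | by rewrite eqxx; lia].
  have hv r : r < k.+2 -> tape_view [ffun i => scanned (m i)] r = (scanned \o tp) r.
    move=> hr; rewrite /tape_view ffunE hm inordK ?swap_tapeK //.
    exact: swap_tape_lt.
  rewrite (@next_point_ext _ _ _ (scanned \o tp)); last by move=> r hr; apply: hv; lia.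
  eexists; first by [].
  move=> i; rewrite !ffunE hm; congr act; apply: action_ext; apply: hv.
  exact: swap_tape_lt.
by rewrite e1; apply: IH.
Qed.

Lemma compile_outputs O x n s' t : 0 < max_reg c ->
  exec O c (fun r => if r == 0 then x else [::]) n s' -> n <= t ->
  outputs_within compile O t x (s' 0).
Proof.
move=> k0 /exec_runs h nt.
pose tp r := if r == 0 then tape_of_word x else ([::], [::]).
have [|tp' hr hh] := h tp.
  move=> r; rewrite /tp; case: eqP => _; first exact: holds_tape_of_word.
  by exists 0.
have [|m' em hm'] := runs_machine hr (m := (init_config compile x).2).
  move=> i; rewrite ffunE /tp /swap_tape -val_eqE /=.
  by rewrite -/k in k0; do !case: eqP => //; lia.
(* Final configurations are fixed points of [step], which turns the exact number of steps into an
   upper bound [t]. *)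
have stop j q : iter j (@step compile O) (None, q) = (None, q).
  by elim: j => // j IH; rewrite iterSr.
rewrite /outputs_within -(subnK nt) iterD.
rewrite (_ : init_config compile x = (Some (entry c), (init_config compile x).2)) //.
rewrite em stop /=; split => //.
by rewrite hm' (_ : swap_tape _ = 0) //; apply: holds_word.
Qed.

End Compile.

(** The closed form is monotone at sight and closed under sums, products and composition; its base
    [n.+1] is positive, so larger exponents dominate at 0 too. *)
Definition polyb (b : nat -> nat) : Prop :=
  exists a k, forall n, b n <= a * n.+1 ^ k.

Lemma leq_expl k m n : m <= n -> m ^ k <= n ^ k.
Proof. by move=> h; case: k => // k; rewrite leq_exp2r. Qed.

Lemma polyb_const c : polyb (fun=> c).
Proof. by exists c, 0 => n; rewrite muln1. Qed.

Lemma polyb_id : polyb id.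
Proof. by exists 1, 1 => n; rewrite mul1n expn1. Qed.

Lemma polyb_succ : polyb succn.
Proof. by exists 1, 1 => n; rewrite mul1n expn1. Qed.

Lemma polyb_add b b' : polyb b -> polyb b' -> polyb (fun n => b n + b' n).
Proof.
move=> [a [k hb]] [a' [k' hb']]; exists (a + a'), (k + k') => n.
rewrite mulnDl leq_add //.
  by apply: (leq_trans (hb n)); rewrite leq_mul2l leq_pexp2l ?orbT ?leq_addr.
by apply: (leq_trans (hb' n)); rewrite leq_mul2l leq_pexp2l ?orbT ?leq_addl.
Qed.

Lemma polyb_mul b b' : polyb b -> polyb b' -> polyb (fun n => b n * b' n).
Proof.
move=> [a [k hb]] [a' [k' hb']]; exists (a * a'), (k + k') => n.
by rewrite expnD mulnACA leq_mul.
Qed.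

Lemma polyb_comp b b' : polyb b -> polyb b' -> polyb (fun n => b (b' n)).
Proof.
move=> [a [k hb]] pb'.
have := polyb_add pb' (polyb_const 1); case=> a' [k' hb'].
exists (a * a' ^ k), (k' * k) => n; apply: (leq_trans (hb _)).
rewrite -mulnA leq_mul2l expnM -expnMn leq_expl ?orbT //.
by have := hb' n; rewrite addn1.
Qed.

(** Running times are bounds applied to bounds on sizes, so the outer bound of such a composition
    has to be monotone. *)
Lemma polyb_mono b : polyb b ->
  exists b', [/\ {homo b' : m n / m <= n}, polyb b' & forall n, b n <= b' n].
Proof.
move=> [a [k hb]]; exists (fun n => a * n.+1 ^ k); split=> //.
  by move=> m n h; rewrite leq_mul2l leq_expl ?orbT.
by exists a, k.
Qed.

Definition total (xs : seq word) : nat := sumn (map size xs).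

Lemma total_cat xs ys : total (xs ++ ys) = total xs + total ys.
Proof. by rewrite /total map_cat sumn_cat. Qed.

Lemma total_nth xs i : size (nth [::] xs i) <= total xs.
Proof.
elim: xs i => [|x xs IH] [|i] //=; first by rewrite leq_addr.
by apply: leq_trans (IH i) _; rewrite leq_addl.
Qed.

Definition does (O : word -> word) (c : cmd) (t : nat) (s s' : store) : Prop :=
  exists2 n, n <= t & exec O c s n s'.

Section Does.
Variable O : word -> word.

Lemma does_weak c t t' s s' : t <= t' -> does O c t s s' -> does O c t' s s'.
Proof. by move=> h [n hn e]; exists n => //; apply: leq_trans h. Qed.

Lemma does_eq c t t' s s' s'' : does O c t s s' -> t <= t' -> s' = s'' ->
  does O c t' s s''.
Proof. by move=> h ht <-; apply: does_weak h. Qed.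

Lemma does_skip s : does O Skip 1 s s.
Proof. by exists 1 => //; constructor. Qed.

Lemma does_push r b s : does O (Push r b) 2 s (upd_reg s r (b :: s r)).
Proof. by exists 2 => //; constructor. Qed.

Lemma does_pop r s : does O (Pop r) 1 s (upd_reg s r (behead (s r))).
Proof. by exists 1 => //; constructor. Qed.

Lemma does_seq c1 c2 t1 t2 s s1 s2 :
  does O c1 t1 s s1 -> does O c2 t2 s1 s2 -> does O (Seq c1 c2) (t1 + t2) s s2.
Proof.
by move=> [n1 h1 e1] [n2 h2 e2]; exists (n1 + n2); [apply: leq_add | econstructor; eauto].
Qed.

Lemma does_case r c c0 c1 t s s' :
  does O (if s r is b :: _ then if b then c1 else c0 else c) t s s' ->
  does O (Case r c c0 c1) t.+1 s s'.
Proof. by move=> [n h e]; exists n.+1 => //; constructor. Qed.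

Lemma does_while_end r c s : s r = [::] -> does O (While r c) 1 s s.
Proof. by move=> h; exists 1 => //; constructor. Qed.

Lemma does_while r c t1 t2 s s1 s2 : s r != [::] -> does O c t1 s s1 ->
  does O (While r c) t2 s1 s2 -> does O (While r c) (t1 + t2).+1 s s2.
Proof.
move=> h [n1 h1 e1] [n2 h2 e2]; exists (n1 + n2).+1; first by rewrite ltnS leq_add.
by apply: ExecWhile e2.
Qed.

Ltac store_eq :=
  apply/funext => z; rewrite /upd_reg /=;
  repeat (case: eqP => [?|?]; subst => //=); try congruence; try lia.

Definition clear r := While r (Pop r).

Lemma does_clear r s : does O (clear r) (2 * size (s r) + 1) s (upd_reg s r [::]).
Proof.
move: {2}(s r) (erefl (s r)) => w; elim: w s => [|b w IH] s sr; rewrite sr.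
  apply: (does_eq (does_while_end _ _)) => //.
  by apply/funext => z; rewrite /upd_reg; case: eqP => // ->.
apply: (does_eq (does_while _ (does_pop r s) (IH _ _))) => //.
- by rewrite sr.
- by rewrite /upd_reg eqxx sr.
- by rewrite /upd_reg eqxx sr /=; lia.
- by store_eq.
Qed.

Definition reverse_onto r r' :=
  While r (Seq (Case r Skip (Push r' false) (Push r' true)) (Pop r)).

Lemma does_reverse_onto r r' s : r != r' ->
  does O (reverse_onto r r') (5 * size (s r) + 1) s
    (upd_reg (upd_reg s r' (catrev (s r) (s r'))) r [::]).
Proof.
move=> /eqP ne; move: {2}(s r) (erefl (s r)) => w; elim: w s => [|b w IH] s sr.
  rewrite sr; apply: (does_eq (does_while_end _ _)) => //.
  by store_eq.
have h : does O (Case r Skip (Push r' false) (Push r' true)) 3 s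
    (upd_reg s r' (b :: s r')).
  by apply: does_case; rewrite sr; case: b {IH sr}; apply: does_push.
apply: (does_eq (does_while _ (does_seq h (does_pop _ _)) (IH _ _))) => //.
- by rewrite sr.
- by rewrite /upd_reg eqxx; case: eqP => //; rewrite sr.
- by rewrite /upd_reg eqxx; case: eqP => // _; rewrite sr /=; lia.
- apply/funext => z; rewrite /upd_reg; case: (eqVneq z r) => // zr.
  rewrite !eqxx; do !case: (eqVneq _ _) => ? //; try congruence.
  by rewrite sr.
Qed.

Definition reverse_onto2 t r r' :=
  While t (Seq (Case t Skip (Seq (Push r false) (Push r' false))
                            (Seq (Push r true) (Push r' true))) (Pop t)).

Lemma does_reverse_onto2 t r r' s : t != r -> t != r' -> r != r' ->
  does O (reverse_onto2 t r r') (7 * size (s t) + 1) s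
    (upd_reg (upd_reg (upd_reg s r (catrev (s t) (s r)))
                      r' (catrev (s t) (s r'))) t [::]).
Proof.
move=> /eqP tr /eqP tr' /eqP rr'; move: {2}(s t) (erefl (s t)) => w.
elim: w s => [|b w IH] s sr.
  rewrite sr; apply: (does_eq (does_while_end _ _)) => //.
  by store_eq.
have h : does O (Case t Skip (Seq (Push r false) (Push r' false))
                            (Seq (Push r true) (Push r' true))) 5 s
    (upd_reg (upd_reg s r (b :: s r)) r' (b :: s r')).
  apply: does_case; rewrite sr; case: b {IH sr};
    apply: (does_eq (does_seq (does_push _ _ _) (does_push _ _ _))) => //;
    by rewrite /upd_reg; case: eqP => // /esym.
apply: (does_eq (does_while _ (does_seq h (does_pop _ _)) (IH _ _))) => //.
- by rewrite sr.
- by rewrite /upd_reg eqxx; do !case: eqP => //; rewrite sr.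
- by rewrite /upd_reg eqxx; do !case: eqP => //; rewrite sr /=; lia.
- apply/funext => z; rewrite /upd_reg; case: (eqVneq z t) => // zr.
  rewrite !eqxx; do !case: (eqVneq _ _) => ? //; try congruence; by rewrite sr.
Qed.

(** Reading a register consumes it: the word is poured in reverse onto the scratch register [t] and
    then back onto both [r] and [r']. *)
Definition copy r r' t := Seq (reverse_onto r t) (reverse_onto2 t r r').

Lemma does_copy r r' t s : r != r' -> r != t -> r' != t -> s t = [::] -> s r' = [::] ->
  does O (copy r r' t) (12 * size (s r) + 2) s (upd_reg s r' (s r)).
Proof.
move=> rr' rt r't st sr'.
apply: (does_eq (does_seq (does_reverse_onto s rt) (does_reverse_onto2 _ _ _ _))) => //.
- by rewrite eq_sym.
- by rewrite eq_sym.
- rewrite /upd_reg eqxx eq_sym (negPf rt) st; rewrite catrevE cats0 size_rev; lia.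
- apply/funext => z; rewrite /upd_reg !eqxx !(eq_sym t) (negPf rt) (negPf r't) (eq_sym r').
  rewrite (negPf rr') st sr' !catrevE !cats0 !revK.
  case: (eqVneq z t) => [->|_]; first by rewrite ?(eq_sym t) ?(negPf r't) ?(negPf rt) ?st.
  rewrite ?(negPf r't) ?cats0.
  by case: (eqVneq z r) => [->|_]; rewrite ?(negPf rr') //; case: eqP.
Qed.

Definition shift r r' t := Seq (reverse_onto r t) (reverse_onto t r').

Lemma does_shift r r' t s : r != r' -> r != t -> r' != t -> s t = [::] -> s r' = [::] ->
  does O (shift r r' t) (10 * size (s r) + 2) s (upd_reg (upd_reg s r' (s r)) r [::]).
Proof.
move=> rr' rt r't st sr'.
apply: (does_eq (does_seq (does_reverse_onto s rt) (does_reverse_onto _ _))) => //.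
- by rewrite eq_sym.
- rewrite /upd_reg eqxx eq_sym (negPf rt) st; rewrite catrevE cats0 size_rev; lia.
- apply/funext => z; rewrite /upd_reg !eqxx !(eq_sym t) (negPf rt) (eq_sym r').
  rewrite (negPf rr') st sr' !catrevE !cats0 !revK.
  case: (eqVneq z t) => [->|_]; first by rewrite ?(eq_sym t) ?(negPf r't) ?(negPf rt) ?st.
  rewrite ?(negPf r't) ?cats0.
  by case: (eqVneq z r) => [->|_]; rewrite ?(negPf rr') //; case: eqP.
Qed.

Lemma iota_cats1 o m : iota o m.+1 = iota o m ++ [:: o + m].
Proof. by rewrite -addn1 iotaD. Qed.

Fixpoint clears o m :=
  if m is m'.+1 then Seq (clears o m') (clear (o + m')) else Skip.

Lemma does_clears o m s :
  does O (clears o m) (2 * total (map s (iota o m)) + m + 1) s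
    (fun r => if o <= r < o + m then [::] else s r).
Proof.
elim: m => [|m IH].
  apply: (does_eq (does_skip s)); first by rewrite addn1.
  by apply/funext => z; case: ifP => // /andP[]; lia.
apply: (does_eq (does_seq IH (does_clear _ _))).
  rewrite iota_cats1 map_cat total_cat {3}/total /= ifF; [lia | apply/negbTE; lia].
apply/funext => z; rewrite /upd_reg; case: eqP => [->|zn].
  by rewrite ifT //; lia.
by congr (if _ then _ else _); lia.
Qed.

Fixpoint shifts o o' m t :=
  if m is m'.+1 then Seq (shifts o o' m' t) (shift (o + m') (o' + m') t) else Skip.

Lemma does_shifts o o' m t s : o' + m <= o -> o + m <= t -> s t = [::] ->
  (forall r, o' <= r < o' + m -> s r = [::]) ->
  does O (shifts o o' m t) (10 * total (map s (iota o m)) + 2 * m + 1) s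
    (fun r => if o' <= r < o' + m then s (o + (r - o')) else
              if o <= r < o + m then [::] else s r).
Proof.
move=> h1 h2 st so'; elim: m h1 h2 so' => [|m IH] h1 h2 so'.
  apply: (does_eq (does_skip s)) => //.
  by apply/funext => z; rewrite !ifF //; apply/negbTE; lia.
have {}IH := IH ltac:(lia) ltac:(lia) (fun r h => so' r ltac:(lia)).
apply: (does_eq (does_seq IH (does_shift _ _ _ _ _))); try lia.
- by rewrite !ifF ?st //; apply/negbTE; lia.
- by rewrite !ifF ?so' //; try (apply/negbTE); lia.
- rewrite iota_cats1 map_cat total_cat {3}/total /= !ifF; try (apply/negbTE; lia); lia.
apply/funext => z; rewrite /upd_reg.
case: (eqVneq z (o + m)) => [->|zn].
  by rewrite ifF ?ifT //; try (apply/negbTE); lia.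
case: (eqVneq z (o' + m)) => [->|zn'].
  rewrite [RHS]ifT; last by lia.
  rewrite !ifF; try (apply/negbTE; lia).
  by congr (s _); lia.
rewrite (_ : (o' <= z < o' + m) = (o' <= z < o' + m.+1)); last by lia.
by rewrite (_ : (o <= z < o + m) = (o <= z < o + m.+1)) //; lia.
Qed.

End Does.

(** * Polynomial-time word functions *)

Ltac polyb_tac :=
  repeat (cbv beta; match goal with
  | |- polyb _ => assumption
  | |- polyb (fun n => n) => exact: polyb_id
  | |- polyb (fun _ => ?c) => exact: polyb_const
  | |- polyb succn => exact: polyb_succ
  | |- polyb (fun n => @?f n + @?g n) => apply: (@polyb_add f g)
  | |- polyb (fun n => @?f n * @?g n) => apply: (@polyb_mul f g)
  | |- polyb (fun n => ?f (@?g n)) => apply: (@polyb_comp f g)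
  end).

Definition put (s : store) (o : nat) (ws : seq word) : store :=
  fun r => if o <= r < o + size ws then nth [::] ws (r - o) else s r.

Definition ready (ins : seq nat) (o m base : nat) (s : store) : Prop :=
  [/\ all (fun r => (r < base) && ~~ (o <= r < o + m)) ins, o + m <= base,
      forall r, o <= r < o + m -> s r = [::]
    & forall r, base <= r -> s r = [::]].

(* A program for [F] reads the registers [ins], writes its [m] results into
   the registers [o, ..., o + m - 1] and uses the registers from [base] on as
   scratch space, which it leaves empty. *)
Definition FPm (m : nat) (F : seq word -> seq word) : Prop :=
  exists (C : seq nat -> nat -> nat -> cmd) (b : nat -> nat),
  [/\ {homo b : x y / x <= y}, polyb b, forall xs, size (F xs) = m,
      forall xs, total (F xs) <= b (total xs)
    & forall O ins o base s, ready ins o m base s ->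
      does O (C ins o base) (b (total (map s ins))) s (put s o (F (map s ins)))].

Lemma map_put s o ws ins :
  all (fun r => ~~ (o <= r < o + size ws)) ins -> map (put s o ws) ins = map s ins.
Proof. by move=> h; apply/eq_in_map => r /(allP h) /negbTE; rewrite /put => ->. Qed.

Lemma map_iota_eq (s : store) o m (ws : seq word) : size ws = m ->
  (forall i, i < m -> s (o + i) = nth [::] ws i) -> map s (iota o m) = ws.
Proof.
move=> sz h; apply: (@eq_from_nth _ [::]); first by rewrite size_map size_iota.
by move=> i; rewrite size_map size_iota => im; rewrite (nth_map 0) ?size_iota // nth_iota // h.
Qed.

Lemma FPm_ext m F G : F =1 G -> FPm m F -> FPm m G.
Proof.
move=> e [C [b [h1 h2 h3 h4 h5]]]; exists C, b; split=> // [xs|xs|O ins o base s hr].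
- by rewrite -e.
- by rewrite -e.
- by rewrite -e; apply: h5.
Qed.

Lemma FPm_nth i : FPm 1 (fun xs => [:: nth [::] xs i]).
Proof.
exists (fun ins o base => if i < size ins then copy (nth 0 ins i) o base else Skip).
exists (fun n => 12 * n + 2); split=> //.
- by move=> x y; lia.
- by polyb_tac.
- by move=> xs; have := total_nth xs i; rewrite {2}/total /=; lia.
move=> O ins o base s [h1 h2 h3 h4]; case: ltnP => hi.
  have /(allP h1)/andP[ha hb] : nth 0 ins i \in ins by apply: mem_nth.
  apply: (does_eq (does_copy _ _ _ _ _ _)).
  - by apply: contra hb => /eqP->; lia.
  - by move: ha; rewrite ltn_neqAle => /andP[].
  - by apply/eqP; lia.
  - exact: h4.
  - by apply: h3; lia.
  - have := total_nth (map s ins) i; rewrite (nth_map 0) //; lia.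
  - apply/funext => z; rewrite /put /upd_reg /= (nth_map 0) // addn1 ltnS eqn_leq andbC.
    by case: ifP => // hz; rewrite (_ : z - o = 0) //; lia.
rewrite (nth_default _ (n := i)) ?size_map //.
apply: (does_eq (does_skip _ _)); first by lia.
apply/funext => z; rewrite /put /=; case: ifP => // hz.
by rewrite h3 // ; case: (z - o) => //= n; rewrite nth_nil.
Qed.

Lemma FPm_empty : FPm 1 (fun=> [:: [::]]).
Proof.
exists (fun _ _ _ => Skip), (fun=> 1); split=> //; first exact: polyb_const.
move=> O ins o base s [_ _ h _]; apply: (does_eq (does_skip _ _)) => //.
apply/funext => z; rewrite /put /=; case: ifP => // hz.
by rewrite h //; case: (z - o) => //= n; rewrite nth_nil.
Qed.

Lemma FPm_cons b f : FPm 1 (fun xs => [:: f xs]) -> FPm 1 (fun xs => [:: b :: f xs]).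
Proof.
move=> [C [b1 [h1 h2 _ h4 h5]]].
exists (fun ins o base => Seq (C ins o base) (Push o b)), (fun n => b1 n + 2).
split=> //.
- by move=> x y /h1; lia.
- exact: polyb_add h2 (polyb_const _).
- by move=> xs; have := h4 xs; rewrite /total /=; lia.
move=> O ins o base s /h5 h; apply: (does_eq (does_seq (h O) (does_push _ _ _ _))) => //.
apply/funext => z; rewrite /put /upd_reg /=; case: eqP => [->|zo].
  by rewrite !ifT ?subnn //; lia.
by case: ifP => // hz; lia.
Qed.

Lemma FPm_behead f : FPm 1 (fun xs => [:: f xs]) -> FPm 1 (fun xs => [:: behead (f xs)]).
Proof.
move=> [C [b1 [h1 h2 _ h4 h5]]].
exists (fun ins o base => Seq (C ins o base) (Pop o)), (fun n => b1 n + 1).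
split=> //.
- by move=> x y /h1; lia.
- exact: polyb_add h2 (polyb_const _).
- by move=> xs; have := h4 xs; rewrite /total /= size_behead; lia.
move=> O ins o base s /h5 h; apply: (does_eq (does_seq (h O) (does_pop _ _ _))) => //.
apply/funext => z; rewrite /put /upd_reg /=; case: eqP => [->|zo].
  by rewrite !ifT ?subnn //; lia.
by case: ifP => // hz; lia.
Qed.

Lemma FPm_cat m p F G : FPm m F -> FPm p G -> FPm (m + p) (fun xs => F xs ++ G xs).
Proof.
move=> [C [b [h1 h2 h3 h4 h5]]] [C' [b' [h1' h2' h3' h4' h5']]].
exists (fun ins o base => Seq (C ins o base) (C' ins (o + m) base)), (fun n => b n + b' n).
split=> //.
- by move=> x y h; rewrite leq_add ?h1 ?h1'.
- exact: polyb_add.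
- by move=> xs; rewrite size_cat h3 h3'.
- by move=> xs; rewrite total_cat leq_add.
move=> O ins o base s [r1 r2 r3 r4].
have e : map (put s o (F (map s ins))) ins = map s ins.
  by apply: map_put; apply: sub_all r1 => r /andP[_]; rewrite h3; apply: contra; lia.
have q : does O (C ins o base) (b (total (map s ins))) s (put s o (F (map s ins))).
  apply: h5; split=> //.
  - by apply: sub_all r1 => r /andP[-> /=]; apply: contra; lia.
  - by lia.
  - by move=> r hr; apply: r3; lia.
have q' : does O (C' ins (o + m) base) (b' (total (map s ins))) (put s o (F (map s ins)))
    (put (put s o (F (map s ins))) (o + m) (G (map s ins))).
  suff hr : ready ins (o + m) p base (put s o (F (map s ins))).
    by have := h5' O _ _ _ _ hr; rewrite e.
  split=> //.
  - by apply: sub_all r1 => r /andP[-> /=]; apply: contra; lia.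
  - by lia.
  - by move=> r hr; rewrite /put h3 ifF; [apply: r3 | apply/negbTE]; lia.
  - by move=> r hr; rewrite /put h3 ifF; [apply: r4 | apply/negbTE]; lia.
apply: (does_eq (does_seq q q')) => //.
apply/funext => z; rewrite /put size_cat h3 h3' nth_cat h3.
by do !case: ifP => ? //; try lia; congr nth; lia.
Qed.

(* [sel] is any natural transformation that only drops or permutes items. *)
Lemma FPm_select m F (sel : forall A : Type, seq A -> seq A) :
  (forall A B (f : A -> B) l, sel B (map f l) = map f (sel A l)) ->
  (forall A (P : pred A) l, all P l -> all P (sel A l)) ->
  (forall xs, total (sel _ xs) <= total xs) ->
  FPm m F -> FPm m (fun xs => F (sel _ xs)).
Proof.
move=> s1 s2 s3 [C [b [h1 h2 h3 h4 h5]]].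
exists (fun ins => C (sel _ ins)), b; split=> //.
  by move=> xs; apply: leq_trans (h4 _) _; apply: h1.
move=> O ins o base s [r1 r2 r3 r4]; rewrite s1.
apply: does_weak (h5 _ _ _ _ _ _); first by rewrite -s1; apply: h1.
by split=> //; apply: s2.
Qed.

Lemma FPm_drop m F k : FPm m F -> FPm m (fun xs => F (drop k xs)).
Proof.
apply: (@FPm_select _ _ (fun A => @drop A k)).
- by move=> *; rewrite map_drop.
- by move=> A P l; rewrite -{1}(cat_take_drop k l) all_cat => /andP[].
- by move=> xs; rewrite -{2}(cat_take_drop k xs) total_cat leq_addl.
Qed.

Lemma FPm_take m F k : FPm m F -> FPm m (fun xs => F (take k xs)).
Proof.
apply: (@FPm_select _ _ (fun A => @take A k)).
- by move=> *; rewrite map_take.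
- by move=> A P l; rewrite -{1}(cat_take_drop k l) all_cat => /andP[].
- by move=> xs; rewrite -{2}(cat_take_drop k xs) total_cat leq_addr.
Qed.

(** Environments behave like de Bruijn contexts: intermediate results stand in front of the inputs,
    in scratch registers that are cleared at the end. *)
Lemma FPm_let m p F G : FPm m F -> FPm p G -> FPm p (fun xs => G (F xs ++ xs)).
Proof.
move=> [C [b [h1 h2 h3 h4 h5]]] [C' [b' [h1' h2' h3' h4' h5']]].
exists (fun ins o base => Seq (C ins base (base + m))
  (Seq (C' (iota base m ++ ins) o (base + m)) (clears base m))).
exists (fun n => b n + (b' (b n + n) + (2 * b n + m + 1))); split=> //.
- move=> x y h; have := h1 _ _ h; move=> hb.
  by rewrite leq_add // leq_add ?h1' ?leq_add // ?leq_mul2l ?hb.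
- by polyb_tac.
- move=> xs; apply: leq_trans (h4' _) _; rewrite total_cat.
  apply: (leq_trans (h1' _ (b (total xs) + total xs) _)); first by rewrite leq_add2r.
  by lia.
move=> O ins o base s [r1 r2 r3 r4].
set xs := map s ins.
have q : does O (C ins base (base + m)) (b (total xs)) s (put s base (F xs)).
  apply: h5; split=> //.
  - by apply: sub_all r1 => r; lia.
  - by move=> r hr; apply: r4; lia.
  - by move=> r hr; apply: r4; lia.
have e : map (put s base (F xs)) (iota base m ++ ins) = F xs ++ xs.
  rewrite map_cat (@map_put _ _ _ ins); last by apply: sub_all r1 => r; lia.
  congr (_ ++ _); apply: map_iota_eq => // i im.
  by rewrite /put h3 ifT ?addKn //; lia.
have q' : does O (C' (iota base m ++ ins) o (base + m)) (b' (b (total xs) + total xs))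
    (put s base (F xs)) (put (put s base (F xs)) o (G (F xs ++ xs))).
  suff hr : ready (iota base m ++ ins) o p (base + m) (put s base (F xs)).
    have := h5' O _ _ _ _ hr; rewrite e; apply: does_weak.
    by rewrite total_cat; apply: h1'; rewrite leq_add2r.
  split.
  - rewrite all_cat; apply/andP; split; last by apply: sub_all r1 => r; lia.
    by apply/allP => r; rewrite mem_iota; lia.
  - by lia.
  - by move=> r hr; rewrite /put h3 ifF; [apply: r3 | apply/negbTE]; lia.
  - by move=> r hr; rewrite /put h3 ifF; [apply: r4 | apply/negbTE]; lia.
apply: (does_eq (does_seq q (does_seq q' (does_clears _ _ _ _)))).
  rewrite !leq_add2l !leq_add2r leq_mul2l /= (_ : map _ _ = F xs) ?h4 //.
  apply: map_iota_eq => // i im.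
  rewrite /put h3' h3 ifF; last by apply/negbTE; lia.
  by rewrite ifT ?addKn //; lia.
apply/funext => z; rewrite /put h3 h3'.
by do !case: ifP => ? //; try lia; rewrite r4 //; lia.
Qed.

Lemma FPm_comp m p F G : FPm m F -> FPm p G -> FPm p (fun xs => G (F xs)).
Proof.
move=> hF hG; have sF xs : size (F xs) = m by case: hF => [C [b [_ _ ->]]].
apply: FPm_ext (FPm_let hF (FPm_take m hG)) => xs.
by rewrite take_size_cat.
Qed.

Lemma FPm_if m c F G : FPm 1 (fun xs => [:: c xs]) -> FPm m F -> FPm m G ->
  FPm m (fun xs => if head false (c xs) then F xs else G xs).
Proof.
move=> [C [b [h1 h2 _ h4 h5]]] [C1 [b1 [h11 h12 h13 h14 h15]]]
  [C2 [b2 [h21 h22 h23 h24 h25]]].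
exists (fun ins o base => Seq (C ins base base.+1) (Seq
  (Case base (C2 ins o base.+1) (C2 ins o base.+1) (C1 ins o base.+1)) (clear base))).
exists (fun n => b n + ((b1 n + b2 n).+1 + (2 * b n + 1))); split=> //.
- move=> x y h; have := h1 _ _ h; have := h11 _ _ h; have := h21 _ _ h; lia.
- by polyb_tac.
- by move=> xs; case: ifP => _; rewrite ?h13 ?h23.
- by move=> xs; case: ifP => _; [have := h14 xs | have := h24 xs]; lia.
move=> O ins o base s [r1 r2 r3 r4].
set xs := map s ins.
have q : does O (C ins base base.+1) (b (total xs)) s (put s base [:: c xs]).
  apply: h5; split=> //.
  - by apply: sub_all r1 => r; lia.
  - by rewrite addn1.
  - by move=> r hr; apply: r4; lia.
  - by move=> r hr; apply: r4; lia.
have e : map (put s base [:: c xs]) ins = xs.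
  by apply: map_put; apply: sub_all r1 => r /=; lia.
have r : ready ins o m base.+1 (put s base [:: c xs]).
  split=> //.
  - by apply: sub_all r1 => r; lia.
  - by lia.
  - by move=> r hr; rewrite /put /= ifF; [apply: r3 | apply/negbTE]; lia.
  - by move=> r hr; rewrite /put /= ifF; [apply: r4 | apply/negbTE]; lia.
have cb : put s base [:: c xs] base = c xs by rewrite /put /= ifT ?subnn //; lia.
set v := if head false (c xs) then F xs else G xs.
have q' : does O (Case base (C2 ins o base.+1) (C2 ins o base.+1) (C1 ins o base.+1))
    (b1 (total xs) + b2 (total xs)).+1 (put s base [:: c xs]) (put (put s base [:: c xs]) o v).
  have k1 := h15 O _ _ _ _ r; have k2 := h25 O _ _ _ _ r.
  rewrite e in k1 k2; apply: does_case; rewrite cb /v.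
  by move: k1 k2; case: (c xs) => [|[] w] /= k1 k2;
    [apply: does_weak k2 | apply: does_weak k1 | apply: does_weak k2]; lia.
have sv : size v = m by rewrite /v; case: ifP.
have vb : put (put s base [:: c xs]) o v base = c xs.
  by rewrite {1}/put sv ifF //; apply/negbTE; lia.
apply: (does_eq (does_seq q (does_seq q' (does_clear _ _ _)))).
  by rewrite vb; have := h4 xs; rewrite {1}/total /=; lia.
apply/funext => z; rewrite /upd_reg; case: eqP => [->|zb].
  by rewrite /put sv ifF ?r4 //; apply/negbTE; lia.
by rewrite /put; case: ifP => // _; rewrite ifF //=; apply/negbTE; lia.
Qed.

(** * Loops over the bits of a word *)

Section Loop.
Variables (m : nat) (init step : seq word -> seq word) (w : seq word -> word).

Definition loop (xs : seq word) (v : word) : seq word :=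
  foldl (fun acc b => step ([:: b] :: acc ++ xs)) (init xs) v.

(** A polynomial-time body that is iterated polynomially often may still blow up its data. The bound
    [B] on every intermediate accumulator excludes this and gives all passes a common polynomial
    cost. *)
Lemma FPm_loop B : FPm m init -> FPm m step -> FPm 1 (fun xs => [:: w xs]) -> polyb B ->
  (forall xs k, total (loop xs (take k (w xs))) <= B (total xs)) ->
  FPm m (fun xs => loop xs (w xs)).
Proof.
move=> [Ci [bi [i1 i2 i3 i4 i5]]] [Cs [bs [s1 s2 s3 s4 s5]]] [Cw [bw [w1 w2 _ w4 w5]]].
move=> /polyb_mono[B' [B1 B2 B3]] hB.
have {B B3 hB} hB xs k : total (loop xs (take k (w xs))) <= B' (total xs).
  exact: leq_trans (hB _ _) (B3 _).
have sloop xs v : size (loop xs v) = m.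
  by rewrite /loop; elim/last_ind: v => [|v b _]; rewrite ?foldl_rcons ?s3 //= i3.
(* Register [base] holds the unread bits and [base.+1] the current one. The new accumulator is
   computed at [base.+2], since the body still reads the old one at [o], and is then moved down. *)
pose body ins o base :=
  Seq (Case base Skip (Push base.+1 false) (Push base.+1 true)) (Seq (Pop base)
  (Seq (Cs (base.+1 :: iota o m ++ ins) base.+2 (base.+2 + m)) (Seq (clears o m)
  (Seq (shifts base.+2 o m (base.+2 + m)) (Pop base.+1))))).
pose tb n := bs (1 + B' n + n) + 12 * B' n + 3 * m + 8.
exists (fun ins o base => Seq (Cw ins base base.+1) (Seq (Ci ins o base.+1)
   (While base (body ins o base)))).
exists (fun n => bw n + (bi n + (bw n * tb n + 1)) + B' n).
have tb1 : {homo tb : x y / x <= y}.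
  move=> x y h; rewrite /tb; have := B1 _ _ h => hb.
  have := s1 (1 + B' x + x) (1 + B' y + y) ltac:(lia); lia.
split=> //.
- move=> x y h; have := w1 _ _ h; have := i1 _ _ h; have := B1 _ _ h.
  have := leq_mul (w1 _ _ h) (tb1 _ _ h); lia.
- by rewrite /tb; polyb_tac.
- by move=> xs; have := hB xs (size (w xs)); rewrite take_size; lia.
move=> O ins o base s [r1 r2 r3 r4].
set xs := map s ins.
(* The store at the loop head, with accumulator [acc] and unread word [v]. *)
pose st acc v : store := fun r =>
  if o <= r < o + m then nth [::] acc (r - o) else if r == base then v else s r.
have stins acc v : map (st acc v) ins = xs.
  apply/eq_in_map => r /(allP r1) hr; rewrite /st ifF; last by apply/negbTE; lia.
  by case: eqP => // ?; lia.
(* One unit of [tb] is reserved for the loop test, hence the predecessor in the time bound. *)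
have step_body acc b v : size acc = m -> total acc <= B' (total xs) ->
    total (step ([:: b] :: acc ++ xs)) <= B' (total xs) ->
    does O (body ins o base) (tb (total xs)).-1
      (st acc (b :: v)) (st (step ([:: b] :: acc ++ xs)) v).
  move=> sa ta tn; set nw := step _ in tn *.
  have sn : size nw = m by rewrite /nw s3.
  have st0 : st acc (b :: v) base = b :: v.
    by rewrite /st eqxx ifF //; apply/negbTE; lia.
  have st1 : st acc (b :: v) base.+1 = [::].
    rewrite /st ifF; last by apply/negbTE; lia.
    by rewrite ifF ?r4 //; lia.
  pose S1 := upd_reg (st acc (b :: v)) base.+1 [:: b].
  have d1 : does O (Case base Skip (Push base.+1 false) (Push base.+1 true)) 3
      (st acc (b :: v)) S1.
    apply: does_case; rewrite st0.
    rewrite (_ : (if b then _ else _) = Push base.+1 b); last by case: (b).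
    by have := does_push O base.+1 b (st acc (b :: v)); rewrite st1.
  pose S2 := upd_reg S1 base v.
  have d2 : does O (Pop base) 1 S1 S2.
    apply: (does_eq (does_pop _ _ _)) => //; rewrite /S2; congr upd_reg.
    by rewrite /S1 /upd_reg ifF ?st0 //; lia.
  have e2 : map S2 (base.+1 :: iota o m ++ ins) = [:: b] :: acc ++ xs.
    rewrite /= map_cat; congr (_ :: _ ++ _).
    - by rewrite /S2 /S1 /upd_reg eqxx ifF //; lia.
    - apply: map_iota_eq => // i im; rewrite /S2 /S1 /upd_reg !ifF; try lia.
      by rewrite /st ifT ?addKn //; lia.
    - rewrite -(stins acc (b :: v)); apply/eq_in_map => r /(allP r1) hr.
      by rewrite /S2 /S1 /upd_reg !ifF //; lia.
  pose S3 := put S2 base.+2 nw.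
  have d3 : does O (Cs (base.+1 :: iota o m ++ ins) base.+2 (base.+2 + m))
      (bs (1 + B' (total xs) + total xs)) S2 S3.
    suff hr : ready (base.+1 :: iota o m ++ ins) base.+2 m (base.+2 + m) S2.
      have := s5 O _ _ _ _ hr; rewrite e2; apply: does_weak.
      by apply: s1; rewrite {1}/total /= map_cat sumn_cat -!/(total _); lia.
    split=> //.
    - rewrite /= all_cat; apply/and3P; split; first by lia.
        by apply/allP => r; rewrite mem_iota; lia.
      by apply: sub_all r1 => r; lia.
    - move=> r hr; rewrite /S2 /S1 /upd_reg !ifF; try lia.
      rewrite /st !ifF; first by apply: r4; lia.
        by lia.
      by apply/negbTE; lia.
    - move=> r hr; rewrite /S2 /S1 /upd_reg !ifF; try lia.
      rewrite /st !ifF; first by apply: r4; lia.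
        by lia.
      by apply/negbTE; lia.
  have d4 := does_clears O o m S3.
  set S4 := (fun r => _) in d4.
  have e3 : map S3 (iota o m) = acc.
    apply: map_iota_eq => // i im; rewrite /S3 /put sn ifF; last by apply/negbTE; lia.
    by rewrite /S2 /S1 /upd_reg !ifF; try lia; rewrite /st ifT ?addKn //; lia.
  have a1 : S4 (base.+2 + m) = [::].
    rewrite /S4 ifF; last by apply/negbTE; lia.
    rewrite /S3 /put sn ifF; last by apply/negbTE; lia.
    rewrite /S2 /S1 /upd_reg !ifF; try lia.
    rewrite /st !ifF; first by apply: r4; lia.
      by lia.
    by apply/negbTE; lia.
  have a2 r : o <= r < o + m -> S4 r = [::] by move=> hr; rewrite /S4 hr.
  have a3 : o + m <= base.+2 by lia.
  have d5 := does_shifts O a3 (leqnn _) a1 a2.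
  have e4 : map S4 (iota base.+2 m) = nw.
    apply: map_iota_eq => // i im; rewrite /S4 ifF; last by apply/negbTE; lia.
    by rewrite /S3 /put sn ifT ?addKn //; lia.
  rewrite e3 in d4; rewrite e4 in d5.
  apply: (does_eq (does_seq d1 (does_seq d2 (does_seq d3 (does_seq d4
    (does_seq d5 (does_pop _ _ _))))))); first by rewrite /tb; lia.
  have sb : S3 base.+1 = [:: b].
    rewrite /S3 /put sn ifF; last by apply/negbTE; lia.
    by rewrite /S2 /S1 /upd_reg eqxx ifF //; lia.
  apply/funext => z; rewrite /upd_reg; case: (eqVneq z base.+1) => [->|zb].
    rewrite [in LHS]ifF; last by apply/negbTE; lia.
    rewrite [in LHS]ifF; last by apply/negbTE; lia.
    rewrite /S4 ifF; last by apply/negbTE; lia.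
    rewrite sb /= /st ifF; last by apply/negbTE; lia.
    by rewrite ifF ?r4 //; lia.
  rewrite {1}/st; case: (boolP (o <= z < o + m)) => hz.
    rewrite /S4 ifF; last by apply/negbTE; lia.
    by rewrite /S3 /put sn ifT ?addKn //; lia.
  case: ifP => hz2.
    by rewrite ifF ?r4 //; lia.
  rewrite /S4 (negPf hz) /S3 /put sn hz2 /S2 /S1 /upd_reg (negPf zb) /st (negPf hz).
  by case: eqP.
have dwhile v0 v : w xs = v0 ++ v ->
    does O (While base (body ins o base)) (size v * tb (total xs) + 1)
      (st (loop xs v0) v) (st (loop xs (v0 ++ v)) [::]).
  elim: v v0 => [|b v IH] v0 ev.
    rewrite cats0; apply: (does_eq (does_while_end _ _ _)) => //.
    by rewrite /st eqxx ifF //; apply/negbTE; lia.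
  have IH' := IH (rcons v0 b); rewrite cat_rcons in IH'.
  have h0 : total (loop xs v0) <= B' (total xs).
    by have := hB xs (size v0); rewrite ev take_size_cat.
  have h1 : total (step ([:: b] :: loop xs v0 ++ xs)) <= B' (total xs).
    have := hB xs (size (rcons v0 b)); rewrite ev -cat_rcons take_size_cat //.
    by rewrite /loop foldl_rcons.
  have d := step_body _ b v (sloop _ _) h0 h1.
  apply: (does_eq (does_while _ d _)) => //.
  - by rewrite /st eqxx ifF //; apply/negbTE; lia.
  - rewrite (_ : step _ = loop xs (rcons v0 b)); first exact: IH'.
    by rewrite /loop foldl_rcons.
  - rewrite /tb /=; lia.
have q1 : does O (Cw ins base base.+1) (bw (total xs)) s (put s base [:: w xs]).
  apply: w5; split=> //.
  - by apply: sub_all r1 => r; lia.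
  - by rewrite addn1.
  - by move=> r hr; apply: r4; lia.
  - by move=> r hr; apply: r4; lia.
have e1 : map (put s base [:: w xs]) ins = xs.
  by apply: map_put; apply: sub_all r1 => r /=; lia.
have q2 : does O (Ci ins o base.+1) (bi (total xs)) (put s base [:: w xs])
    (st (init xs) (w xs)).
  have hr : ready ins o m base.+1 (put s base [:: w xs]).
    split=> //.
    - by apply: sub_all r1 => r; lia.
    - by lia.
    - by move=> r hr; rewrite /put /= ifF; [apply: r3 | apply/negbTE]; lia.
    - by move=> r hr; rewrite /put /= ifF; [apply: r4 | apply/negbTE]; lia.
  apply: (does_eq (i5 _ _ _ _ _ hr)); rewrite e1 //.
  apply/funext => z; rewrite /put /st i3 /=; case: ifP => // _.
  rewrite addn1 ltnS (eqn_leq z) andbC; case: ifP => // hz.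
  by rewrite (_ : z - base = 0) //; lia.
have q3 := dwhile [::] (w xs) erefl.
apply: (does_eq (does_seq q1 (does_seq q2 q3))).
- have := w4 xs; rewrite {1}/total /= addn0 => hw.
  have := leq_mul hw (leqnn (tb (total xs))); lia.
- apply/funext => z; rewrite /st /put sloop; case: ifP => // _.
  by case: eqP => [->|] //; rewrite r4.
Qed.

End Loop.

Definition FP (f : seq word -> word) : Prop := FPm 1 (fun xs => [:: f xs]).
Definition FPb (f : seq word -> bool) : Prop := FP (fun xs => [:: f xs]).
(* Numbers are passed around in unary. *)
Definition FPn (f : seq word -> nat) : Prop := FP (fun xs => nseq (f xs) true).

Lemma FP_ext f g : f =1 g -> FP f -> FP g.
Proof. by move=> e; apply: FPm_ext => xs; rewrite e. Qed.

Lemma FPb_ext f g : f =1 g -> FPb f -> FPb g.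
Proof. by move=> e; apply: FP_ext => xs; rewrite e. Qed.

Lemma FPn_ext f g : f =1 g -> FPn f -> FPn g.
Proof. by move=> e; apply: FP_ext => xs; rewrite e. Qed.

Lemma FP_size f : FP f ->
  exists b, [/\ {homo b : m n / m <= n}, polyb b & forall xs, size (f xs) <= b (total xs)].
Proof.
case=> C [b [h1 h2 _ h4 _]]; exists b; split=> // xs.
by have := h4 xs; rewrite {1}/total /= addn0.
Qed.

Lemma FP_nth i : FP (fun xs => nth [::] xs i).
Proof. exact: FPm_nth. Qed.

Lemma FP_const w : FP (fun=> w).
Proof. by elim: w => [|b w]; [apply: FPm_empty | apply: FPm_cons]. Qed.

Lemma FP_cons b f : FP f -> FP (fun xs => b :: f xs).
Proof. exact: FPm_cons. Qed.

Lemma FP_behead f : FP f -> FP (fun xs => behead (f xs)).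
Proof. exact: FPm_behead. Qed.

Lemma FP_drop_env f k : FP f -> FP (fun xs => f (drop k xs)).
Proof. exact: FPm_drop. Qed.

Lemma FP_shift f : FP f -> FP (fun xs => f (behead xs)).
Proof. by move=> h; apply: FP_ext (FP_drop_env 1 h) => xs; rewrite drop1. Qed.

Lemma FPn_shift f : FPn f -> FPn (fun xs => f (behead xs)).
Proof. exact: FP_shift. Qed.

Lemma FP_let f g : FP f -> FP g -> FP (fun xs => g (f xs :: xs)).
Proof. by move=> hf hg; apply: (FPm_let hf hg). Qed.

(** This serves the body of a counted loop. Once the index is bound, the environment consists of the
    index, the loop bit, the index again, the output and the rest; only the first and the last of
    these are kept. *)
Lemma FP_select13 f : FP f -> FP (fun xs => f (take 1 xs ++ drop 4 xs)).
Proof.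
apply: (@FPm_select 1 (fun xs => [:: f xs])
         (fun A (l : seq A) => take 1 l ++ drop 4 l)).
- by move=> *; rewrite map_cat map_take map_drop.
- move=> A P [|a [|b [|c [|d l]]]] //=; rewrite ?take0 ?drop0 ?cats0 //=;
    by case: (P a) => //= /and4P[].
- move=> [|a [|b [|c [|d l]]]] //=; rewrite ?take0 ?drop0 ?cats0 /total //=; lia.
Qed.

Lemma FP_if c f g : FPb c -> FP f -> FP g -> FP (fun xs => if c xs then f xs else g xs).
Proof.
by move=> hc hf hg; apply: FPm_ext (FPm_if hc hf hg) => xs /=; case: (c xs).
Qed.

Lemma FPb_head f : FP f -> FPb (fun xs => head false (f xs)).
Proof.
move=> h; apply: FPm_ext (FPm_if h (FP_const [:: true]) (FP_const [:: false])) => xs /=.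
by case: (head false _).
Qed.

Lemma FPb_const b : FPb (fun=> b).
Proof. exact: FP_const. Qed.

Lemma FPb_if c f g : FPb c -> FPb f -> FPb g -> FPb (fun xs => if c xs then f xs else g xs).
Proof. by move=> hc hf hg; apply: FP_ext (FP_if hc hf hg) => xs; case: (c xs). Qed.

Lemma FPb_not c : FPb c -> FPb (fun xs => ~~ c xs).
Proof. by move=> h; apply: FPb_ext (FPb_if h (FPb_const false) (FPb_const true)). Qed.

Lemma FPb_and c d : FPb c -> FPb d -> FPb (fun xs => c xs && d xs).
Proof. by move=> h k; apply: FPb_ext (FPb_if h k (FPb_const false)). Qed.

Lemma FPb_or c d : FPb c -> FPb d -> FPb (fun xs => c xs || d xs).
Proof. by move=> h k; apply: FPb_ext (FPb_if h (FPb_const true) k). Qed.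

Lemma FP_bcons c f : FPb c -> FP f -> FP (fun xs => c xs :: f xs).
Proof.
move=> hc hf; apply: FP_ext (FP_if hc (FP_cons true hf) (FP_cons false hf)) => xs.
by case: (c xs).
Qed.

(** If a pass adds at most an amount depending on the inputs alone, the accumulator stays below its
    initial size plus the number of passes times that amount. *)
Lemma FPm_loop_growth m init step w c :
  FPm m init -> FPm m step -> FP w -> polyb c ->
  (forall b acc xs, size acc = m ->
     total (step ([:: b] :: acc ++ xs)) <= total acc + c (total xs)) ->
  FPm m (fun xs => loop init step xs (w xs)).
Proof.
move=> hi hs hw pc hg.
have si xs : size (init xs) = m by case: hi => [C [b [_ _ ->]]].
have ss xs : size (step xs) = m by case: hs => [C [b [_ _ ->]]].
have [bi [_ pi ti]] : exists b, [/\ {homo b : m n / m <= n}, polyb b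
    & forall xs, total (init xs) <= b (total xs)].
  by case: hi => [C [b [h1 h2 _ h4 _]]]; exists b.
have [bw [_ pw tw]] := FP_size hw.
apply: (FPm_loop (B := fun n => bi n + bw n * c n)) => //; first by polyb_tac.
move=> xs k.
have hk : size (take k (w xs)) <= bw (total xs).
  by apply: leq_trans (tw xs); rewrite size_take_min geq_minr.
apply: (@leq_trans (total (init xs) + size (take k (w xs)) * c (total xs))); last first.
  by apply: leq_add => //; apply: leq_mul.
elim/last_ind: (take k (w xs)) => {k hk} [|v b IH]; first by rewrite addn0.
have sl : size (loop init step xs v) = m.
  by rewrite /loop; elim/last_ind: (v) => [|v' b' _] //=; rewrite foldl_rcons.
have := hg b _ xs sl; rewrite {3}/loop foldl_rcons -/(loop init step xs v) size_rcons.
by rewrite mulSn; lia.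
Qed.

Section FoldPair.
Variables (g1 g2 : bool -> word -> word -> seq word -> word).
Variables (a1 a2 : seq word -> word).

(** The common form of the bit-serial algorithms below: typically one accumulator is a state such as
    a carry or a remainder, the other collects output. *)
Definition fold_pair (xs : seq word) (w : word) : word * word :=
  foldl (fun p b => (g1 b p.1 p.2 xs, g2 b p.1 p.2 xs)) (a1 xs, a2 xs) w.

Definition FP_step (g : bool -> word -> word -> seq word -> word) : Prop :=
  FP (fun ys => g (head false (nth [::] ys 0)) (nth [::] ys 1) (nth [::] ys 2) (drop 3 ys)).

Lemma FP_fold_pair w c : FP_step g1 -> FP_step g2 -> FP a1 -> FP a2 -> FP w -> polyb c ->
  (forall b u v xs, size (g1 b u v xs) + size (g2 b u v xs) <=
                    size u + size v + c (total xs)) ->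
  FP (fun xs => (fold_pair xs (w xs)).1) /\ FP (fun xs => (fold_pair xs (w xs)).2).
Proof.
move=> h1 h2 ha1 ha2 hw pc hg.
pose step ys := [:: g1 (head false (nth [::] ys 0)) (nth [::] ys 1) (nth [::] ys 2) (drop 3 ys)]
  ++ [:: g2 (head false (nth [::] ys 0)) (nth [::] ys 1) (nth [::] ys 2) (drop 3 ys)].
pose init xs := [:: a1 xs] ++ [:: a2 xs].
have hl : FPm 2 (fun xs => loop init step xs (w xs)).
  apply: (@FPm_loop_growth _ _ _ _ c) => //.
  - exact: FPm_cat ha1 ha2.
  - exact: (FPm_cat h1 h2).
  - move=> b [|u [|v []]] //= xs _; rewrite /step /= drop0 /total /= !addn0.
    exact: hg.
have e xs v : loop init step xs v = [:: (fold_pair xs v).1; (fold_pair xs v).2].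
  rewrite /loop /fold_pair; elim/last_ind: v => // v b IH.
  by rewrite !foldl_rcons IH /step /= drop0.
split; [apply: FP_ext (FPm_comp hl (FP_nth 0)) | apply: FP_ext (FPm_comp hl (FP_nth 1))].
  by move=> xs; rewrite e.
by move=> xs; rewrite e.
Qed.

End FoldPair.

Lemma FP_foldl g a w c :
  FP (fun ys => g (head false (nth [::] ys 0)) (nth [::] ys 1) (drop 2 ys)) ->
  FP a -> FP w -> polyb c ->
  (forall b u xs, size (g b u xs) <= size u + c (total xs)) ->
  FP (fun xs => foldl (fun u b => g b u xs) (a xs) (w xs)).
Proof.
move=> hg ha hw pc bound.
pose step ys := [:: g (head false (nth [::] ys 0)) (nth [::] ys 1) (drop 2 ys)].
have hl : FPm 1 (fun xs => loop (fun xs => [:: a xs]) step xs (w xs)).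
  apply: (@FPm_loop_growth _ _ _ _ c) => //.
  move=> b [|u []] //= xs _; rewrite /step /= drop0 /total /= !addn0.
  exact: bound.
apply: FPm_ext hl => xs; rewrite /loop; elim/last_ind: (w xs) => // v b IH.
by rewrite !foldl_rcons IH /step /= drop0.
Qed.

Lemma FP_rev f : FP f -> FP (fun xs => rev (f xs)).
Proof.
move=> h; apply: (@FP_ext (fun xs => foldl (fun u b => b :: u) [::] (f xs))).
  move=> xs; by rewrite /rev; elim: (f xs) [::] => //= b w IH v; rewrite IH.
apply: (@FP_foldl (fun b u _ => b :: u) _ _ (fun=> 1)) => //.
- exact: FP_bcons (FPb_head (FP_nth 0)) (FP_nth 1).
- exact: FP_const.
- exact: polyb_const.
- by move=> b u xs; rewrite addn1.
Qed.

Lemma FP_cat f g : FP f -> FP g -> FP (fun xs => f xs ++ g xs).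
Proof.
move=> hf hg; apply: (@FP_ext (fun xs => foldl (fun u b => b :: u) (g xs) (rev (f xs)))).
  by move=> xs; rewrite foldl_rev; elim: (f xs) => //= b w ->.
apply: (@FP_foldl (fun b u _ => b :: u) _ _ (fun=> 1)) => //.
- exact: FP_bcons (FPb_head (FP_nth 0)) (FP_nth 1).
- exact: FP_rev.
- exact: polyb_const.
- by move=> b u xs; rewrite addn1.
Qed.

Lemma FPn_size f : FP f -> FPn (fun xs => size (f xs)).
Proof.
move=> hf; apply: (@FP_ext (fun xs => foldl (fun u _ => true :: u) [::] (f xs))).
  move=> xs; have -> : nseq (size (f xs)) true = ncons (size (f xs)) true [::] by [].
  by elim: (f xs) [::] => //= b w IH v; rewrite IH /ncons -iterSr.
apply: (@FP_foldl (fun _ u _ => true :: u) _ _ (fun=> 1)) => //.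
- exact: FP_cons (FP_nth 1).
- exact: FP_const.
- exact: polyb_const.
- by move=> b u xs; rewrite addn1.
Qed.

Lemma FPn_nth i : FPn (fun xs => size (nth [::] xs i)).
Proof. exact: FPn_size (FP_nth i). Qed.

Lemma FPn_const n : FPn (fun=> n).
Proof. exact: FP_const. Qed.

Lemma FPn_succ f : FPn f -> FPn (fun xs => (f xs).+1).
Proof. exact: FP_cons. Qed.

Lemma FPn_add f g : FPn f -> FPn g -> FPn (fun xs => f xs + g xs).
Proof. by move=> hf hg; apply: FP_ext (FP_cat hf hg) => xs; rewrite nseqD. Qed.

Lemma FPn_if c f g : FPb c -> FPn f -> FPn g -> FPn (fun xs => if c xs then f xs else g xs).
Proof. by move=> hc hf hg; apply: FP_ext (FP_if hc hf hg) => xs; case: (c xs). Qed.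

Lemma FP_drop n f : FPn n -> FP f -> FP (fun xs => drop (n xs) (f xs)).
Proof.
move=> hn hf; apply: (@FP_ext (fun xs => foldl (fun u _ => behead u) (f xs) (nseq (n xs) true))).
  by move=> xs; elim: (n xs) (f xs) => [|k IH] [|b w] //=; rewrite -drop1 IH ?drop0 ?drop_nil.
apply: (@FP_foldl (fun _ u _ => behead u) _ _ (fun=> 0)) => //.
- exact: FP_behead (FP_nth 1).
- exact: polyb_const.
- by move=> b u xs; rewrite size_behead addn0 leq_pred.
Qed.

Lemma FPb_nth n f : FPn n -> FP f -> FPb (fun xs => nth false (f xs) (n xs)).
Proof.
by move=> hn hf; apply: FPb_ext (FPb_head (FP_drop hn hf)) => xs; rewrite -nth0 nth_drop addn0.
Qed.

Lemma FPb_nilp f : FP f -> FPb (fun xs => nilp (f xs)).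
Proof.
move=> hf; apply: (@FP_ext (fun xs => foldl (fun _ _ => [:: false]) [:: true] (f xs))).
  move=> xs; case: (f xs) => // b w; elim/last_ind: w => //= w c _.
  by rewrite foldl_rcons.
apply: (@FP_foldl (fun _ _ _ => [:: false]) _ _ (fun=> 1)) => //.
- exact: FP_const.
- exact: FP_const.
- exact: polyb_const.
- by move=> b u xs; rewrite addn1.
Qed.

Lemma FPn_sub f g : FPn f -> FPn g -> FPn (fun xs => f xs - g xs).
Proof. by move=> hf hg; apply: FP_ext (FP_drop hg hf) => xs; rewrite drop_nseq. Qed.

Lemma FPb_leq f g : FPn f -> FPn g -> FPb (fun xs => f xs <= g xs).
Proof.
move=> hf hg; apply: FPb_ext (FPb_nilp (FPn_sub hf hg)) => xs.
by rewrite /nilp size_nseq.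
Qed.

Lemma FPb_eq f g : FPn f -> FPn g -> FPb (fun xs => f xs == g xs).
Proof.
move=> hf hg; apply: FPb_ext (FPb_and (FPb_leq hf hg) (FPb_leq hg hf)) => xs.
by rewrite eqn_leq.
Qed.

Lemma FPb_eqb f g : FPb f -> FPb g -> FPb (fun xs => f xs == g xs).
Proof.
move=> hf hg; apply: FPb_ext (FPb_if hf hg (FPb_not hg)) => xs.
by case: (f xs) (g xs) => [] [].
Qed.

(* The body is given by its value when the loop index is the first item of the
   environment. *)
Lemma FP_flatten (N : seq word -> nat) (G : nat -> seq word -> word) :
  FPn N -> FP (fun ys => G (size (nth [::] ys 0)) (behead ys)) ->
  FP (fun xs => flatten [seq G i xs | i <- iota 0 (N xs)]).
Proof.
move=> hN hG.
pose init (xs : seq word) : seq word := [:: [::]] ++ [:: [::]].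
pose step (ys : seq word) := [:: true :: nth [::] ys 1] ++
  [:: nth [::] ys 2 ++ G (size (nth [::] ys 1)) (drop 3 ys)].
have e xs k : loop init step xs (nseq k true)
    = [:: nseq k true; flatten [seq G i xs | i <- iota 0 k]].
  rewrite /loop; elim: k => // k IH; rewrite iota_cats1 map_cat flatten_cat.
  rewrite (_ : nseq k.+1 true = rcons (nseq k true) true); last first.
    by rewrite -cats1 -(nseqD k 1) addn1.
  rewrite foldl_rcons IH /step /= size_nseq drop0 cats0.
  by elim: (k) => //= j [->].
have [bN [_ pN tN]] := FP_size hN.
have [bG [mG pG tG]] := FP_size hG.
have hl : FPm 2 (fun xs => loop init step xs (nseq (N xs) true)).
  apply: (@FPm_loop _ _ _ _ (fun n => bN n + bN n * bG (bN n + n))).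
  - exact: FPm_cat FPm_empty FPm_empty.
  - apply: (@FPm_cat 1 1); first exact: FP_cons (FP_nth 1).
    apply: FP_cat (FP_nth 2) _.
    apply: FP_ext (FP_let (FP_nth 1) (FP_select13 hG)) => ys /=.
    by rewrite take0.
  - exact: hN.
  - by polyb_tac.
  - move=> xs k.
    have [k' hk' ->] : exists2 k', k' <= N xs & take k (nseq (N xs) true) = nseq k' true.
      exists (minn k (N xs)); first exact: geq_minr.
      by elim: k (N xs) => [|k IH] [|n] //=; rewrite IH minnSS.
    have hb : N xs <= bN (total xs) by have := tN xs; rewrite size_nseq.
    rewrite e {1}/total /= addn0 size_nseq; apply: leq_add; first exact: leq_trans hb.
    rewrite size_flatten /shape -map_comp.
    apply: (@leq_trans (k' * bG (bN (total xs) + total xs))); last first.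
      by rewrite leq_mul2r (leq_trans hk') ?orbT.
    have : all (fun i => i < k') (iota 0 k') by apply/allP => i; rewrite mem_iota.
    rewrite -{4}(size_iota 0 k'); elim: (iota 0 k') => //= i l IH /andP[ik hl].
    rewrite mulSn leq_add ?IH //.
    have := tG (nseq i true :: xs); rewrite /= size_nseq => h.
    apply: (leq_trans h); apply: mG; rewrite {1}/total /= size_nseq leq_add2r.
    by apply: leq_trans hb; apply: leq_trans hk'; apply: ltnW.
apply: FP_ext (FPm_comp hl (FP_nth 1)) => xs.
by rewrite e.
Qed.

Lemma FPn_mul f g : FPn f -> FPn g -> FPn (fun xs => f xs * g xs).
Proof.
move=> hf hg.
apply: FP_ext (@FP_flatten f (fun _ xs => nseq (g xs) true) hf (FP_shift hg)) => xs.
elim: (f xs) => // k IH.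
by rewrite iota_cats1 map_cat flatten_cat IH /= cats0 mulSnr nseqD.
Qed.

Lemma FPn_poly (p : {poly nat}) f : FPn f -> FPn (fun xs => p.[f xs]%R).
Proof.
move=> hf; rewrite /horner; elim: (polyseq p) => [|a s IH] /=.
  exact: FPn_const.
exact: FPn_add (FPn_mul IH hf) (FPn_const _).
Qed.

Lemma FPn_min f g : FPn f -> FPn g -> FPn (fun xs => minn (f xs) (g xs)).
Proof.
move=> hf hg; apply: FPn_ext (FPn_if (FPb_leq hf hg) hf hg) => xs.
by rewrite /minn; case: ltngtP.
Qed.

Lemma FPn_pred f : FPn f -> FPn (fun xs => (f xs).-1).
Proof. by move=> hf; apply: FPn_ext (FPn_sub hf (FPn_const 1)) => xs; rewrite subn1. Qed.

Lemma modn_succ_eq m d : ((m %% d).+1 == d) = (d %| m.+1).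
Proof.
case: d => [|d]; first by rewrite dvd0n.
rewrite /dvdn -(addn1 m) -modnDml addn1.
have : m %% d.+1 < d.+1 by rewrite ltn_mod.
rewrite ltnS leq_eqVlt => /orP[/eqP->|h]; first by rewrite eqxx modnn.
by rewrite (@modn_small (m %% d.+1).+1) ?ltnS //; lia.
Qed.

(** Unary counting: the remainder grows until it would reach [d], then it is reset and the quotient
    grows. For divisor 0 it is never reset, in agreement with the conventions for [%/] and [%%]. *)
Lemma FPn_divn_modn f d : FPn f -> FPn d ->
  FPn (fun xs => f xs %/ d xs) /\ FPn (fun xs => f xs %% d xs).
Proof.
move=> hf hd.
pose g1 (_ : bool) (q r : word) (xs : seq word) : word :=
  if (size r).+1 == d xs then true :: q else q.
pose g2 (_ : bool) (q r : word) (xs : seq word) : word :=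
  if (size r).+1 == d xs then [::] else true :: r.
have hc : FPb (fun ys => (size (nth [::] ys 2)).+1 == d (drop 3 ys)).
  apply: FPb_eq; first exact: FPn_succ (FPn_nth 2).
  exact: FP_drop_env hd.
have [|||||||h1 h2] := @FP_fold_pair g1 g2 (fun=> [::]) (fun=> [::])
    (fun xs => nseq (f xs) true) (fun=> 2).
- exact: FP_if hc (FP_cons true (FP_nth 1)) (FP_nth 1).
- exact: FP_if hc (FP_const [::]) (FP_cons true (FP_nth 2)).
- exact: FP_const.
- exact: FP_const.
- exact: hf.
- exact: polyb_const.
- by move=> b u v xs; rewrite /g1 /g2; case: ifP => _ /=; lia.
have e xs k : fold_pair g1 g2 (fun=> [::]) (fun=> [::]) xs (nseq k true)
    = (nseq (k %/ d xs) true, nseq (k %% d xs) true).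
  elim: k => [|k IH]; first by rewrite div0n mod0n.
  have -> : nseq k.+1 true = rcons (nseq k true) true by rewrite -cats1 -(nseqD k 1) addn1.
  rewrite /fold_pair foldl_rcons -/(fold_pair _ _ _ _ _ _) IH /g1 /g2 /= size_nseq.
  rewrite modn_succ_eq modnS; case: (posnP (d xs)) => [->|d0]; first by rewrite !divn0 dvd0n.
  by rewrite divnS //; case: ifP.
by split; [apply: FP_ext h1 | apply: FP_ext h2] => xs; rewrite e.
Qed.

Lemma FPn_div f d : FPn f -> FPn d -> FPn (fun xs => f xs %/ d xs).
Proof. by move=> h k; case: (FPn_divn_modn h k). Qed.

Lemma FPn_mod f d : FPn f -> FPn d -> FPn (fun xs => f xs %% d xs).
Proof. by move=> h k; case: (FPn_divn_modn h k). Qed.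

(** A number known to lie below a constant [q] is turned into a parameter fixed in advance. This
    handles cells and patterns of the tableau, whose number depends on the machine only. *)
Lemma FPb_switch q (h : nat -> seq word -> bool) f :
  FPn f -> (forall i, i < q -> FPb (h i)) -> FPb (fun xs => (f xs < q) && h (f xs) xs).
Proof.
move=> hf; elim: q => [|q IH] hh; first exact: FPb_const.
have hq := IH (fun i iq => hh i (ltnW iq)).
apply: FPb_ext (FPb_if (FPb_eq hf (FPn_const q)) (hh q (ltnSn q)) hq) => xs.
case: (eqVneq (f xs) q) => [->|n]; first by rewrite ltnSn.
by rewrite ltnS (leq_eqVlt (f xs)) (negPf n).
Qed.

(** * Binary notation and parsing *)

Fixpoint incr (w : word) : word :=
  if w is b :: w' then if b then false :: incr w' else true :: w' else [:: true].

(** The first accumulator is the carry; the output is collected in reverse, and a carry left over is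
    appended at the end. *)
Lemma FP_incr f : FP f -> FP (fun xs => incr (f xs)).
Proof.
move=> hf.
pose g1 (b : bool) (c o : word) (_ : seq word) : word := [:: head false c && b].
pose g2 (b : bool) (c o : word) (_ : seq word) : word := (head false c != b) :: o.
have hb : FPb (fun ys => head false (nth [::] ys 0)) by apply: FPb_head (FP_nth 0).
have hc : FPb (fun ys => head false (nth [::] ys 1)) by apply: FPb_head (FP_nth 1).
have [|||||||h1 h2] := @FP_fold_pair g1 g2 (fun=> [:: true]) (fun=> [::]) f (fun=> 2).
- exact: FPb_and hc hb.
- exact: FP_bcons (FPb_not (FPb_eqb hc hb)) (FP_nth 2).
- exact: FP_const.
- exact: FP_const.
- exact: hf.
- exact: polyb_const.
- by move=> b u v xs /=; lia.
have h : FP (fun xs => rev (fold_pair g1 g2 (fun=> [:: true]) (fun=> [::]) xs (f xs)).2 ++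
   (if head false (fold_pair g1 g2 (fun=> [:: true]) (fun=> [::]) xs (f xs)).1
    then [:: true] else [::])).
  apply: FP_cat (FP_rev h2) _.
  exact: FP_if (FPb_head h1) (FP_const [:: true]) (FP_const [::]).
apply: FP_ext h => xs; rewrite /fold_pair.
have e w c o : let p := foldl (fun p b => (g1 b p.1 p.2 xs, g2 b p.1 p.2 xs)) ([:: c], o) w in
    rev p.2 ++ (if head false p.1 then [:: true] else [::])
    = rev o ++ (if c then incr w else w).
  elim: w c o => [|b w IH] c o /=; first by case: c.
  rewrite {}IH /g1 /g2 /= rev_cons cat_rcons.
  by case: c b => [] [].
by rewrite (e (f xs) true [::]).
Qed.

Lemma bits_double n : 0 < n -> bits n = odd n :: bits n./2.
Proof.
move=> n0; have e := up_log2S n0.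
rewrite /bits e /= expn0 divn1; congr (_ :: _).
rewrite -[1]add1n iotaDl -map_comp; apply: eq_map => i /=.
by rewrite add1n expnS divnMA divn2.
Qed.

Lemma bits_succ n : bits n.+1 = incr (bits n).
Proof.
have [m] := ubnP n; elim: m n => // m IH n nm.
case: (posnP n) => [->|n0]; first by rewrite bits_double.
rewrite bits_double // (bits_double n0) /= uphalf_half.
case: (odd n) => //=; rewrite add1n IH //; have := odd_double_half n; rewrite -muln2; lia.
Qed.

Lemma size_incr w : size (incr w) <= (size w).+1.
Proof. by elim: w => [|[] w IH]. Qed.

Lemma FP_bits f : FPn f -> FP (fun xs => bits (f xs)).
Proof.
move=> hf; apply: (@FP_ext (fun xs => foldl (fun u _ => incr u) [::] (nseq (f xs) true))).
  move=> xs; elim: (f xs) => // k IH.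
  have -> : nseq k.+1 true = rcons (nseq k true) true by rewrite -cats1 -(nseqD k 1) addn1.
  by rewrite foldl_rcons IH bits_succ.
apply: (@FP_foldl (fun _ u _ => incr u) _ _ (fun=> 1)) => //.
- exact: FP_incr (FP_nth 1).
- exact: FP_const.
- exact: polyb_const.
- by move=> b u xs; rewrite addn1 size_incr.
Qed.

Lemma bits_exp2 k : bits (2 ^ k) = nseq k false ++ [:: true].
Proof.
elim: k => [|k IH]; first by rewrite bits_double.
rewrite bits_double ?expn_gt0 // expnS mul2n odd_double doubleK IH //.
Qed.

Lemma FP_delimit f : FP f -> FP (fun xs => delimit (f xs)).
Proof.
move=> hf; pose g (b : bool) (u : word) (_ : seq word) : word := b :: true :: u.
have h : FP (fun xs => foldl (fun u b => g b u xs) [::] (f xs)).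
  apply: (@FP_foldl g _ _ (fun=> 2)) => //.
  - exact: FP_bcons (FPb_head (FP_nth 0)) (FP_cons true (FP_nth 1)).
  - exact: FP_const.
  - exact: polyb_const.
  - by move=> b u xs /=; lia.
apply: FP_ext (FP_cat (FP_rev h) (FP_const [:: false])) => xs; congr (_ ++ _).
have e w u : rev (foldl (fun u b => g b u xs) u w) = rev u ++ flatten [seq [:: true; b] | b <- w].
  elim: w u => [|b w IH] u /=; first by rewrite cats0.
  by rewrite IH !rev_cons -!cats1 -!catA.
exact: e.
Qed.

Lemma FP_map_negb f : FP f -> FP (fun xs => map negb (f xs)).
Proof.
move=> hf; pose g (b : bool) (u : word) (_ : seq word) : word := ~~ b :: u.
have h : FP (fun xs => foldl (fun u b => g b u xs) [::] (f xs)).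
  apply: (@FP_foldl g _ _ (fun=> 1)) => //.
  - exact: FP_bcons (FPb_not (FPb_head (FP_nth 0))) (FP_nth 1).
  - exact: FP_const.
  - exact: polyb_const.
  - by move=> b u xs /=; lia.
apply: FP_ext (FP_rev h) => xs.
have e w u : rev (foldl (fun u b => g b u xs) u w) = rev u ++ map negb w.
  elim: w u => [|b w IH] u /=; first by rewrite cats0.
  by rewrite IH rev_cons cat_rcons.
exact: e.
Qed.

Lemma FP_take n f : FPn n -> FP f -> FP (fun xs => take (n xs) (f xs)).
Proof.
move=> hn hf.
apply: FP_ext (FP_rev (FP_drop (FPn_sub (FPn_size hf) hn) (FP_rev hf))) => xs.
rewrite drop_rev revK; case: (leqP (n xs) (size (f xs))) => h; first by rewrite subKn.
by rewrite !take_oversize //; lia.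
Qed.

(* The mode is empty before a flag, [true] before a data bit and [false] after
   the closing flag. *)
Definition parse_mode (b : bool) (m : word) : word :=
  if nilp m then [:: b] else if head false m then [::] else m.

(** A bit is kept if the mode in which it is read equals [data]. So [true] keeps the data bits of
    the first word, and [false] keeps everything behind its closing flag. *)
Definition parse (data : bool) (w : word) : word :=
  rev (fold_pair (fun b m _ _ => parse_mode b m)
                 (fun b m o _ => if ~~ nilp m && (head false m == data) then b :: o else o)
                 (fun=> [::]) (fun=> [::]) [::] w).2.

Definition first_word : word -> word := parse true.
Definition other_words : word -> word := parse false.

Lemma FP_parse data f : FP f -> FP (fun xs => parse data (f xs)).
Proof.
move=> hf; rewrite /parse.
have hb : FPb (fun ys => head false (nth [::] ys 0)) by apply: FPb_head (FP_nth 0).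
have hm : FPb (fun ys => head false (nth [::] ys 1)) by apply: FPb_head (FP_nth 1).
have hn : FPb (fun ys => nilp (nth [::] ys 1)) by apply: FPb_nilp (FP_nth 1).
have [|||||||_ h] := @FP_fold_pair (fun b m _ _ => parse_mode b m)
  (fun b m o _ => if ~~ nilp m && (head false m == data) then b :: o else o)
  (fun=> [::]) (fun=> [::]) f (fun=> 2).
- exact: FP_if hn hb (FP_if hm (FP_const [::]) (FP_nth 1)).
- apply: FP_if (FPb_and (FPb_not hn) (FPb_eqb hm (FPb_const _))) _ (FP_nth 2).
  exact: FP_bcons hb (FP_nth 2).
- exact: FP_const.
- exact: FP_const.
- exact: hf.
- exact: polyb_const.
- move=> b u v _; rewrite /parse_mode; case: u => [|c u] /=; first by lia.
  by case: c => /=; case: eqP => /=; lia.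
exact: FP_rev h.
Qed.

Lemma parse_delimit x r : first_word (delimit x ++ r) = x /\ other_words (delimit x ++ r) = r.
Proof.
rewrite /first_word /other_words /parse /fold_pair.
pose f data (p : word * word) b := (parse_mode b p.1,
  if ~~ nilp p.1 && (head false p.1 == data) then b :: p.2 else p.2).
have fE data m o b : f data (m, o) b =
    (parse_mode b m, if ~~ nilp m && (head false m == data) then b :: o else o) by [].
have done_ data m o : foldl (f data) ([:: false], o) m
    = ([:: false], if data then o else rev m ++ o).
  elim: m o => [|b m IH] o /=; first by case: data.
  rewrite fE /= IH; case: data {IH} => //=.
  by rewrite rev_cons cat_rcons.
have run data o : foldl (f data) ([::], o) (delimit x ++ r)
    = ([:: false], if data then rev x ++ o else rev r ++ o).
  rewrite /delimit; elim: x o => [|b x IH] o /=.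
    by rewrite fE /= done_; case: data.
  rewrite !fE /= IH; case: data {IH} => //=.
  by rewrite rev_cons cat_rcons.
split.
  rewrite (_ : foldl _ _ _ = foldl (f true) ([::], [::]) (delimit x ++ r)) // run.
  by rewrite cats0 revK.
rewrite (_ : foldl _ _ _ = foldl (f false) ([::], [::]) (delimit x ++ r)) // run.
by rewrite cats0 revK.
Qed.

Lemma first_word_delimit x r : first_word (delimit x ++ r) = x.
Proof. by case: (parse_delimit x r). Qed.

Lemma other_words_delimit x r : other_words (delimit x ++ r) = r.
Proof. by case: (parse_delimit x r). Qed.

(** * Reading the count off an approximation *)

Lemma value_cat u v : value_of_bits (u ++ v) = value_of_bits u + 2 ^ size u * value_of_bits v.
Proof.
elim: u => [|b u IH]; first by rewrite mul1n.
by rewrite /= IH expnS -!mul2n; lia.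
Qed.

Lemma value_nseq_false k : value_of_bits (nseq k false) = 0.
Proof. by elim: k => //= k ->. Qed.

Lemma value_lt u : value_of_bits u < 2 ^ size u.
Proof. by elim: u => //= b u IH; rewrite expnS -mul2n; case: b => /=; lia. Qed.

Lemma value_negb u : value_of_bits (map negb u) = 2 ^ size u - (value_of_bits u).+1.
Proof.
elim: u => //= b u ->; have := value_lt u; rewrite expnS -!mul2n.
by case: b => /=; lia.
Qed.

Lemma value_take k u : value_of_bits (take k u) = value_of_bits u %% 2 ^ k.
Proof.
rewrite -{2}(cat_take_drop k u) value_cat size_take_min.
case: (leqP k (size u)) => h.
  rewrite mulnC addnC modnMDl modn_small //.
  by have := value_lt (take k u); rewrite size_takel.
rewrite drop_oversize ?(ltnW h) //= muln0 addn0 modn_small //.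
apply: leq_trans (value_lt _) _; rewrite leq_pexp2l // size_take_min; exact: geq_minl.
Qed.

(* [c] is the borrow; the result has as many bits as the first operand. *)
Fixpoint subtract (c : bool) (a v : word) : word * bool :=
  if a is x :: a' then
    let y := head false v in
    let p := subtract (if x then y && c else y || c) a' (behead v) in
    ((x (+) y (+) c) :: p.1, p.2)
  else ([::], c).

Lemma size_subtract c a v : size (subtract c a v).1 = size a.
Proof. by elim: a c v => //= x a IH c v; rewrite IH. Qed.

Lemma value_subtract c a v : size v <= size a ->
  value_of_bits a + 2 ^ size a * (subtract c a v).2
  = value_of_bits (subtract c a v).1 + value_of_bits v + c.
Proof.
elim: a c v => [|x a IH] c v /=; first by case: v => // _; rewrite !add0n mul1n.
move=> h; have := IH (if x then head false v && c else head false v || c) (behead v).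
rewrite size_behead -subn1 leq_subLR add1n => /(_ h).
case: (subtract _ _ _) => o c' /=; rewrite expnS -!mul2n => e.
have -> : value_of_bits v = head false v + 2 * value_of_bits (behead v).
  by case: (v) => //= b w; rewrite mul2n.
by move: e; clear IH; case: x (head false v) c c' => [] [] [] [] /=; lia.
Qed.

Lemma FP_subtract a v : FP a -> FP v ->
  FP (fun xs => (subtract false (a xs) (v xs)).1) /\
  FPb (fun xs => (subtract false (a xs) (v xs)).2).
Proof.
move=> ha hv.
pose g1 (x : bool) (p o : word) (_ : seq word) : word :=
  (if x then head false (behead p) && head false p else head false (behead p) || head false p)
  :: behead (behead p).
pose g2 (x : bool) (p o : word) (_ : seq word) : word :=
  (x (+) head false (behead p) (+) head false p) :: o.
have hx : FPb (fun ys => head false (nth [::] ys 0)) by apply: FPb_head (FP_nth 0).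
have hc : FPb (fun ys => head false (nth [::] ys 1)) by apply: FPb_head (FP_nth 1).
have hy : FPb (fun ys => head false (behead (nth [::] ys 1))).
  by apply: FPb_head (FP_behead (FP_nth 1)).
have hxor c d : FPb c -> FPb d -> FPb (fun xs => c xs (+) d xs).
  by move=> h k; apply: FPb_ext (FPb_if h (FPb_not k) k) => xs; case: (c xs).
have [|||||||h1 h2] := @FP_fold_pair g1 g2 (fun xs => false :: v xs) (fun=> [::]) a (fun=> 2).
- apply: FP_bcons (FP_behead (FP_behead (FP_nth 1))).
  exact: FPb_if hx (FPb_and hy hc) (FPb_or hy hc).
- exact: FP_bcons (hxor _ _ (hxor _ _ hx hy) hc) (FP_nth 2).
- exact: FP_cons.
- exact: FP_const.
- exact: ha.
- exact: polyb_const.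
- by move=> b p o xs; rewrite /g1 /g2 /= !size_behead; lia.
have e xs w c u o :
    foldl (fun p b => (g1 b p.1 p.2 xs, g2 b p.1 p.2 xs)) (c :: u, o) w
    = ((subtract c w u).2 :: drop (size w) u, rev (subtract c w u).1 ++ o).
  elim: w c u o => [|x w IH] c u o /=; first by rewrite drop0.
  rewrite {}IH /= rev_cons cat_rcons; congr (_ :: _, _).
  by rewrite -drop1 drop_drop addn1.
split.
  by apply: FP_ext (FP_rev h2) => xs; rewrite /fold_pair e cats0 revK.
by apply: FPb_ext (FPb_head h1) => xs; rewrite /fold_pair e.
Qed.

(** Padding with [size v] zeros makes the first operand long enough for [value_subtract]. The length
    of the result does not depend on the values, which matters when its bits are complemented. *)
Definition monus (a v : word) : word := (subtract false (a ++ nseq (size v) false) v).1.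

Arguments monus : simpl never.

Lemma size_monus a v : size (monus a v) = size a + size v.
Proof. by rewrite size_subtract size_cat size_nseq. Qed.

Lemma subtract_padded a v :
  value_of_bits a + 2 ^ (size a + size v) * (subtract false (a ++ nseq (size v) false) v).2
  = value_of_bits (monus a v) + value_of_bits v.
Proof.
have := @value_subtract false (a ++ nseq (size v) false) v.
rewrite size_cat size_nseq value_cat value_nseq_false muln0 !addn0 => -> //.
exact: leq_addl.
Qed.

(** In the identity for the padded operands the result lies below [2 ^ (size a + size v)], so the
    borrow has to be set exactly when the subtraction would be negative. *)
Lemma borrowE a v : (subtract false (a ++ nseq (size v) false) v).2
  = (value_of_bits a < value_of_bits v).
Proof.
have := subtract_padded a v; have := value_lt (monus a v); rewrite size_monus.
have := value_lt v; have : 2 ^ size v <= 2 ^ (size a + size v).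
  by rewrite leq_pexp2l // leq_addl.
by case: (subtract _ _ _).2 => /=; lia.
Qed.

Lemma value_monus a v : value_of_bits v <= value_of_bits a ->
  value_of_bits (monus a v) = value_of_bits a - value_of_bits v.
Proof.
move=> h; have := subtract_padded a v; rewrite borrowE ltnNge h /= muln0 addn0; lia.
Qed.

Definition division_step (d : word) (b : bool) (r q : word) : word * word :=
  if (subtract false ((b :: r) ++ nseq (size d) false) d).2 then (b :: r, false :: q)
  else (monus (b :: r) d, true :: q).

(* Schoolbook division, most significant bit first; [q] is built from its
   last bit backwards. *)
Definition divide (n d : word) : word :=
  (fold_pair (fun b r q _ => (division_step d b r q).1) (fun b r q _ => (division_step d b r q).2)
     (fun=> [::]) (fun=> [::]) [::] (rev n)).2.

Lemma FP_nseq_false f : FPn f -> FP (fun xs => nseq (f xs) false).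
Proof.
by move=> h; apply: FP_ext (FP_map_negb h) => xs; rewrite map_nseq.
Qed.

Lemma FP_monus a v : FP a -> FP v -> FP (fun xs => monus (a xs) (v xs)).
Proof.
move=> ha hv.
by case: (FP_subtract (FP_cat ha (FP_nseq_false (FPn_size hv))) hv).
Qed.

Lemma FP_divide n d : FP n -> FP d -> FP (fun xs => divide (n xs) (d xs)).
Proof.
move=> hn hd.
have [bd [_ pd td]] := FP_size hd.
pose g1 b r q xs := (division_step (d xs) b r q).1.
pose g2 b r q xs := (division_step (d xs) b r q).2.
have hx : FPb (fun ys => head false (nth [::] ys 0)) by apply: FPb_head (FP_nth 0).
have hbr : FP (fun ys => head false (nth [::] ys 0) :: nth [::] ys 1).
  exact: FP_bcons hx (FP_nth 1).
have hd3 : FP (fun ys => d (drop 3 ys)) by apply: FP_drop_env.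
have hpad := FP_cat hbr (FP_nseq_false (FPn_size hd3)).
have hc := (FP_subtract hpad hd3).2.
(* The remainder is never trimmed: a subtraction lengthens it by [size d]. Together with one new bit
   each for remainder and quotient this is the growth allowed per pass. *)
have [|||||||_ h2] := @FP_fold_pair g1 g2 (fun=> [::]) (fun=> [::]) (fun xs => rev (n xs))
   (fun k => bd k + 2).
- apply: FP_ext (FP_if hc hbr (FP_monus hbr hd3)) => ys.
  by rewrite /g1 /division_step; case: ifP.
- apply: FP_ext (FP_if hc (FP_cons false (FP_nth 2)) (FP_cons true (FP_nth 2))) => ys.
  by rewrite /g2 /division_step; case: ifP.
- exact: FP_const.
- exact: FP_const.
- exact: FP_rev.
- by polyb_tac.
- move=> b r q xs; rewrite /g1 /g2 /division_step; case: ifP => _; cbn [fst snd].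
    by rewrite /=; lia.
  by rewrite size_monus /=; have := td xs; lia.
exact: FP_ext h2.
Qed.

Lemma divideE n d : 0 < value_of_bits d ->
  value_of_bits (divide n d) = value_of_bits n %/ value_of_bits d /\
  size (divide n d) = size n.
Proof.
move=> d0; rewrite /divide /fold_pair.
set f := fun p b => _.
have fE r q b : f (r, q) b = ((division_step d b r q).1, (division_step d b r q).2) by [].
suff : forall w, let p := foldl f ([::], [::]) (rev w) in
    [/\ value_of_bits w = value_of_bits p.2 * value_of_bits d + value_of_bits p.1,
        value_of_bits p.1 < value_of_bits d & size p.2 = size w].
  move=> /(_ n) /= []; set p := foldl _ _ _ => -> h ->.
  by rewrite divnMDl // divn_small // addn0.
elim=> [|b w]; first by split.
rewrite rev_cons foldl_rcons /=; case: (foldl _ _ _) => r q /= [e1 e2 e3].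
rewrite /division_step borrowE; case: ifP => h; cbn [fst snd].
  by move: h => /= h; split; [rewrite e1 -!mul2n; lia | exact: h | rewrite e3].
rewrite value_monus; last by rewrite leqNgt; apply/negbT.
rewrite /= in h *.
by split; [rewrite e1 -!mul2n; move: h => /=; rewrite -mul2n; nia |
  move: h; rewrite -mul2n; case: (b) => /=; lia | rewrite e3].
Qed.

(* With the answer [N / D] within [2 ^ - L.+1] of [Z / 2 ^ L], the integer part
   of [(2 ^ L.+1 * N - D) / (2 * D)] is [Z - 1], and complementing bits turns
   it into [- Z]. *)
Definition extract (K L : nat) (y : word) : word :=
  let n := first_word (other_words y) in
  let d := first_word (other_words (other_words y)) in
  take K (map negb (divide (monus (nseq L.+1 false ++ n) d) (false :: d))).

Lemma FP_extract K L f : FPn K -> FPn L -> FP f ->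
  FP (fun xs => extract (K xs) (L xs) (f xs)).
Proof.
move=> hK hL hf.
have hn := FP_parse true (FP_parse false hf).
have hd := FP_parse true (FP_parse false (FP_parse false hf)).
apply: FP_take hK (FP_map_negb (FP_divide (FP_monus _ hd) (FP_cons false hd))).
exact: FP_cat (FP_nseq_false (FPn_succ hL)) hn.
Qed.

(** Dividing the inequalities by [2 * value_of_bits d] puts the quotient computed by [extract]
    strictly between [Z - 1] and [Z]. As [K <= L.+1], the number [2 ^ L.+1] vanishes modulo [2 ^ K],
    so there [- Z] and [S] agree. *)
Lemma extractE K L (s n d : word) Z S : K <= L.+1 -> 0 < value_of_bits d ->
  (2 * Z - 1) * value_of_bits d < 2 ^ L.+1 * value_of_bits n ->
  2 ^ L.+1 * value_of_bits n < (2 * Z + 1) * value_of_bits d -> 0 < Z ->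
  Z + S = 2 ^ L.+1 ->
  value_of_bits (extract K L (encode_words [:: s; n; d])) = S %% 2 ^ K.
Proof.
move=> KL d0 h1 h2 Z0 ZS.
rewrite /extract (_ : encode_words _ = delimit s ++ delimit n ++ delimit d ++ [::]) //.
rewrite !(first_word_delimit, other_words_delimit).
rewrite value_take value_negb.
set m := monus _ _; have [-> ->] : value_of_bits (divide m (false :: d)) = Z.-1 /\
    size (divide m (false :: d)) = size m.
  have [|-> ->] := @divideE m (false :: d); first by rewrite /= add0n double_gt0.
  split=> //; rewrite /m value_monus value_cat size_nseq value_nseq_false add0n; last by nia.
  rewrite /= add0n -mul2n; apply/eqP; rewrite eqn_leq leq_divRL ?muln_gt0 //.
  rewrite -ltnS ltn_divLR ?muln_gt0 // prednK //.
  by apply/andP; split; nia.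
rewrite prednK // /m size_monus size_cat size_nseq.
have -> : L.+1 + size n + size d = L.+1 + (size n + size d) by lia.
have : 2 ^ K %| 2 ^ L.+1 by rewrite dvdn_exp2l.
case/dvdnP => c ec; rewrite expnD ec.
set e := 2 ^ (size n + size d).
have e0 : 0 < e by rewrite expn_gt0.
(* Taking [Z] from [e] copies of [2 ^ L.+1] leaves [e.-1] copies and [S]. *)
have -> : c * 2 ^ K * e - Z = (c * e.-1) * 2 ^ K + S.
  by rewrite -(prednK e0) in ec *; rewrite ec in ZS; rewrite /=; nia.
by rewrite modnMDl.
Qed.

(** * The clause net *)

Section MarkingSets.
Variables (P T : finType) (N : net P T).

Lemma enabledE (A : {set P}) t : enabled N A t = (pre N t \subset A).
Proof.
apply/forall_inP/fintype.subsetP => h p hp; have := h p hp; rewrite ffunE; by case: (p \in A).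
Qed.

Lemma in_fire (A : {set P}) t p :
  (p \in fire_set N A t) = (p \notin pre N t) && (p \in A) || (p \in post N t).
Proof. by rewrite finset.in_setU finset.in_setD. Qed.

Lemma fire_seq_cat (M : marking P) s1 s2 :
  fire_seq N M (s1 ++ s2) = obind (fun M' => fire_seq N M' s2) (fire_seq N M s1).
Proof. by elim: s1 M => //= t s IH M; case: ifP => // _; rewrite IH. Qed.

Lemma acyclic_rank (rk : P + T -> nat) :
  (forall x y, flow N x y -> rk x < rk y) -> acyclic N.
Proof.
move=> h x y xy; apply/negP => /connectP[p hp e].
suff : rk y <= rk x by have := h _ _ xy; lia.
rewrite e; elim: p y hp {xy e} => //= z p IH y /andP[yz /IH]; have := h _ _ yz; lia.
Qed.

(** When dependent transitions have equal presets, a conflict set at a marking that enables [u] is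
    the whole dependence class of [u]. Removing the preset of an independent [t] leaves the preset
    of [u] marked, so the class stays the same. *)
Lemma confusion_free_equal_presets :
  (forall t u, ~~ independent N t u -> pre N t = pre N u) -> confusion_free N.
Proof.
move=> h A _ t u et eu ind.
have e (B : {set P}) : pre N u \subset B -> conflict_set N u B = [set v | ~~ independent N u v].
  move=> uB; apply/setP => v; rewrite !inE enabledE andbC.
  by case iv: (independent N u v) => //=; rewrite -(h u v) ?iv.
rewrite enabledE in eu; have iu : [disjoint pre N u & pre N t] by rewrite disjoint_sym.
rewrite !e //.
  by apply/subsetU; rewrite finset.subsetD eu iu.
by rewrite finset.subsetD eu iu.
Qed.

End MarkingSets.

(* A net covered by state machines: every line carries exactly one token. *)
Section Lines.
Variables (P T : finType) (N : net P T) (L : finType) (mem : L -> P -> bool).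
Variable lev : P -> nat.
Hypothesis line_cover : forall p, exists l, mem l p.
Hypothesis line_source : forall l, mem l (source N).
Hypothesis line_post : forall t l p, p \in pre N t -> mem l p ->
  exists q, [/\ q \in post N t, mem l q & forall q', q' \in post N t -> mem l q' -> q' = q].
Hypothesis line_pre : forall t l q, q \in post N t -> mem l q ->
  exists2 p, p \in pre N t & mem l p.
Hypothesis pre_neq0 : forall t, exists p, p \in pre N t.
Hypothesis lev_lt : forall t p q, p \in pre N t -> q \in post N t -> lev p < lev q.

Definition one_token (A : {set P}) : Prop :=
  forall l, exists p, [/\ p \in A, mem l p & forall q, q \in A -> mem l q -> q = p].

Hypothesis dead_sink : forall A, one_token A -> (forall t, ~~ enabled N A t) ->
  A = [set sink N]%SET.

Lemma one_token_source : one_token [set source N]%SET.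
Proof.
by move=> l; exists (source N); split; rewrite ?inE // => q; rewrite inE => /eqP.
Qed.

Lemma one_token_eq A l p q : one_token A -> p \in A -> q \in A -> mem l p -> mem l q -> p = q.
Proof. by move=> /(_ l)[r [_ _ h]] pA qA lp lq; rewrite (h p pA lp) (h q qA lq). Qed.

(** A line that meets the preset passes its token on to the one output place that it contains; by
    [line_pre] a line that misses the preset receives no token. *)
Lemma one_token_fire A t : one_token A -> enabled N A t -> one_token (fire_set N A t).
Proof.
move=> gA; rewrite enabledE => /fintype.subsetP eA l; have [p [pA lp hp]] := gA l.
case: (boolP (p \in pre N t)) => pt.
  have [q [qt lq hq]] := line_post pt lp.
  exists q; split; rewrite ?in_fire ?qt ?orbT // => q';
    rewrite in_fire => /orP[/andP[q't q'A]|q't] lq'.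
    by move: q't; rewrite (hp _ q'A lq') pt.
  exact: hq.
exists p; split; rewrite ?in_fire ?pt ?pA // => q'; rewrite in_fire => /orP[/andP[q't q'A]|q't] lq'.
  exact: hp.
have [r rt lr] := line_pre q't lq'.
by move: pt; rewrite -(hp r (eA _ rt) lr) rt.
Qed.

(** Counting tokens and uniting sets could differ only at an output place that is already marked and
    not consumed. By [line_pre] a line through it contains a marked input place as well, although a
    line carries a single token. *)
Lemma fire_mark A t : one_token A -> enabled N A t ->
  fire N (mark A) t = mark (fire_set N A t).
Proof.
move=> gA; rewrite enabledE => /fintype.subsetP eA; apply/ffunP => p; rewrite !ffunE in_fire.
case pt: (p \in pre N t); case qt: (p \in post N t); case pA: (p \in A) => //=.
have [l lp] := line_cover p; have [r rt lr] := line_pre qt lp.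
by move: pt; rewrite (one_token_eq gA pA (eA _ rt) lp lr) rt.
Qed.

Lemma reachable_one_token M : reachable N (mark [set source N]%SET) M ->
  exists2 A, M = mark A & one_token A.
Proof.
case=> s; elim/last_ind: s M => [|s t IH] M.
  by case=> <-; exists [set source N]%SET => //; exact: one_token_source.
rewrite -cats1 fire_seq_cat; case e: fire_seq => [M'|] //=.
case: ifP => // en [<-]; have [A eA gA] := IH _ e.
exists (fire_set N A t); last by apply: one_token_fire => //; rewrite /enabled -eA.
by rewrite eA fire_mark // /enabled -eA.
Qed.

Lemma lines_one_safe : one_safe N.
Proof. by move=> M /reachable_one_token[A -> _] p; rewrite ffunE; case: (p \in A). Qed.

Definition potential (A : {set P}) : nat := \sum_l \sum_(p in A | mem l p) lev p.

Lemma line_token A l p : one_token A -> p \in A -> mem l p ->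
  \sum_(q in A | mem l q) lev q = lev p.
Proof.
move=> gA pA lp; rewrite (big_pred1 p) // => q /=; apply/andP/eqP => [[qA lq]|->//].
exact: (one_token_eq gA qA pA lq lp).
Qed.

Lemma line_fire_lt A t l p : one_token A -> enabled N A t -> p \in pre N t -> mem l p ->
  \sum_(q in A | mem l q) lev q < \sum_(q in fire_set N A t | mem l q) lev q.
Proof.
move=> gA en pt lp; have gF := one_token_fire gA en.
move: (en); rewrite enabledE => /fintype.subsetP eA.
have [q [qt lq _]] := line_post pt lp.
rewrite (line_token gA (eA _ pt) lp) (@line_token _ _ q gF) ?in_fire ?qt ?orbT //.
exact: lev_lt pt qt.
Qed.

Lemma line_fire_le A t l : one_token A -> enabled N A t ->
  \sum_(q in A | mem l q) lev q <= \sum_(q in fire_set N A t | mem l q) lev q.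
Proof.
move=> gA en; have gF := one_token_fire gA en; have [r [rA lr _]] := gA l.
case: (boolP (r \in pre N t)) => rt; first exact: ltnW (line_fire_lt gA en rt lr).
by rewrite (line_token gA rA lr) (@line_token _ _ r gF) ?in_fire ?rt ?rA.
Qed.

(** No line sees its token move down, and on a line through an input place it moves strictly up. *)
Lemma potential_fire A t : one_token A -> enabled N A t ->
  potential A < potential (fire_set N A t).
Proof.
move=> gA en; have [p pt] := pre_neq0 t; have [l lp] := line_cover p.
rewrite /potential (bigD1 l) //= [X in _ < X](bigD1 l) //= -addSn leq_add //.
  exact: line_fire_lt pt lp.
by apply: leq_sum => k _; exact: line_fire_le.
Qed.

Definition potential_bound : nat := \sum_(l : L) \max_p lev p.

Lemma potential_le A : one_token A -> potential A <= potential_bound.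
Proof.
move=> gA; apply: leq_sum => l _; have [r [rA lr _]] := gA l.
rewrite (line_token gA rA lr); exact: leq_bigmax.
Qed.

(** The potential grows with every firing and is bounded, so firing arbitrary enabled transitions
    must stop, and [dead_sink] tells where. *)
Lemma lines_sound : sound N.
Proof.
move=> M /reachable_one_token[A -> gA {M}].
have [k] := ubnP (potential_bound - potential A); elim: k A gA => // k IH A gA hk.
case: (boolP [exists t, enabled N A t]) => [/existsP[t en]|/existsPn dead].
  have lt := potential_fire gA en; have le := potential_le (one_token_fire gA en).
  have [|s hs] := IH _ (one_token_fire gA en); first by lia.
  by exists (t :: s) => /=; rewrite (_ : enabled_at _ _ _) // fire_mark.
by exists [::]; rewrite /= (dead_sink gA dead).
Qed.

End Lines.

Section ClauseNet.
Variables (n m : nat).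

(** [Lit v b c] is the message to clause [c] that [v] has value [b]. In [Arg v c] the value is
    forgotten; what remains of it is the arrival time. *)
Inductive place :=
| Source | Sink | Var of 'I_n | Lit of 'I_n & bool & 'I_m | Arg of 'I_n & 'I_m | Done of 'I_m.

(* [Choose v b] fixes the value of the variable [v]; its token for the clause
   [c] is late by 1 iff that value satisfies [c] (the delay of [Delay v b c]).
   [Check c b] adds a random delay [b], so [Done c] is reached at time 2 iff [c]
   is satisfied and [b = 1]. *)
Inductive transition :=
| Start | Choose of 'I_n & bool | Delay of 'I_n & bool & 'I_m | Check of 'I_m & bool | Finish.

Definition arc_pt (p : place) (t : transition) : bool :=
  match p, t with
  | Source, Start => true
  | Var v, Choose v' _ => v == v'
  | Lit v b c, Delay v' b' c' => [&& v == v', b == b' & c == c']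
  | Arg _ c, Check c' _ => c == c'
  | Done _, Finish => true
  | _, _ => false
  end.

Definition arc_tp (t : transition) (p : place) : bool :=
  match t, p with
  | Start, Var _ => true
  | Choose v b, Lit v' b' _ => (v == v') && (b == b')
  | Delay v _ c, Arg v' c' => (v == v') && (c == c')
  | Check c _, Done c' => c == c'
  | Finish, Sink => true
  | _, _ => false
  end.

Definition place_rank (p : place) : nat :=
  match p with
  | Source => 0 | Var _ => 2 | Lit _ _ _ => 4 | Arg _ _ => 6 | Done _ => 8 | Sink => 10
  end.

Definition transition_rank (t : transition) : nat :=
  match t with
  | Start => 1 | Choose _ _ => 3 | Delay _ _ _ => 5 | Check _ _ => 7 | Finish => 9
  end.

Lemma arc_pt_rank p t : arc_pt p t -> place_rank p < transition_rank t.
Proof. by case: p t => [||v|v b c|v c|c] []. Qed.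

Lemma arc_tp_rank t p : arc_tp t p -> transition_rank t < place_rank p.
Proof. by case: p t => [||v|v b c|v c|c] []. Qed.

(** A line follows the message from the variable [l.1] to the clause [l.2], whichever value is
    chosen. *)
Definition on_line (l : 'I_n * 'I_m) (p : place) : bool :=
  match p with
  | Source | Sink => true
  | Var v => v == l.1
  | Lit v _ c | Arg v c => (v == l.1) && (c == l.2)
  | Done c => c == l.2
  end.

Variables (P T : finType) (dP : P -> place) (eP : place -> P) (dT : T -> transition)
  (eT : transition -> T).
Hypotheses (dPK : cancel dP eP) (ePK : cancel eP dP) (dTK : cancel dT eT) (eTK : cancel eT dT).
Hypotheses (n_gt0 : 0 < n) (m_gt0 : 0 < m).

(** The nodes come from types in bijection with [place] and [transition], because an [instance] has
    ordinals as nodes. *)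
Definition clause_net : net P T :=
  Net [set x | arc_pt (dP x.1) (dT x.2)]%SET [set x | arc_tp (dT x.1) (dP x.2)]%SET
      (eP Source) (eP Sink).

Let N := clause_net.

Lemma in_pre p t : (p \in pre N t) = arc_pt (dP p) (dT t).
Proof. by rewrite !inE. Qed.

Lemma in_post p t : (p \in post N t) = arc_tp (dT t) (dP p).
Proof. by rewrite !inE. Qed.

Lemma clause_flow_rank x y : flow N x y ->
  match x with inl p => place_rank (dP p) | inr t => transition_rank (dT t) end <
  match y with inl p => place_rank (dP p) | inr t => transition_rank (dT t) end.
Proof.
case: x y => [p|t] [q|u] //=; rewrite inE /=; first exact: arc_pt_rank.
exact: arc_tp_rank.
Qed.

Lemma clause_acyclic : acyclic N.
Proof. exact: acyclic_rank clause_flow_rank. Qed.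

Lemma preE (t u : T) p : p \in pre N t -> p \in pre N u -> pre N t = pre N u.
Proof.
rewrite !in_pre => h1 h2; apply/setP => q; rewrite !in_pre.
move: h1 h2; case: (dP p) (dT t) => [||v|v b c|v c|c] [|v1 b1|v1 b1 c1|c1 b1|] //=;
  case: (dT u) => [|v2 b2|v2 b2 c2|c2 b2|] //=.
- by move=> /eqP-> /eqP->.
- by move=> /and3P[/eqP-> /eqP-> /eqP->] /and3P[/eqP-> /eqP-> /eqP->].
- by move=> /eqP-> /eqP->.
Qed.

Lemma clause_presets (t u : T) : ~~ independent N t u -> pre N t = pre N u.
Proof. by case/pred0Pn => p /andP[/= h1 h2]; apply: preE h1 h2. Qed.

Lemma clause_free_choice : free_choice N.
Proof.
move=> p q /set0Pn[t]; rewrite !inE /= => /andP[h1 h2]; apply/setP => u; rewrite !inE /=.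
move: h1 h2; case: (dP p) (dT t) => [||v|v b c|v c|c] [|v1 b1|v1 b1 c1|c1 b1|] //=;
  case: (dP q) => [||v2|v2 b2 c2|v2 c2|c2] //=.
- by move=> /eqP-> /eqP->.
- by move=> /and3P[/eqP-> /eqP-> /eqP->] /and3P[/eqP-> /eqP-> /eqP->].
- by move=> /eqP-> /eqP->.
Qed.

Definition line_mem l p := on_line l (dP p).

Let v0 : 'I_n := Ordinal n_gt0.
Let c0 : 'I_m := Ordinal m_gt0.

Lemma clause_line_cover p : exists l, line_mem l p.
Proof.
rewrite /line_mem; case: (dP p) => [||v|v b c|v c|c].
- by exists (v0, c0).
- by exists (v0, c0).
- by exists (v, c0) => /=.
- by exists (v, c); rewrite /= !eqxx.
- by exists (v, c); rewrite /= !eqxx.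
- by exists (v0, c) => /=.
Qed.

Lemma clause_line_source l : line_mem l (source N).
Proof. by rewrite /line_mem ePK. Qed.

Lemma clause_line_post t l p : p \in pre N t -> line_mem l p ->
  exists q, [/\ q \in post N t, line_mem l q &
                forall q', q' \in post N t -> line_mem l q' -> q' = q].
Proof.
rewrite in_pre /line_mem.
suff h : arc_pt (dP p) (dT t) -> on_line l (dP p) ->
    exists q, [/\ arc_tp (dT t) q, on_line l q &
                  forall q', arc_tp (dT t) q' -> on_line l q' -> q' = q].
  move=> h1 h2; have [q [q1 q2 q3]] := h h1 h2.
  exists (eP q); rewrite in_post ePK; split=> // q'; rewrite in_post => k1 k2.
  by rewrite -[q']dPK (q3 _ k1 k2).
case: l => lv lc; case: (dP p) (dT t) => [||v|v b c|v c|c] [|v1 b1|v1 b1 c1|c1 b1|] //=.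
- by move=> _ _; exists (Var lv); split=> //= -[||v2|v2 b2 c2|v2 c2|c2] //= _ /eqP->.
- move=> /eqP<- /eqP->; exists (Lit lv b1 lc); split; rewrite /= ?eqxx //.
  by move=> [||v2|v2 b2 c2|v2 c2|c2] //= /andP[/eqP<- /eqP<-] /andP[_ /eqP->].
- move=> /and3P[/eqP<- _ /eqP<-] /andP[/eqP-> /eqP->]; exists (Arg lv lc).
  split; rewrite /= ?eqxx //.
  by move=> [||v2|v2 b2 c2|v2 c2|c2] //= /andP[/eqP<- /eqP<-].
- move=> /eqP<- /andP[_ /eqP->]; exists (Done lc); split; rewrite /= ?eqxx //.
  by move=> [||v2|v2 b2 c2|v2 c2|c2] //= /eqP<-.
- by move=> _ _; exists Sink; split=> // -[||v2|v2 b2 c2|v2 c2|c2].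
Qed.

Lemma clause_line_pre t l q : q \in post N t -> line_mem l q ->
  exists2 p, p \in pre N t & line_mem l p.
Proof.
rewrite in_post /line_mem.
suff h : arc_tp (dT t) (dP q) -> on_line l (dP q) ->
    exists2 p, arc_pt p (dT t) & on_line l p.
  by move=> h1 h2; have [p p1 p2] := h h1 h2; exists (eP p); rewrite ?in_pre ePK.
case: l => lv lc; case: (dP q) (dT t) => [||v|v b c|v c|c] [|v1 b1|v1 b1 c1|c1 b1|] //=.
- by move=> _ _; exists (Done lc) => //=.
- by move=> _ _; exists Source.
- by move=> /andP[/eqP-> /eqP->] /andP[/eqP-> _]; exists (Var lv) => //=.
- by move=> /andP[/eqP-> /eqP->] /andP[/eqP-> /eqP->]; exists (Lit lv b1 lc); rewrite /= ?eqxx.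
- by move=> /eqP-> /eqP->; exists (Arg lv lc); rewrite /= ?eqxx.
Qed.

Lemma clause_pre_neq0 t : exists p, p \in pre N t.
Proof.
suff [p h] : exists p, arc_pt p (dT t) by exists (eP p); rewrite in_pre ePK.
case: (dT t) => [|v b|v b c|c b|].
- by exists Source.
- by exists (Var v) => /=.
- by exists (Lit v b c); rewrite /= !eqxx.
- by exists (Arg v0 c) => /=.
- by exists (Done c0).
Qed.

Lemma clause_lev t p q : p \in pre N t -> q \in post N t ->
  place_rank (dP p) < place_rank (dP q).
Proof.
by rewrite in_pre in_post => /arc_pt_rank h1 /arc_tp_rank h2; apply: ltn_trans h2.
Qed.

(** Tokens before [Arg] always enable something, so with the sink empty every line is at [Arg] or
    [Done]. If [Done c] is unmarked, all arguments of [c] have arrived and a [Check] is enabled; if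
    every [Done c] is marked, [Finish] is. *)
Lemma clause_dead A : one_token line_mem A -> (forall t, ~~ enabled N A t) ->
  A = [set sink N]%SET.
Proof.
move=> gA dead.
have dis t : ~ (forall p, arc_pt p t -> eP p \in A).
  move=> h; have /negP := dead (eT t); apply; rewrite enabledE; apply/fintype.subsetP => p.
  by rewrite in_pre eTK => /h; rewrite dPK.
have tok v c : eP Sink \notin A -> (eP (Arg v c) \in A) || (eP (Done c) \in A).
  move=> ns; have [p [pA lp _]] := gA (v, c); rewrite -[p]dPK in pA.
  move: lp pA; rewrite /line_mem; case: (dP p) => [||v1|v1 b1 c1|v1 c1|c1] //=.
  - by move=> _ h; case: (dis Start) => -[].
  - by rewrite (negPf ns).
  - by move=> _ h; case: (dis (Choose v1 true)) => -[] //= v2 /eqP->.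
  - move=> _ h; case: (dis (Delay v1 b1 c1)) => -[] //= v2 b2 c2.
    by move=> /and3P[/eqP-> /eqP-> /eqP->].
  - by move=> /andP[/eqP-> /eqP->] ->.
  - by move=> /eqP-> ->; rewrite orbT.
case: (boolP (eP Sink \in A)) => sA; last first.
  have dn c : eP (Done c) \in A.
    apply/negPn/negP => nc; case: (dis (Check c true)) => -[] //= v c' /eqP->.
    by have := tok v c sA; rewrite (negPf nc) orbF.
  by case: (dis Finish) => -[].
apply/setP => p; rewrite inE; apply/idP/eqP => [pA|->//].
have [l lp] := clause_line_cover p.
by apply: (one_token_eq gA pA sA lp); rewrite /line_mem ePK.
Qed.

Lemma clause_sound : sound N.
Proof.
apply: (@lines_sound _ _ _ _ line_mem (place_rank \o dP)).
- exact: clause_line_cover.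
- exact: clause_line_source.
- exact: clause_line_post.
- exact: clause_line_pre.
- exact: clause_pre_neq0.
- exact: clause_lev.
- exact: clause_dead.
Qed.

Lemma clause_one_safe : one_safe N.
Proof.
apply: (@lines_one_safe _ _ _ _ line_mem).
- exact: clause_line_cover.
- exact: clause_line_source.
- exact: clause_line_post.
- exact: clause_line_pre.
Qed.

Lemma clause_confusion_free : confusion_free N.
Proof. exact/confusion_free_equal_presets/clause_presets. Qed.

Lemma clause_workflow : workflow_net N.
Proof.
have rk := clause_flow_rank; split.
- by move=> x; apply/negP => /rk; rewrite /= ePK.
- move=> x; apply/negP => /rk; rewrite /= ePK /=.
  by case: x => [p|t]; [case: (dP p) | case: (dT t)].
set r := (r in connect r).
have pt p t : arc_pt p t -> connect r (inl (eP p)) (inr (eT t)).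
  by move=> h; apply: connect1; rewrite /r /= inE /= ePK eTK h.
have tp t p : arc_tp t p -> connect r (inr (eT t)) (inl (eP p)).
  by move=> h; apply: connect1; rewrite /r /= inE /= ePK eTK h.
have c1 v b : connect r (inl (eP Source)) (inr (eT (Choose v b))).
  apply: connect_trans (pt Source Start isT) _.
  by apply: connect_trans (tp Start (Var v) isT) _; apply: pt => /=.
have c2 v b c : connect r (inl (eP Source)) (inr (eT (Delay v b c))).
  apply: connect_trans (c1 v b) _; apply: connect_trans (tp _ (Lit v b c) _) _.
    by rewrite /= !eqxx.
  by apply: pt; rewrite /= !eqxx.
have c3 (v : 'I_n) c b : connect r (inl (eP Source)) (inr (eT (Check c b))).
  apply: connect_trans (c2 v true c) _; apply: connect_trans (tp _ (Arg v c) _) _.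
    by rewrite /= !eqxx.
  by apply: pt; rewrite /= !eqxx.
have d5 : connect r (inr (eT Finish)) (inl (eP Sink)) by apply: tp.
have d4 c b : connect r (inr (eT (Check c b))) (inl (eP Sink)).
  apply: connect_trans (tp _ (Done c) _) _; first by rewrite /=.
  exact: connect_trans (pt (Done c) Finish isT) d5.
have d3 v b c : connect r (inr (eT (Delay v b c))) (inl (eP Sink)).
  apply: connect_trans (tp _ (Arg v c) _) _; first by rewrite /= !eqxx.
  by apply: connect_trans (pt _ (Check c true) _) (d4 _ _); rewrite /=.
have d2 v b : connect r (inr (eT (Choose v b))) (inl (eP Sink)).
  apply: connect_trans (tp _ (Lit v b c0) _) _; first by rewrite /= !eqxx.
  by apply: connect_trans (pt _ (Delay v b c0) _) (d3 _ _ _); rewrite /= !eqxx.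
have from x : connect r (inl (eP Source)) x.
  case: x => [p|t].
    rewrite -[p]dPK; case: (dP p) => [||v|v b c|v c|c].
    - exact: connect0.
    - exact: connect_trans (c1 v0 true) (d2 _ _).
    - by apply: connect_trans (pt Source Start isT) _; apply: tp.
    - by apply: connect_trans (c1 v b) _; apply: tp; rewrite /= !eqxx.
    - by apply: connect_trans (c2 v true c) _; apply: tp; rewrite /= !eqxx.
    - by apply: connect_trans (c3 v0 c true) _; apply: tp => /=.
  rewrite -[t]dTK; case: (dT t) => [|v b|v b c|c b|].
  - exact: pt.
  - exact: c1.
  - exact: c2.
  - exact: (c3 v0).
  - apply: connect_trans (c3 v0 c0 true) _; apply: connect_trans (tp _ (Done c0) _) _ => //=.
    exact: pt.
have to x : connect r x (inl (eP Sink)).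
  case: x => [p|t].
    rewrite -[p]dPK; case: (dP p) => [||v|v b c|v c|c].
    - exact: connect_trans (c1 v0 true) (d2 _ _).
    - exact: connect0.
    - by apply: connect_trans (pt _ (Choose v true) _) (d2 _ _) => /=.
    - by apply: connect_trans (pt _ (Delay v b c) _) (d3 _ _ _); rewrite /= !eqxx.
    - by apply: connect_trans (pt _ (Check c true) _) (d4 _ _) => /=.
    - exact: connect_trans (pt (Done c) Finish isT) d5.
  rewrite -[t]dTK; case: (dT t) => [|v b|v b c|c b|] //.
  apply: connect_trans (tp Start (Var v0) isT) _.
  by apply: connect_trans (pt _ (Choose v0 true) _) (d2 _ _) => /=.
move=> x y; apply: connect_trans (to x) _; apply: connect_trans (from y).
by apply: connect1; rewrite /r /= eqxx.
Qed.

Lemma clause_choices (t : T) : #|\bigcup_(p in pre N t) place_post N p| <= 2.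
Proof.
(* A transition shares an input place only with the opposite outcome of its coin, if it has a
   coin. *)
pose alt (u : transition) : transition := match u with
  | Choose v b => Choose v (~~ b) | Check c b => Check c (~~ b) | _ => u end.
suff h : \bigcup_(p in pre N t) place_post N p \subset [set t; eT (alt (dT t))]%SET.
  by apply: leq_trans (subset_leq_card h) _; rewrite cards2; case: (_ != _).
apply/bigcupsP => p; rewrite in_pre => h1; apply/fintype.subsetP => u; rewrite !inE /= => h2.
suff : dT u = dT t \/ dT u = alt (dT t).
  case=> e; apply/orP; first by left; rewrite -[u]dTK e dTK.
  by right; rewrite -[u]dTK e.
move: h1 h2; case: (dP p) (dT t) => [||v|v b c|v c|c] [|v1 b1|v1 b1 c1|c1 b1|] //=;
  case: (dT u) => [|v2 b2|v2 b2 c2|c2 b2|] //=; try by left.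
- by move=> /eqP<- /eqP<-; case: b1 b2 => [] []; auto.
- by move=> /and3P[/eqP<- /eqP<- /eqP<-] /and3P[/eqP<- /eqP<- /eqP<-]; left.
- by move=> /eqP<- /eqP<-; case: b1 b2 => [] []; auto.
Qed.

End ClauseNet.

Arguments Source {n m}.
Arguments Sink {n m}.
Arguments Var {n m}.
Arguments Lit {n m}.
Arguments Arg {n m}.
Arguments Done {n m}.
Arguments Start {n m}.
Arguments Choose {n m}.
Arguments Delay {n m}.
Arguments Check {n m}.
Arguments Finish {n m}.

(** * Expected time of the clause net *)

Section Average.
Context d (X : measurableType d) (R : realType) (I : finType) (x : I -> X) (i0 : I).

Let weight_ge0 : (0 <= #|I|%:R^-1 :> R)%R.
Proof. by rewrite invr_ge0 ler0n. Qed.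

(** Points are counted with multiplicity. Being a scaled finite sum of Dirac measures, this is a
    measure by construction, and integrals against it are finite sums. *)
Definition average : set X -> \bar R :=
  mscale (NngNum weight_ge0)
    (msum (fun k => dirac (x (nth i0 (enum I) k)) : measure X R) #|I|).

HB.instance Definition _ := Measure.on average.

Lemma sum_nth_enum (F : I -> \bar R) :
  (\sum_(k < #|I|) F (nth i0 (enum I) k) = \sum_i F i)%E.
Proof.
transitivity (\sum_(i <- enum I) F i)%E.
  by rewrite (big_nth i0) big_mkord cardE.
by rewrite big_enum.
Qed.

Lemma averageE B (b : pred I) : (forall i, B (x i) <-> b i) ->
  average B = (#|b|%:R / #|I|%:R)%:E.
Proof.
move=> h; transitivity ((#|I|%:R^-1)%:E * \sum_i dirac (x i) B : \bar R)%E.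
  by congr (_ * _)%E; exact: (sum_nth_enum (fun i => dirac (x i) B)).
rewrite (eq_bigr (fun i => ((b i)%:R : R)%:E)); last first.
  move=> i _; rewrite diracE; case: (boolP (b i)) => bi.
    by rewrite mem_set // h.
  by rewrite memNset // h; apply/negP.
rewrite sumEFin -EFinM mulrC -natr_sum; congr (_%:R * _)%:E.
by rewrite -sum1_card [RHS]big_mkcond /=; apply: eq_bigr => i _; rewrite unfold_in; case: (b i).
Qed.

Lemma average_setT : average setT = 1%E.
Proof.
rewrite (@averageE _ predT) // divff // pnatr_eq0 -lt0n.
by apply/card_gt0P; exists i0.
Qed.

HB.instance Definition _ := Measure_isProbability.Build _ _ _ average average_setT.

Lemma average_integral (f : X -> \bar R) : measurable_fun setT f -> (forall y, 0 <= f y)%E ->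
  (\int[average]_(y in setT) f y = (#|I|%:R^-1)%:E * \sum_i f (x i))%E.
Proof.
move=> mf f0; rewrite ge0_integral_mscale // ge0_integral_measure_sum //.
congr (_ * _)%E; rewrite -sum_nth_enum; apply: eq_bigr => k _.
by rewrite integral_dirac // diracT mul1e.
Qed.

End Average.

(** * Measurability of the time to the sink *)

Section Measurability.
Variables (P T : finType) (W : tpwn P T) (R : realType).

(** There are finitely many states, so a set determined by prefixes of length [n] is a finite union
    of cylinders. *)
Lemma measurable_prefix (n : nat) (B : set (path_space P T)) :
  (forall pi pi' : path_space P T, mkseq pi n = mkseq pi' n -> B pi -> B pi') ->
  measurable B.
Proof.
move=> h.
rewrite (_ : B = \bigcup_(s in [set s : n.-tuple (state P T) | exists2 pi, B pi & mkseq pi n = s])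
                    (cylinder s : set (path_space P T)))%classic; last first.
  apply/seteqP; split=> [pi Bpi|pi [s [pi' B' e] e']].
    exists (Tuple (introT eqP (size_mkseq pi n))); first by exists pi.
    by rewrite /cylinder /= size_mkseq.
  by apply: h B'; rewrite e -e' size_tuple.
apply: fin_bigcup_measurable; first exact: finite_finset.
by move=> s _; apply: sub_sigma_algebra; exists (val s).
Qed.

(** Paths are sorted by their first visit to the sink: given that visit at [n], the time depends on
    a prefix of length [n.+1]. The paths without a visit form the complement and all have the value
    [+oo]. *)
Lemma measurable_time_to_sink : measurable_fun setT (@time_to_sink P T W R).
Proof.
move=> _ Y mY; rewrite setTI.
pose first_visit n (pi : path_space P T) :=
  pi n = sink_state W /\ forall k, k < n -> pi k <> sink_state W.
have first_exists pi : (exists n, pi n == sink_state W) -> exists n, first_visit n pi.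
  move=> ex; case: (ex_minnP ex) => n /eqP hn hm; exists n; split=> // k kn /eqP /hm.
  by rewrite leqNgt kn.
have first_value n pi : first_visit n pi -> time_to_sink W R pi =
    ((odflt 0 (time_of W (fired (mkseq pi n.+1))))%:R)%:E.
  move=> [h1 h2]; rewrite /time_to_sink; case: pselect => [visit|[]]; last first.
    by exists n; apply/eqP.
  case: ex_minnP => k /eqP hk hm; suff -> : k = n by [].
  apply/eqP; rewrite eqn_leq hm ?h1 // leqNgt; apply/negP => /h2; exact.
rewrite (_ : _ @^-1` Y = \bigcup_n [set pi | first_visit n pi /\ Y (time_to_sink W R pi)]
   `|` [set pi | ~ (exists n, first_visit n pi) /\ Y +oo%E])%classic; last first.
  apply/seteqP; split=> [pi /= Ypi|pi [[n _ [_ ]]//|[nv Yoo]]].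
    case: (pselect (exists n, first_visit n pi)) => [[n hn]|nv]; first by left; exists n.
    right; split=> //; move: Ypi; rewrite /time_to_sink; case: pselect => // v.
    by case: nv; apply: first_exists.
  rewrite /= /time_to_sink; case: pselect => // v.
  by case: nv; apply: first_exists.
apply: measurableU.
  apply: bigcup_measurable => n _; apply: (@measurable_prefix n.+1) => pi pi' e [v y].
  have v' : first_visit n pi'.
    have ek k : k < n.+1 -> pi' k = pi k.
      move=> kn; have := congr1 (fun s => nth (init_state W) s k) e.
      by rewrite !nth_mkseq.
    case: v => v1 v2; split=> [|k kn]; first by rewrite ek.
    by rewrite ek; [exact: v2 | exact: ltnW].
  by split=> //; rewrite (first_value _ _ v') -e -(first_value _ _ v).
have [yes|no] := pselect (Y +oo%E); last first.
  rewrite (_ : [set _ | _] = set0)%classic ?measurable0 //.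
  by apply/seteqP; split=> // pi [].
rewrite (_ : [set _ | _]%classic = ~` \bigcup_n [set pi | first_visit n pi])%classic; last first.
  apply/seteqP; split=> [pi [nv _] [n _ v]|pi nv]; first by apply: nv; exists n.
  by split=> // -[n v]; apply: nv; exists n.
apply: measurableC; apply: bigcup_measurable => n _.
apply: (@measurable_prefix n.+1) => pi pi' e [v1 v2].
have ek k : k < n.+1 -> pi' k = pi k.
  move=> kn; have := congr1 (fun s => nth (init_state W) s k) e.
  by rewrite !nth_mkseq.
split=> [|k kn]; first by rewrite ek.
by rewrite ek; [exact: v2 | exact: ltnW].
Qed.

Lemma time_to_sink_ge0 pi : (0 <= time_to_sink W R pi)%E.
Proof. by rewrite /time_to_sink; case: pselect => // v; rewrite lee_fin ler0n. Qed.

End Measurability.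

(** * Runs determined by the coins *)

Section Runs.
Variables (n m : nat) (inc : 'I_n -> bool -> 'I_m -> bool).
Variables (P T : finType) (dP : P -> place n m) (eP : place n m -> P)
  (dT : T -> transition n m) (eT : transition n m -> T).
Hypotheses (dPK : cancel dP eP) (ePK : cancel eP dP) (dTK : cancel dT eT) (eTK : cancel eT dT).
Hypotheses (n_gt0 : 0 < n) (m_gt0 : 0 < m).

Definition clause_tpwn : tpwn P T :=
  TPWN (clause_net dP eP dT) (fun=> 1%R)
    (fun t => match dT t with
              | Delay v b c => inc v b c : nat
              | Check _ b => b : nat
              | _ => 0
              end).

Let W := clause_tpwn.
Let N : net P T := W.
Let mem := line_mem dP.

(* The net has no other random choices, so a run is determined, up to the order
   of its steps, by tossing all coins in advance. *)
Definition coin := ('I_n + 'I_m)%type.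
Definition coins := {ffun coin -> bool}.

Definition coin_of (t : transition n m) : option coin :=
  match t with
  | Choose v _ => Some (inl v)
  | Check c _ => Some (inr c)
  | _ => None
  end.

Definition outcome (k : coin) (b : bool) : transition n m :=
  match k with inl v => Choose v b | inr c => Check c b end.

(** Picking a transition only selects its conflict set; the coin then decides which member of that
    set fires. *)
Definition resolve (w : coins) (t : T) : T :=
  if coin_of (dT t) is Some k then eT (outcome k (w k)) else t.

Lemma coin_of_outcome k b : coin_of (outcome k b) = Some k.
Proof. by case: k. Qed.

Lemma outcome_coin_of t k : coin_of t = Some k -> exists b, t = outcome k b.
Proof. by case: t => //= [v b|c b] [<-]; exists b. Qed.

Lemma arc_pt_outcome p k b b' : arc_pt p (outcome k b) = arc_pt p (outcome k b').
Proof. by case: k p => [v|c] []. Qed.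

Lemma arc_pt_coin_of p t u : arc_pt p t -> arc_pt p u ->
  coin_of t = coin_of u /\ (coin_of t = None -> t = u).
Proof.
case: p t => [||v|v b c|v c|c] [|v1 b1|v1 b1 c1|c1 b1|] //=;
  case: u => [|v2 b2|v2 b2 c2|c2 b2|] //=.
- by move=> /eqP<- /eqP<-.
- by move=> /and3P[/eqP<- /eqP<- /eqP<-] /and3P[/eqP<- /eqP<- /eqP<-].
- by move=> /eqP<- /eqP<-.
Qed.

Lemma pre_resolve w t : pre N (resolve w t) = pre N t.
Proof.
apply/setP => p; rewrite !in_pre /resolve; case e: (coin_of (dT t)) => [k|] //.
by have [b ->] := outcome_coin_of e; rewrite eTK (arc_pt_outcome _ _ _ b).
Qed.

Lemma enabled_resolve w A t : enabled N A (resolve w t) = enabled N A t.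
Proof. by rewrite !enabledE pre_resolve. Qed.

Definition pick_enabled (A : {set P}) : option T := [pick t | enabled N A t].

Definition next_state (w : coins) (s : state P T) : state P T :=
  match s with
  | inl A => if pick_enabled A is Some t then inr (A, resolve w t) else inl A
  | inr (A, t) => inl (fire_set N A t)
  end.

Definition run (w : coins) (k : nat) : state P T := iter k (next_state w) (init_state W).

(** In a state [inr (A, t)] the transition [t] already belongs to the [fired] sequence, so
    invariants about time stamps concern the marking after it. *)
Definition settled (s : state P T) : {set P} :=
  match s with inl A => A | inr (A, t) => fire_set N A t end.

Definition good := one_token mem.

Lemma good_fire A t : good A -> enabled N A t -> good (fire_set N A t).
Proof.
apply: one_token_fire; [exact: clause_line_post | exact: clause_line_pre].
Qed.

Definition satisfied (w : coins) (c : 'I_m) : bool := [exists v, inc v (w (inl v)) c].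

(** The time at which a token arrives at [p] is a function of the coins alone, whatever the order of
    the firings. This makes the running time explicit at [Sink]. *)
Definition stamp (w : coins) (p : place n m) : nat :=
  match p with
  | Arg v c => inc v (w (inl v)) c
  | Done c => satisfied w c + w (inr c)
  | Sink => \max_c (satisfied w c + w (inr c))
  | _ => 0
  end.

Definition compatible (w : coins) (p : place n m) : bool :=
  if p is Lit v b _ then b == w (inl v) else true.

Lemma stamp_fire w t q : (forall p, p \in pre N (resolve w t) -> compatible w (dP p)) ->
  q \in post N (resolve w t) ->
  compatible w (dP q) /\
  stamp w (dP q) = tau W (resolve w t) + \max_(p in pre N (resolve w t)) stamp w (dP p).
Proof.
set u := resolve w t => comp; rewrite in_post.
(* A maximum over the preset is recognised by an upper bound that is attained or is 0. *)
have bigE x : (forall p, arc_pt p (dT u) -> stamp w p <= x) ->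
    (x = 0 \/ exists2 p, arc_pt p (dT u) & stamp w p = x) ->
    \max_(p in pre N u) stamp w (dP p) = x.
  move=> h1 h2; apply/eqP; rewrite eqn_leq; apply/andP; split.
    by apply/bigmax_leqP => p; rewrite in_pre; apply: h1.
  case: h2 => [->//|[p hp <-]]; rewrite -(ePK p).
  by apply: leq_bigmax_cond; rewrite in_pre ePK.
have compP p : arc_pt p (dT u) -> compatible w p.
  by move=> h; rewrite -(ePK p); apply: comp; rewrite in_pre ePK.
have ru : coin_of (dT u) = None \/ exists k, dT u = outcome k (w k).
  rewrite /u /resolve; case e: (coin_of (dT t)) => [k|]; last by left.
  by right; exists k; rewrite eTK.
move: bigE compP ru; rewrite /= -/u.
case: (dT u) => [|v b|v b c|c b|]; case: (dP q) => [||v1|v1 b1 c1|v1 c1|c1] //= bigE compP ru hq.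
- by rewrite (bigE 0) //; [case | left].
- move: hq => /andP[/eqP<- /eqP<-].
  have -> : w (inl v) = b by case: ru => // -[[v2|c2]] //= [-> ->].
  by split=> //; rewrite (bigE 0) //; [case | left].
- move: hq => /andP[/eqP<- /eqP<-].
  have /eqP -> : b == w (inl v) by apply: (compP (Lit v b c)); rewrite /= !eqxx.
  by split=> //; rewrite (bigE 0) ?addn0 //; [case | left].
- move/eqP: hq => <-.
  have -> : w (inr c) = b by case: ru => // -[[v2|c2]] //= [-> ->].
  split=> //; rewrite addnC; congr (_ + _); apply/esym/bigE.
    move=> [] //= v c2 /eqP ->; rewrite /satisfied.
    by case e: (inc _ _ _) => //; rewrite lt0b; apply/existsP; exists v.
  case e: (satisfied w c); last by left.
  by right; have /existsP[v hv] := e; exists (Arg v c) => /=; rewrite ?hv.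
- split=> //; rewrite add0n; apply/esym/bigE.
    by move=> [] //= c _; apply: (leq_bigmax (F := fun c => satisfied w c + w (inr c))).
  have cm : 0 < #|'I_m| by rewrite card_ord.
  have [c hc] := @bigop.eq_bigmax 'I_m (fun c => satisfied w c + w (inr c)) cm.
  by right; exists (Done c).
Qed.

(** All unmarked places carry bottom, so [max_bot] becomes an ordinary maximum as soon as one marked
    place is present. *)
Lemma big_max_bot (I : Type) (r : seq I) (Q A : pred I) (f : I -> nat) :
  \big[max_bot/None]_(i <- r | Q i) (if A i then Some (f i) else None)
  = if has (predI Q A) r then Some (\max_(i <- r | Q i && A i) f i) else None.
Proof.
elim: r => [|i r IH]; first by rewrite !big_nil.
rewrite !big_cons /=; case: (Q i) => //=; rewrite {}IH; case: (A i) => //=.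
case e: (has _ r) => //=; congr Some; rewrite big_hasC ?maxn0 //; exact: negbT.
Qed.

Definition stamped (w : coins) (A : {set P}) (x : timestamps P) : Prop :=
  forall p, x p = if p \in A then Some (stamp w (dP p)) else None.

Lemma stamped_fire w A t x : good A -> enabled N A t ->
  (forall p, p \in A -> compatible w (dP p)) -> stamped w A x ->
  let u := resolve w t in
  (forall p, p \in fire_set N A u -> compatible w (dP p)) /\
  stamped w (fire_set N A u) (upd W x u).
Proof.
move=> gA en comp st u.
have eu : enabled N A u by rewrite /u enabled_resolve.
move: (eu); rewrite enabledE => /fintype.subsetP sA.
have key q := @stamp_fire w t q (fun p hp => comp p (sA p hp)).
split=> p; rewrite in_fire; first by case/orP => [/andP[_ /comp]|/key[]].
rewrite /upd ffunE; case: ifP => [pt|npt].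
  rewrite orbT (proj2 (key p pt)).
  rewrite (eq_bigr (fun q => if q \in A then Some (stamp w (dP q)) else None));
    last by move=> q _; rewrite st.
  rewrite big_max_bot ifT /=.
    by congr Some; congr addn; apply: eq_bigl => q; case qt: (q \in pre N u); rewrite ?(sA _ qt).
  have [q hq] := @clause_pre_neq0 n m P T dP eP dT ePK n_gt0 m_gt0 u.
  by apply/hasP; exists q; rewrite ?mem_index_enum //= hq sA.
rewrite orbF; case: ifP => pt //=; exact: st.
Qed.

(** The claims need each other: the stamps follow [stamp] because marked literals agree with the
    coins, and the one-token property underlies every firing. *)
Lemma run_invariant w k :
  [/\ good (settled (run w k)),
      forall p, p \in settled (run w k) -> compatible w (dP p)
    & stamped w (settled (run w k))
        (foldl (upd W) (init_timestamps W) (fired (mkseq (run w) k.+1)))].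
Proof.
have firedS h s : fired (rcons h s) = fired h ++ fired [:: s] :> seq T.
  by rewrite /fired -cats1 pmap_cat.
elim: k => [|k [g c st]].
  split=> [|p|p] /=.
  - by apply: (@one_token_source _ _ N _ mem) => l; rewrite /mem /line_mem ePK.
  - by rewrite inE => /eqP->; rewrite ePK.
  - by rewrite ffunE !inE; case: eqP => // ->; rewrite ePK.
rewrite mkseqS firedS foldl_cat.
have e : run w k.+1 = next_state w (run w k) by [].
move: g c st; rewrite e; case: (run w k) => [A|[A t]] /= g c st; last first.
  by rewrite /fired /=; split.
rewrite /pick_enabled; case: pickP => [t en|none]; last by rewrite /fired /=; split.
have [c' st'] := stamped_fire g en c st.
by split=> //; apply: good_fire => //; rewrite enabled_resolve.
Qed.

Lemma run_good w k A : run w k = inl A -> good A.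
Proof. by have [g _ _] := run_invariant w k; move=> e; rewrite e in g. Qed.

(** A firing takes two steps of the run and increases the bounded potential; a marking without
    enabled transitions is the sink. *)
Lemma run_visits w : exists k, run w k == sink_state W.
Proof.
suff : forall A j, run w j = inl A -> exists k, run w k == sink_state W.
  by move=> /(_ _ 0 erefl).
move=> A j.
pose pot := potential mem (@place_rank n m \o dP).
have [M leM] : exists M, forall B, good B -> pot B <= M.
  by eexists => B gB; exact: potential_le.
have [b] := ubnP (M - pot A).
elim: b A j => // b IH A j hb e.
have gA := run_good e.
have e1 : run w j.+1 = next_state w (inl A) by rewrite -e.
have : pick_enabled A = pick_enabled A by [].
rewrite {1}/pick_enabled; case: pickP => [t en|none] pk; last first.
  exists j; rewrite e /sink_state; apply/eqP; congr inl.
  by apply: (@clause_dead n m P T dP eP dT eT dPK ePK eTK n_gt0 m_gt0) => // t; rewrite none.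
have eu : enabled N A (resolve w t) by rewrite enabled_resolve.
have gF := good_fire gA eu.
rewrite /= -pk in e1.
have e2 : run w j.+2 = inl (fire_set N A (resolve w t)).
  by rewrite -[LHS]/(next_state w (next_state w (run w j))) e1.
apply: (IH _ _ _ e2).
have lt : pot A < pot (fire_set N A (resolve w t)).
  apply: potential_fire => //.
  - exact: clause_line_cover.
  - exact: clause_line_post.
  - exact: clause_line_pre.
  - exact: clause_pre_neq0.
  - exact: clause_lev.
have := leM _ gF; lia.
Qed.

Lemma time_run (R : realType) w :
  time_to_sink W R (run w : path_space P T) = ((stamp w Sink)%:R)%:E.
Proof.
rewrite /time_to_sink; case: pselect => [v|[]]; last exact: run_visits.
case: ex_minnP => k /eqP hk _.
have [_ _ st] := run_invariant w k; rewrite hk /= in st.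
rewrite /time_of (eq_bigr (fun p => if p \in [set eP Sink]%SET
                                    then Some (stamp w (dP p)) else None)); last first.
  by move=> p _; rewrite st.
rewrite big_max_bot ifT /=; last first.
  by apply/hasP; exists (eP Sink); rewrite ?mem_index_enum //= inE.
by rewrite (big_pred1 (eP Sink)) ?ePK // => p; rewrite inE.
Qed.

End Runs.

(** * The induced measure and its expectation *)

Section Expectation.
Variables (n m : nat) (inc : 'I_n -> bool -> 'I_m -> bool).
Variables (P T : finType) (dP : P -> place n m) (eP : place n m -> P)
  (dT : T -> transition n m) (eT : transition n m -> T).
Hypotheses (dPK : cancel dP eP) (ePK : cancel eP dP) (dTK : cancel dT eT) (eTK : cancel eT dT).
Hypotheses (n_gt0 : 0 < n) (m_gt0 : 0 < m).

Let W := clause_tpwn inc dP eP dT.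
Let N : net P T := W.
Let mem := line_mem dP.
Let lev := @place_rank n m \o dP.
Local Notation run := (run inc dP eP dT eT).
Local Notation next := (next_state inc dP eP dT eT).
Local Notation picked := (pick_enabled inc dP eP dT).
Local Notation settled := (settled inc dP eP dT).

Definition memoryless (s : state P T) : {set T} :=
  if s is inl A then if picked A is Some t then conflict_set N t A else finset.set0
  else finset.set0.

Definition clause_scheduler (h : seq (state P T)) : {set T} :=
  if h is s0 :: h' then memoryless (last s0 h') else finset.set0.

Lemma clause_schedulerP : scheduler W clause_scheduler.
Proof.
move=> s0 h A e /existsP[t en]; rewrite /clause_scheduler /memoryless e /pick_enabled.
case: pickP => [u eu|/(_ t)]; last by rewrite en.
by apply/imsetP; exists u => //; rewrite inE.
Qed.

Lemma pre_coin t u : coin_of (dT t) != None -> coin_of (dT t) = coin_of (dT u) ->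
  pre N t = pre N u.
Proof.
case e: (coin_of (dT t)) => [k|] // _ /esym e'.
apply/setP => p; rewrite !in_pre.
have [b ->] := outcome_coin_of e; have [b' ->] := outcome_coin_of e'.
exact: arc_pt_outcome.
Qed.

(** Transitions with a common input place have the same coin or are equal, so a conflict set
    consists of the two outcomes of a coin or is a singleton. *)
Lemma conflictE A t u : enabled N A t ->
  (u \in conflict_set N t A) =
  if coin_of (dT t) is Some k then coin_of (dT u) == Some k else u == t.
Proof.
move=> en; rewrite inE.
have [p pt] := @clause_pre_neq0 n m P T dP eP dT ePK n_gt0 m_gt0 t.
have dep v : pre N v = pre N t -> enabled N A v && ~~ independent N t v.
  move=> e; rewrite enabledE e -enabledE en /=.
  by apply/pred0Pn; exists p; rewrite /= pt e pt.
apply/andP/idP => [[eu /pred0Pn[q /andP[/= q1 q2]]]|].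
  rewrite in_pre in q1; rewrite in_pre in q2.
  have [c1 c2] := arc_pt_coin_of q1 q2.
  case e: (coin_of (dT t)) => [k|]; first by rewrite -c1 e.
  by apply/eqP; rewrite -[u]dTK -(c2 e) dTK.
case e: (coin_of (dT t)) => [k|].
  by move=> /eqP eu; apply/andP/dep/esym/pre_coin; rewrite ?e ?eu.
by move/eqP->; apply/andP/dep.
Qed.

Definition flip (k : coin n m) (w : coins n m) : coins n m :=
  [ffun j => if j == k then ~~ w j else w j].

Lemma flipK k : involutive (flip k).
Proof. by move=> w; apply/ffunP => j; rewrite !ffunE; case: eqP => // _; rewrite negbK. Qed.

Lemma settled_monotone w i j l : i <= j ->
  \sum_(q in settled (run w i) | mem l q) lev q
  <= \sum_(q in settled (run w j) | mem l q) lev q.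
Proof.
elim: j => [|j IH]; first by rewrite leqn0 => /eqP->.
rewrite leq_eqVlt => /orP[/eqP->//|]; rewrite ltnS => /IH h; apply: (leq_trans h).
have -> : run w j.+1 = next w (run w j) by [].
have [g _ _] := run_invariant inc dPK ePK eTK n_gt0 m_gt0 w j.
move: g; case: (run w j) => [A|[A t]] //= g.
rewrite /= /pick_enabled; case: pickP => //= t en.
apply: (@line_fire_le _ _ N _ mem lev) => //.
- exact: clause_line_post.
- exact: clause_line_pre.
- exact: clause_lev.
- by rewrite enabled_resolve.
Qed.

(* A coin is tossed at most once: once it is used, the token on its line has
   moved past the place where it is tossed. *)
Lemma coin_unused w i j A B t u k : i < j -> run w i = inl A -> run w j = inl B ->
  picked A = Some t -> enabled N B u ->
  coin_of (dT t) = Some k -> coin_of (dT u) = Some k -> False.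
Proof.
move=> ij ei ej pk eu ct cu.
have en : enabled N A t by move: pk; rewrite /pick_enabled; case: pickP => // t' et [<-].
have [p pt] := @clause_pre_neq0 n m P T dP eP dT ePK n_gt0 m_gt0 t.
have [l lp] := clause_line_cover dP n_gt0 m_gt0 p.
have gA := run_good dPK ePK eTK n_gt0 m_gt0 ei.
have gB := run_good dPK ePK eTK n_gt0 m_gt0 ej.
have pu : p \in pre N u by rewrite -(@pre_coin t u) ?ct ?cu.
have pA : p \in A by move: en; rewrite enabledE => /fintype.subsetP; apply.
have pB : p \in B by move: eu; rewrite enabledE => /fintype.subsetP; apply.
have er : enabled N A (resolve dT eT w t) by rewrite enabled_resolve.
have := settled_monotone w l ij; rewrite ej [settled (inl _)]/=.
have -> : run w i.+1 = next w (run w i) by [].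
rewrite ei /= pk /= (@line_token _ _ mem lev _ _ _ gB pB lp) leqNgt.
rewrite -(@line_token _ _ mem lev _ _ _ gA pA lp) => /negP; apply.
apply: (@line_fire_lt _ _ N _ mem lev _ _ _ _ _ _ _ gA er _ lp).
- exact: clause_line_post.
- exact: clause_line_pre.
- exact: clause_lev.
- by rewrite pre_resolve.
Qed.

Definition follows (h : seq (state P T)) : pred (coins n m) :=
  fun w => mkseq (run w) (size h) == h.

Lemma in_follows h w : (w \in follows h) = follows h w.
Proof. by []. Qed.

Lemma follows_nth s0 h w i : follows (s0 :: h) w -> i <= size h ->
  run w i = nth s0 (s0 :: h) i.
Proof.
by move=> /eqP e hi; have := congr1 (fun s => nth s0 s i) e; rewrite nth_mkseq.
Qed.

Lemma follows_last s0 h w : follows (s0 :: h) w -> run w (size h) = last s0 h.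
Proof. by move=> f; rewrite (follows_nth f) //= (last_nth s0). Qed.

(** The coin [k] is about to be tossed after [h]; by [coin_unused] it has not been tossed along [h],
    so its value cannot have influenced the path. *)
Lemma follows_flip s0 h A t k w : last s0 h = inl A -> picked A = Some t ->
  coin_of (dT t) = Some k -> follows (s0 :: h) w -> follows (s0 :: h) (flip k w).
Proof.
move=> el pk ct f; rewrite /follows; move: (f) => /eqP {2}<-; apply/eqP.
have en : enabled N A t by move: pk; rewrite /pick_enabled; case: pickP => // t' et [<-].
have e j : j <= size h -> run (flip k w) j = run w j.
  elim: j => // j IH jh.
  have -> : run (flip k w) j.+1 = next (flip k w) (run (flip k w) j) by [].
  have -> : run w j.+1 = next w (run w j) by [].
  rewrite IH ?(ltnW jh) //; case ej: (run w j) => [B|[B u]] //=.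
  case pB: (pick_enabled _ _ _ _ B) => [u|] //=.
  rewrite /resolve; case cu: (coin_of (dT u)) => [k'|] //.
  rewrite ffunE; case: eqP => // kk.
  have {}cu : coin_of (dT u) = Some k by rewrite cu kk.
  by case: (coin_unused jh ej _ pB en cu ct); rewrite (follows_last f).
by apply/eq_in_map => j; rewrite mem_iota => /andP[_ hj]; apply: e.
Qed.

Lemma follows_flipE s0 h A t k w : last s0 h = inl A -> picked A = Some t ->
  coin_of (dT t) = Some k -> follows (s0 :: h) (flip k w) = follows (s0 :: h) w.
Proof.
move=> el pk ct; apply/idP/idP; last exact: (follows_flip el pk ct).
by rewrite -{2}(flipK k w); apply: (follows_flip el pk ct).
Qed.

Lemma follows_rcons s0 h s w :
  follows (rcons (s0 :: h) s) w = follows (s0 :: h) w && (next w (last s0 h) == s).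
Proof.
rewrite /follows size_rcons mkseqS eqseq_rcons -/(follows _ _).
by case f: (follows _ _) => //=; rewrite -(follows_last f).
Qed.

(** Flipping [k] is an involution on the assignments that follow the path, and it exchanges the two
    values of [k]; each value takes one half. *)
Lemma card_toss s0 h A t k b : last s0 h = inl A -> picked A = Some t ->
  coin_of (dT t) = Some k ->
  #|[pred w | follows (s0 :: h) w && (w k == b)]| * 2 = #|follows (s0 :: h)|.
Proof.
move=> el pk ct; rewrite -[RHS](cardID [pred w : coins n m | w k == b]) muln2 -addnn.
congr (_ + _).
rewrite -!sum1_card (reindex_inj (inv_inj (flipK k))) /=.
apply: eq_bigl => w; rewrite !inE (follows_flipE _ el pk ct) andbC ffunE eqxx.
by congr (_ && _); case: (w k) b => [] [].
Qed.

(** A step without a coin keeps the number of assignments, a toss halves it, and an impossible step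
    makes it 0. These are the factors 1, 1/2 and 0 of [next_prob], since all weights are 1. *)
Lemma card_follows_rcons s0 h s :
  (#|follows (rcons (s0 :: h) s)|%:R
   = #|follows (s0 :: h)|%:R * next_prob W clause_scheduler s0 h s :> rat)%R.
Proof.
have cardE0 (B : pred (coins n m)) : (forall w, B w = false) -> #|B| = 0.
  by move=> h0; apply: eq_card0 => w; rewrite unfold_in h0.
have sure s' : (forall w, next w (last s0 h) = s') ->
    (#|follows (rcons (s0 :: h) s)|%:R = #|follows (s0 :: h)|%:R * (s == s')%:R :> rat)%R.
  move=> hs; case: eqP => [->|ne].
    by rewrite mulr1; congr (_%:R)%R; apply: eq_card => w;
      rewrite ?inE !in_follows follows_rcons hs eqxx andbT.
  rewrite mulr0 cardE0 // => w; rewrite follows_rcons hs; apply/negbTE.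
  by rewrite negb_and orbC; apply/orP; left; apply/eqP => /esym.
rewrite /next_prob; case el: (last s0 h) => [A|[A t]]; last first.
  by apply: sure => w; rewrite el.
case: ifP => [/existsP[t0 en0]|/negbT/existsPn none]; last first.
  apply: sure => w; rewrite el /= /pick_enabled; case: pickP => // t en.
  by move: (none t); rewrite en.
have [t pk] : exists t, picked A = Some t.
  by rewrite /pick_enabled; case: pickP => [t _|/(_ t0)]; [exists t | rewrite en0].
have en : enabled N A t by move: pk; rewrite /pick_enabled; case: pickP => // t' et [<-].
have -> : clause_scheduler (s0 :: h) = conflict_set N t A.
  by rewrite /= el /= pk.
have nx w : next w (last s0 h) = inr (A, resolve dT eT w t) by rewrite el /= pk.
have sumC : (\sum_(u in conflict_set N t A) weight W u = #|conflict_set N t A|%:R :> rat)%R.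
  by rewrite /= sumr_const.
rewrite /= in sumC; rewrite /= sumC div1r.
have inC w : resolve dT eT w t \in conflict_set N t A.
  rewrite conflictE // /resolve; case: (coin_of (dT t)) => [k|] //.
  by rewrite eTK coin_of_outcome.
have never : (forall w, inr (A, resolve dT eT w t) <> s) ->
    (#|follows (rcons (s0 :: h) s)|%:R = #|follows (s0 :: h)|%:R * 0 :> rat)%R.
  move=> ne; rewrite mulr0 cardE0 // => w; rewrite follows_rcons nx; apply/negbTE.
  by rewrite negb_and orbC; apply/orP; left; apply/eqP; apply: ne.
case es: s => [B|[B u]]; rewrite -es; first by apply: never => w; rewrite es.
case: ifP => [/andP[/eqP eB uC]|nC]; last first.
  by apply: never => w; rewrite es => -[eB eu]; move: nC; rewrite -eB -eu eqxx inC.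
case ct: (coin_of (dT t)) => [k|].
  have cC : #|conflict_set N t A| = 2.
    rewrite (_ : conflict_set N t A = [set eT (outcome k true); eT (outcome k false)]%SET).
      by rewrite cards2; case: eqP => // /(can_inj eTK); case: (k) => [v|c] [].
    apply/setP => v; rewrite conflictE // ct !inE.
    apply/eqP/orP => [/outcome_coin_of[b e]|[/eqP->|/eqP->]]; rewrite ?eTK ?coin_of_outcome //.
    by rewrite -[v]dTK e; case: b {e}; [left | right].
  move: uC; rewrite conflictE // ct => /eqP /outcome_coin_of[b eu].
  have -> : #|follows (rcons (s0 :: h) s)| = #|[pred w | follows (s0 :: h) w && (w k == b)]|.
    apply: eq_card => w; rewrite ?inE !in_follows follows_rcons nx es eB; congr (_ && _).
    apply/eqP/eqP => [[]|e]; last by rewrite /resolve ct e -eu dTK.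
    rewrite /resolve ct -[u]dTK eu => /(can_inj eTK).
    by case: k {ct cC eu} => [v|c] [].
  rewrite cC -(card_toss b el pk ct) natrM mulfK //.
have cC : #|conflict_set N t A| = 1.
  rewrite (_ : conflict_set N t A = [set t]%SET) ?cards1 //.
  by apply/setP => v; rewrite conflictE // ct inE.
rewrite cC invr1 mulr1; move: uC; rewrite conflictE // ct => /eqP eu.
congr (_%:R)%R; apply: eq_card => w; rewrite ?inE !in_follows follows_rcons nx es eB eu.
by rewrite /resolve ct eqxx andbT.
Qed.

Variable R : realType.

Let w0 : coins n m := [ffun=> true].

Definition run_path (w : coins n m) : path_space P T := run w.

(** The measure of a cylinder is the fraction of coin assignments whose run follows it, so the
    product rule is [card_follows_rcons] transported to the reals. *)
Lemma average_induced : induced_by W clause_scheduler (average R run_path w0).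
Proof.
have cyl h : (average R run_path w0 : probability (path_space P T) R) (cylinder h)
    = (#|follows h|%:R / #|{: coins n m}|%:R)%:E.
  by apply: averageE => w; split=> [e|/eqP]; [apply/eqP | ].
split=> [s|s0 h s]; rewrite !cyl.
  have n0 : (#|{: coins n m}|%:R != 0 :> R)%R.
    by rewrite pnatr_eq0 -lt0n; apply/card_gt0P; exists w0.
  case: eqP => [->|ne].
    by rewrite (_ : #|follows _| = #|{: coins n m}|) ?divff //; apply: eq_card => w;
      rewrite in_follows /follows /= eqxx.
  rewrite (_ : #|follows _| = 0) ?mul0r //; apply: eq_card0 => w.
  by rewrite in_follows /follows /= eqseq_cons andbT; apply/eqP => /esym.
rewrite -EFinM; congr EFin.
have := congr1 (ratr : rat -> R) (card_follows_rcons s0 h s).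
by rewrite rmorphM /= !ratr_nat => ->; rewrite mulrAC.
Qed.

Lemma average_expected_time :
  expected_time W (average R run_path w0 : probability _ R) =
  ((\sum_w stamp inc w Sink)%:R / #|{: coins n m}|%:R)%:E.
Proof.
rewrite /expected_time average_integral; first last.
- exact: time_to_sink_ge0.
- exact: measurable_time_to_sink.
rewrite (eq_bigr (fun w => ((stamp inc w Sink)%:R : R)%:E)); last first.
  by move=> w _; exact: (time_run inc dPK ePK eTK n_gt0 m_gt0).
by rewrite sumEFin -EFinM -natr_sum mulrC.
Qed.

End Expectation.

(** * Weighted counting of violated clauses *)

Section Weights.
Variables (n m : nat) (inc : 'I_n -> bool -> 'I_m -> bool).

Definition sat_clause (s : {ffun 'I_n -> bool}) (c : 'I_m) : bool :=
  [exists v, inc v (s v) c].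

Definition unsat_count (s : {ffun 'I_n -> bool}) : nat := #|[pred c | ~~ sat_clause s c]|.

Definition violation_weight : nat := \sum_s 2 ^ unsat_count s.

Variable c0 : 'I_m.
Hypothesis taut : forall s, sat_clause s c0.

Definition join_coins (p : {ffun 'I_n -> bool} * {ffun 'I_m -> bool}) : coins n m :=
  [ffun k => match k with inl v => p.1 v | inr c => p.2 c end].

Lemma join_coins_bij : bijective join_coins.
Proof.
exists (fun w : coins n m => ([ffun v : 'I_n => w (inl v)], [ffun c : 'I_m => w (inr c)])).
  by case=> s t; congr pair; apply/ffunP => i; rewrite !ffunE.
by move=> w; apply/ffunP => -[i|i]; rewrite !ffunE.
Qed.

Lemma satisfied_join p c : satisfied inc (join_coins p) c = sat_clause p.1 c.
Proof. by apply: eq_existsb => v; rewrite ffunE. Qed.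

Lemma stamp_sink p :
  stamp inc (join_coins p) Sink + [forall c, sat_clause p.1 c ==> ~~ p.2 c] = 2.
Proof.
rewrite /=; set M := \max_c _.
have eM c : satisfied inc (join_coins p) c + join_coins p (inr c) = sat_clause p.1 c + p.2 c.
  by rewrite satisfied_join ffunE.
(* The coin of the tautological clause may be down, but its delay alone gives 1. *)
have M1 : 1 <= M.
  apply: leq_trans (@bigop.leq_bigmax _ (fun c => satisfied inc (join_coins p) c + _) c0).
  by rewrite eM taut.
case: forallP => [h|/forallP/forallPn[c]] /=.
  suff : M <= 1 by lia.
  apply/bigmax_leqP => c _; rewrite eM.
  by have := h c; case: (sat_clause _ _); case: (p.2 c).
rewrite negb_imply negbK => /andP[h1 h2].
have : 2 <= M.
  apply: leq_trans (@bigop.leq_bigmax _ (fun c => satisfied inc (join_coins p) c + _) c).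
  by rewrite eM h1 h2.
suff : M <= 2 by lia.
by apply/bigmax_leqP => d _; rewrite eM; case: (sat_clause _ _); case: (p.2 d).
Qed.

(** The condition is a product over clauses: the coin of a satisfied clause is forced down, that of
    a violated clause is free and contributes a factor 2. *)
Lemma count_silent s :
  \sum_(t : {ffun 'I_m -> bool}) [forall c, sat_clause s c ==> ~~ t c] = 2 ^ unsat_count s.
Proof.
transitivity (\sum_(t : {ffun 'I_m -> bool}) \prod_c (sat_clause s c ==> ~~ t c : nat)).
  apply: eq_bigr => t _; case: forallP => [h|/forallP/forallPn[c hc]].
    by rewrite big1 // => c _; rewrite h.
  by rewrite (bigD1 c) //= (negbTE hc) mul0n.
rewrite -(bigA_distr_bigA (fun c b => sat_clause s c ==> ~~ b : nat)).
rewrite /unsat_count -prod_nat_const [RHS]big_mkcond; apply: eq_bigr => c _.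
by rewrite big_bool inE; case: (sat_clause s c).
Qed.

Lemma sum_stamp : \sum_(w : coins n m) stamp inc w Sink + violation_weight = 2 ^ (n + m).+1.
Proof.
rewrite (reindex join_coins (onW_bij _ join_coins_bij)) /=.
rewrite /violation_weight (eq_bigr _ (fun s _ => esym (count_silent s))).
rewrite (pair_big predT predT) /= -big_split /= (eq_bigr (fun=> 2)); last first.
  by move=> p _; exact: stamp_sink.
rewrite sum_nat_const card_prod !card_ffun !card_ord card_bool -expnD.
by rewrite expnS mulnC.
Qed.

Lemma sum_stamp_gt0 : 0 < \sum_(w : coins n m) stamp inc w Sink.
Proof.
rewrite (reindex join_coins (onW_bij _ join_coins_bij)).
pose p : {ffun 'I_n -> bool} * {ffun 'I_m -> bool} := ([ffun=> true], [ffun=> true]).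
rewrite (bigD1 p) // ltn_addr //; have := stamp_sink p.
by set b := (X in _ + nat_of_bool X); case: b; lia.
Qed.

End Weights.

(* Repeating every clause [K] times turns [violation_weight] into a number in
   base [2 ^ K] whose last digit counts the satisfying assignments. *)
Lemma violation_weight_repeat n m K (f : nat -> bool -> nat -> bool) :
  violation_weight (fun (v : 'I_n) b (c : 'I_(K * m)) => f v b (c %% m)) =
  #|[set s : {ffun 'I_n -> bool} |
       [forall c : 'I_m, sat_clause (fun v b (c : 'I_m) => f v b c) s c]]|
  %[mod 2 ^ K].
Proof.
have repeat (F : nat -> nat) : \sum_(c < K * m) F (c %% m) = K * \sum_(c < m) F c.
  elim: K => [|k IH]; first by rewrite big_ord0.
  rewrite -(big_mkord xpredT (fun c => F (c %% m))) mulSn.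
  rewrite (@big_cat_nat _ _ _ m) ?leq_addr //= mulSn; congr (_ + _).
    rewrite big_mkord; apply: eq_bigr => c _; by rewrite modn_small.
  rewrite -{1}[m]add0n big_addn addKn big_mkord -IH.
  by apply: eq_bigr => c _; rewrite modnDr.
set g := (fun v b (c : 'I_m) => f v b c).
have e s : unsat_count (fun (v : 'I_n) b (c : 'I_(K * m)) => f v b (c %% m)) s
    = K * unsat_count (g : 'I_n -> bool -> 'I_m -> bool) s.
  rewrite /unsat_count -!sum1_card big_mkcond [in RHS]big_mkcond /=.
  rewrite -(repeat (fun c => if ~~ [exists v : 'I_n, f v (s v) c] then 1 else 0)).
  by apply: eq_bigr => c _; rewrite inE.
rewrite /violation_weight -sum1_card [in RHS]big_mkcond /=.
apply: (big_ind2 (fun x y => x = y %[mod 2 ^ K])) => // [x1 x2 y1 y2 h1 h2|s _].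
  by rewrite -modnDm h1 h2 modnDm.
rewrite e inE.
case: forallP => [all|/forallP/forallPn[c hc]].
  by rewrite (_ : unsat_count _ _ = 0) ?muln0 //; apply: eq_card0 => c; rewrite inE all.
have u0 : 0 < unsat_count (g : 'I_n -> bool -> 'I_m -> bool) s.
  by apply/card_gt0P; exists c; rewrite inE.
by rewrite -(prednK u0) mulnS expnD modnMr mod0n.
Qed.

(** The order of the summands fixes the numbering of the nodes in the encoding; in particular the
    source gets number 0 and the sink number 1. *)
Definition place_sum (n m : nat) : finType :=
  (unit + (unit + ('I_n + ('I_n * bool * 'I_m + ('I_n * 'I_m + 'I_m)))))%type.

Definition transition_sum (n m : nat) : finType :=
  (unit + ('I_n * bool + ('I_n * bool * 'I_m + ('I_m * bool + unit))))%type.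

Definition place_to_sum n m (p : place n m) : place_sum n m :=
  match p with
  | Source => inl tt
  | Sink => inr (inl tt)
  | Var v => inr (inr (inl v))
  | Lit v b c => inr (inr (inr (inl (v, b, c))))
  | Arg v c => inr (inr (inr (inr (inl (v, c)))))
  | Done c => inr (inr (inr (inr (inr c))))
  end.

Definition sum_to_place n m (p : place_sum n m) : place n m :=
  match p with
  | inl _ => Source
  | inr (inl _) => Sink
  | inr (inr (inl v)) => Var v
  | inr (inr (inr (inl (v, b, c)))) => Lit v b c
  | inr (inr (inr (inr (inl (v, c))))) => Arg v c
  | inr (inr (inr (inr (inr c)))) => Done c
  end.

Definition transition_to_sum n m (t : transition n m) : transition_sum n m :=
  match t with
  | Start => inl tt
  | Choose v b => inr (inl (v, b))
  | Delay v b c => inr (inr (inl (v, b, c)))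
  | Check c b => inr (inr (inr (inl (c, b))))
  | Finish => inr (inr (inr (inr tt)))
  end.

Definition sum_to_transition n m (t : transition_sum n m) : transition n m :=
  match t with
  | inl _ => Start
  | inr (inl (v, b)) => Choose v b
  | inr (inr (inl (v, b, c))) => Delay v b c
  | inr (inr (inr (inl (c, b)))) => Check c b
  | inr (inr (inr (inr _))) => Finish
  end.

Lemma place_to_sumK n m : cancel (@place_to_sum n m) (@sum_to_place n m).
Proof. by case. Qed.

Lemma sum_to_placeK n m : cancel (@sum_to_place n m) (@place_to_sum n m).
Proof. by case=> [[]|[[]|[v|[[[v b] c]|[[v c]|c]]]]]. Qed.

Lemma transition_to_sumK n m : cancel (@transition_to_sum n m) (@sum_to_transition n m).
Proof. by case. Qed.

Lemma sum_to_transitionK n m : cancel (@sum_to_transition n m) (@transition_to_sum n m).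
Proof. by case=> [[]|[[v b]|[[[v b] c]|[[c b]|[]]]]]. Qed.

Section ClauseInstance.
Variables (n m : nat) (inc : 'I_n -> bool -> 'I_m -> bool).

Definition ord_place (i : 'I_#|place_sum n m|) : place n m := sum_to_place (enum_val i).
Definition place_ord (p : place n m) : 'I_#|place_sum n m| := enum_rank (place_to_sum p).
Definition ord_transition (i : 'I_#|transition_sum n m|) : transition n m :=
  sum_to_transition (enum_val i).
Definition transition_ord (t : transition n m) : 'I_#|transition_sum n m| :=
  enum_rank (transition_to_sum t).

Lemma ord_placeK : cancel ord_place place_ord.
Proof. by move=> i; rewrite /place_ord sum_to_placeK enum_valK. Qed.
Lemma place_ordK : cancel place_ord ord_place.
Proof. by move=> p; rewrite /ord_place enum_rankK place_to_sumK. Qed.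
Lemma ord_transitionK : cancel ord_transition transition_ord.
Proof. by move=> i; rewrite /transition_ord sum_to_transitionK enum_valK. Qed.
Lemma transition_ordK : cancel transition_ord ord_transition.
Proof. by move=> p; rewrite /ord_transition enum_rankK transition_to_sumK. Qed.

(** The possible expected times are multiples of [1 / 2 ^ (n + m)], one over the number of coin
    assignments; the tolerance is half that distance. *)
Definition clause_instance : instance :=
  Instance (clause_tpwn inc ord_place place_ord ord_transition)
           ((2 ^ (n + m).+1)%:R^-1)%R.

Hypotheses (n_gt0 : 0 < n) (m_gt0 : 0 < m).

Lemma clause_instance_admissible : admissible clause_instance.
Proof.
have dPK := ord_placeK; have ePK := place_ordK.
have dTK := ord_transitionK; have eTK := transition_ordK.
split.
- split=> //.
  + exact: (clause_workflow dPK ePK dTK eTK n_gt0 m_gt0).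
  + exact: (clause_one_safe dPK ePK n_gt0 m_gt0).
  + exact: clause_confusion_free.
- split.
  + exact: (clause_sound dPK ePK eTK n_gt0 m_gt0).
  + exact: clause_acyclic.
  + exact: clause_free_choice.
- move=> t; split=> //=; last exact: (clause_choices ord_place place_ord dTK).
  by case: (ord_transition t) => //= [v b c|c []] //; case: (inc v b c).
- by rewrite /= invr_gt0 ltr0n expn_gt0.
Qed.

Lemma extract_answer (R : realType) (c0 : 'I_m) (K : nat) (y : word) :
  (forall s, sat_clause inc s c0) -> K <= (n + m).+1 ->
  ET_approximation R (encode clause_instance) y ->
  value_of_bits (extract K (n + m) y) = violation_weight inc %% 2 ^ K.
Proof.
move=> taut KL /(_ _ clause_instance_admissible erefl)[r [s [nw [dw [-> d0 er]]]] ap].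
have := ap _ _ (@clause_schedulerP _ _ inc _ _ ord_place place_ord ord_transition)
  (average_induced inc ord_placeK place_ordK ord_transitionK transition_ordK n_gt0 m_gt0 R).
rewrite (average_expected_time inc ord_placeK place_ordK transition_ordK n_gt0 m_gt0 R).
set Z := \sum_w _; have e := sum_stamp taut; rewrite -/Z in e.
have Z0 := sum_stamp_gt0 taut; rewrite -/Z in Z0.
rewrite card_ffun card_sum !card_ord card_bool.
set L := n + m in KL e *.
have eZ : ((Z%:R / (2 ^ L)%:R)%R = ratr (Z%:R / (2 ^ L)%:R) :> R)%R.
  by rewrite fmorph_div /= !ratr_nat.
rewrite [(Z%:R / _)%R]eZ !lte_fin !ltr_rat /= => /andP[h1 h2].
rewrite -/L in h1 h2; set q := (2 ^ L.+1)%:R%R : rat in h1 h2.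
have q0 : (0 < q :> rat)%R by rewrite ltr0n expn_gt0.
have D0 : (0 < (value_of_bits dw)%:R :> rat)%R by rewrite ltr0n.
have eq2 : (Z%:R / (2 ^ L)%:R = (2 * Z)%:R / q :> rat)%R.
  rewrite /q expnS !natrM invfM mulrACA divff ?mul1r //.
have {}h1 : (r < (2 * Z + 1)%:R / q)%R.
  by rewrite natrD mulrDl div1r -ltrBlDr -eq2.
have {}h2 : ((2 * Z - 1)%:R / q < r)%R.
  by rewrite natrB ?mulrBl ?div1r ?ltrBlDr -?eq2 //; lia.
(* [extract] does not look at the sign word, so a negative sign has to be ruled out. *)
have r0 : (0 < r)%R.
  by apply: lt_trans h2; rewrite divr_gt0 // ltr0n; lia.
have {}er : r = ((value_of_bits nw)%:R / (value_of_bits dw)%:R)%R.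
  case: s er => er; last by rewrite er expr0 mul1r.
  by move: r0; rewrite er expr1 mulN1r mulNr oppr_gt0 ltNge divr_ge0 // ltW.
rewrite er ltr_pdivlMr // mulrAC ltr_pdivrMr // -!natrM ltr_nat in h1.
rewrite er ltr_pdivrMr // mulrAC ltr_pdivlMr // -!natrM ltr_nat in h2.
by apply: extractE e => //; lia.
Qed.

End ClauseInstance.

(** * The tableau of a verifier *)

Section Tableau.
Variable M : machine.
Hypothesis no_oracle : oracle_free M.
Variables (x : word) (l T W : nat).

Definition symbols := {ffun 'I_(extra_tapes M).+2 -> symbol}.

(* All tapes are drawn relative to their heads, so that the scanned cells are
   stacked in the column [W], and the control state is copied to every column.
   The flag marks the column [W]. *)
Definition cell : finType := (ctrl M * symbols * bool)%type.

(** Since tapes are drawn relative to their heads, a head moving left shifts its tape one column to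
    the right, so the new symbol comes from [left]. The new symbol has been written only in the
    flagged column. *)
Definition update (left mid right center : cell) : cell :=
  let q := center.1.1 in
  if final q then mid else
  let: (q', a) := delta q center.1.2 in
  let written (u : cell) i := if u.2 then (a i).1 else u.1.2 i in
  (q', [ffun i => match (a i).2 with
                  | GoLeft => written left i
                  | Stay => written mid i
                  | GoRight => written right i
                  end], mid.2).

Arguments update : simpl never.

Definition tape_cell (c : tape) (j : nat) : symbol :=
  if j < W then nth None c.1 (W - j.+1) else nth None c.2 (j - W).

Definition config_cell (c : config M) (j : nat) : cell :=
  (c.1, [ffun i => tape_cell (c.2 i) j], j == W).

Lemma tape_cell_act (c : tape) a j : 0 < j -> tape_cell (act c a) j =
  let written j := if j == W then a.1 else tape_cell c j in
  match a.2 with GoLeft => written j.-1 | Stay => written j | GoRight => written j.+1 end.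
Proof.
case: c a => u v [s []] j0; rewrite /act /tape_cell /=.
- case: (ltngtP j W) => jW.
  + rewrite ifF; last by apply/negbTE; lia.
    rewrite ifT; last by lia.
    by rewrite nth_behead; congr nth; lia.
  + case: eqP => e; first by rewrite (_ : j - W = 1) //; lia.
    rewrite ifF; last by apply/negbTE; lia.
    have -> : j - W = (j - W - 2).+2 by lia.
    by rewrite /= nth_behead; congr nth; lia.
  + rewrite jW subnn /= ifF; last by apply/negbTE; lia.
    rewrite ifT; last by lia.
    by have -> : W - W.-1.+1 = 0 by lia.
- case: (ltngtP j W) => jW //.
    by rewrite (_ : j - W = (j - W).-1.+1) /= ?nth_behead //; lia.
  by rewrite jW subnn.
- case: (ltngtP j.+1 W) => jW.
  + by have -> : W - j.+1 = (W - j.+2).+1 by lia.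
  + by rewrite nth_behead; congr nth; lia.
  + by rewrite jW subnn.
Qed.

Lemma config_cell_step O (c : config M) j : 0 < j ->
  config_cell (@step M O c) j =
  update (config_cell c j.-1) (config_cell c j) (config_cell c j.+1) (config_cell c W).
Proof.
case: c => q tp j0; rewrite /update /step /=.
case: (final q) => //; rewrite no_oracle.
have -> : [ffun i => tape_cell (tp i) W] = [ffun i => scanned (tp i)].
  by apply/ffunP => i; rewrite !ffunE /tape_cell ltnn subnn nth0.
case: (delta _ _) => q' a; rewrite /config_cell /=; congr (_, _, _).
by apply/ffunP => i; rewrite !ffunE tape_cell_act //=.
Qed.

Definition columns := W.*2.+1.

Definition input (y : word) : word := encode_words [:: x; y].

(** At either end the missing neighbour is replaced by the column itself, so one local rule applies
    to all columns. *)
Fixpoint grid (y : word) (t j : nat) : cell :=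
  if t is t'.+1 then
    update (grid y t' j.-1) (grid y t' j) (grid y t' (minn j.+1 W.*2)) (grid y t' W)
  else config_cell (init_config M (input y)) j.

(* Information travels one column per step, so the boundary conditions do not
   reach the column [W] within [W] steps. *)
Lemma grid_config O y t j : t <= j -> j + t <= W.*2 ->
  grid y t j = config_cell (iter t (@step M O) (init_config M (input y))) j.
Proof.
elim: t j => // t IH j h1 h2; rewrite iterS config_cell_step; last by lia.
rewrite /= (_ : minn j.+1 W.*2 = j.+1); last by apply/minn_idPl; lia.
by rewrite !IH //; lia.
Qed.

Definition accepting (a : cell) : bool := a.1.2 ord0 == Some true.

(** The output is known to be a one-bit word, so its first symbol decides; column [W] holds the
    scanned cell. *)
Lemma grid_accepts V y : T <= W -> outputs_within M id T (input y) [:: V (input y)] ->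
  accepting (grid y T W) = V (input y).
Proof.
move=> TW [_]; rewrite (grid_config id) //; last by lia.
move: (iter T _ _) => -[q tp] /=; rewrite /accepting /= ffunE /tape_cell ltnn subnn nth0.
by rewrite /word_of_tape; case: (tp ord0).2 => [|[b|] s] //= [-> _]; case: (V _).
Qed.

Definition blank_cell : cell := (start M, [ffun=> None], false).

(* The symbols that the input word may have in position [i] when only the
   length of its second component is known. *)
Definition input_symbol (i : nat) (s : symbol) : bool :=
  let d := size (delimit x) in
  if i < d then s == Some (nth false (delimit x) i)
  else if i - d < l.*2 then (if odd (i - d) then s != None else s == Some true)
  else if i - d == l.*2 then s == Some false else s == None.

Definition initial (j : nat) (a : cell) : bool :=
  [&& a.1.1 == start M, a.2 == (j == W),
      [forall i, (i != ord0) ==> (a.1.2 i == None)]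
    & if j < W then a.1.2 ord0 == None else input_symbol (j - W) (a.1.2 ord0)].

Lemma size_delimit (w : word) : size (delimit w) = (size w).*2.+1.
Proof. by rewrite size_cat addn1; congr S; elim: w => //= b w ->. Qed.

Lemma nth_delimit (w : word) i : i < (size w).*2 ->
  nth false (delimit w) i = if odd i then nth false w i./2 else true.
Proof.
elim: w i => //= b w IH [|[|i]] //= hi.
rewrite negbK /= -IH //; lia.
Qed.

Lemma size_input y : size (input y) = (size x).*2.+1 + (size y).*2.+1.
Proof. by rewrite /input /encode_words /= cats0 size_cat !size_delimit. Qed.

Lemma nth_input y i : let d := size (delimit x) in
  nth None (map Some (input y)) i =
  if i < d then Some (nth false (delimit x) i)
  else if i - d < (size y).*2
    then Some (if odd (i - d) then nth false y (i - d)./2 else true)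
  else if i - d == (size y).*2 then Some false else None.
Proof.
rewrite /input /encode_words /= cats0; set d := size (delimit x).
case: (ltnP i d) => hi.
  by rewrite (nth_map false) ?nth_cat ?hi // size_cat ltn_addr.
rewrite map_cat nth_cat size_map ltnNge hi /= -/d.
case: (ltngtP (i - d) (size y).*2) => h.
- by rewrite (nth_map false) ?nth_delimit // size_delimit ltnS ltnW.
- by rewrite nth_default // size_map size_delimit.
- rewrite (nth_map false) ?size_delimit ?h // /delimit nth_cat.
  by rewrite (_ : size (flatten _) = (size y).*2) ?ltnn ?subnn //; elim: (y) => //= b w ->.
Qed.

Lemma grid0 y j : grid y 0 j = (start M,
  [ffun i => if (i == ord0) && (W <= j) then nth None (map Some (input y)) (j - W) else None],
  j == W).
Proof.
rewrite /= /config_cell /=; congr (_, _, _); apply/ffunP => i; rewrite !ffunE.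
case: eqP => _ /=; rewrite /tape_cell ltnNge; case: (leqP W j) => h //=; by rewrite nth_nil.
Qed.

Lemma grid0_initial (y : word) j : size y = l -> initial j (grid y 0 j).
Proof.
move=> sy; rewrite grid0 /initial /= !eqxx /=; apply/andP; split.
  by apply/forallP => i; rewrite ffunE; case: eqP.
rewrite ffunE eqxx /= ltnNge; case: (leqP W j) => //= h; rewrite nth_input sy /input_symbol.
by do !case: ifP.
Qed.

(** [initial] leaves a choice only at the odd offsets behind the code of [x], where the data bits of
    the witness stand; the last hypothesis prescribes these. *)
Lemma initial_grid0 (y : word) j a : size y = l -> initial j a ->
  (forall k, k < l -> j = W + size (delimit x) + k.*2.+1 -> a.1.2 ord0 = Some (nth false y k)) ->
  a = grid y 0 j.
Proof.
rewrite grid0; case: a => [[q s] fl] sy /and4P[/= /eqP-> /eqP-> /forallP hs h0] hy.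
congr (_, _, _); apply/ffunP => i; rewrite ffunE; case: (eqVneq i ord0) => [->|ni] /=; last first.
  by have := hs i; rewrite ni => /eqP.
move: h0; rewrite ltnNge; case: (leqP W j) => [jW|_ /eqP //] /=.
rewrite nth_input sy /input_symbol; case: (ltnP (j - W) _) => h1; first by move/eqP.
case: ifP => h2; last by case: ifP => _ /eqP.
case: ifP => od; last by move/eqP.
move=> _; apply: hy; first by lia.
have := odd_double_half (j - W - size (delimit x)); rewrite od; lia.
Qed.

Definition pattern : finType := (cell * cell + cell * cell * cell * cell + (unit + cell))%type.

(* Whether the clause of kind [be] placed at [(t, j)] contains the literal
   stating that the cell at [(t', j')] is ([b]) or is not ([~~ b]) [a]; clauses
   without meaning at their place are made to contain every literal. The four
   kinds say: no two cells at one place, the successor rule, some admissible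
   cell in the first row, acceptance in the last row. *)
Definition literal (t' j' : nat) (a : cell) (b : bool) (t j : nat) (be : pattern) : bool :=
  match be with
  | inl (inl (a1, a2)) =>
      (a1 == a2) || [&& ~~ b, t' == t, j' == j & (a == a1) || (a == a2)]
  | inl (inr (a1, a2, a3, a4)) =>
      [|| T <= t,
          [&& ~~ b, t' == t
            & [|| (j' == j.-1) && (a == a1), (j' == j) && (a == a2),
                  (j' == minn j.+1 W.*2) && (a == a3) | (j' == W) && (a == a4)]]
        | [&& b, t' == t.+1, j' == j & a == update a1 a2 a3 a4]]
  | inr (inl _) => (t != 0) || [&& b, t' == 0, j' == j & initial j a]
  | inr (inr a1) =>
      [|| t != T, j != W, accepting a1 | [&& ~~ b, t' == T, j' == W & a == a1]]
  end.

(** Variables and clauses are numbered in mixed radix: time, column, and an item among [q], which is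
    a cell or a pattern. *)
Definition time_of_index (q i : nat) : nat := i %/ q %/ columns.
Definition column_of_index (q i : nat) : nat := (i %/ q) %% columns.
Definition index_of (q t j a : nat) : nat := (t * columns + j) * q + a.

Lemma index_ofK q t j a : j < columns -> a < q ->
  [/\ time_of_index q (index_of q t j a) = t, column_of_index q (index_of q t j a) = j
    & index_of q t j a %% q = a].
Proof.
move=> hj ha; have q0 : 0 < q by lia.
rewrite /time_of_index /column_of_index /index_of divnMDl // (divn_small ha) addn0.
by rewrite !modnMDl divnMDl // (divn_small hj) addn0 !modn_small.
Qed.

Lemma index_ofP q i : index_of q (time_of_index q i) (column_of_index q i) (i %% q) = i.
Proof. by rewrite /index_of /time_of_index /column_of_index -!divn_eq. Qed.

Lemma index_of_lt q t j a : t <= T -> j < columns -> a < q ->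
  index_of q t j a < T.+1 * columns * q.
Proof.
move=> ht hj ha; rewrite /index_of.
apply: (@leq_trans ((t * columns + j).+1 * q)); first by rewrite mulSn; lia.
rewrite leq_mul2r; apply/orP; right.
apply: (@leq_trans (t.+1 * columns)); first by rewrite mulSn; lia.
by rewrite leq_mul2r ltnS ht orbT.
Qed.

Lemma time_of_index_le q i : i < T.+1 * columns * q -> time_of_index q i <= T.
Proof.
move=> h; have q0 : 0 < q by case: q h => //; rewrite muln0.
by rewrite -ltnS /time_of_index ltn_divLR // ltn_divLR.
Qed.

Lemma column_of_index_lt q i : column_of_index q i < columns.
Proof. by rewrite ltn_mod. Qed.

Definition cell_at (i : nat) : cell := nth blank_cell (enum cell) i.
Definition pattern_at (i : nat) : pattern := nth (inr (inl tt)) (enum pattern) i.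

Lemma cell_atK a : cell_at (index a (enum cell)) = a.
Proof. by rewrite /cell_at nth_index // mem_enum. Qed.

Lemma pattern_atK be : pattern_at (index be (enum pattern)) = be.
Proof. by rewrite /pattern_at nth_index // mem_enum. Qed.

Lemma index_cell_at i : i < #|cell| -> index (cell_at i) (enum cell) = i.
Proof. by move=> h; rewrite index_uniq ?enum_uniq // -cardE. Qed.

Lemma index_cell_lt (a : cell) : index a (enum cell) < #|cell|.
Proof. by rewrite cardE index_mem mem_enum. Qed.

Lemma index_pattern_lt (be : pattern) : index be (enum pattern) < #|pattern|.
Proof. by rewrite cardE index_mem mem_enum. Qed.

Definition num_vars : nat := T.+1 * columns * #|cell|.
Definition num_clauses : nat := T.+1 * columns * #|pattern|.

Definition incidence (v : nat) (b : bool) (c : nat) : bool :=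
  literal (time_of_index #|cell| v) (column_of_index #|cell| v) (cell_at (v %% #|cell|)) b
          (time_of_index #|pattern| c) (column_of_index #|pattern| c)
          (pattern_at (c %% #|pattern|)).

Let inc (v : 'I_num_vars) (b : bool) (c : 'I_num_clauses) : bool := incidence v b c.

Definition var_of (t j : nat) (a : cell) : nat := index_of #|cell| t j (index a (enum cell)).

Definition value_at (s : {ffun 'I_num_vars -> bool}) (t j : nat) (a : cell) : bool :=
  if insub (var_of t j a) is Some v then s v else false.

Lemma value_atE (s : {ffun 'I_num_vars -> bool}) (v : 'I_num_vars) :
  s v = value_at s (time_of_index #|cell| v) (column_of_index #|cell| v) (cell_at (v %% #|cell|)).
Proof.
have q0 : 0 < #|cell| by apply/card_gt0P; exists blank_cell.
rewrite /value_at /var_of index_cell_at ?ltn_mod // index_ofP.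
by case: insubP => [u _ /val_inj ->|]; rewrite ?ltn_ord.
Qed.

Lemma sat_clauseP (s : {ffun 'I_num_vars -> bool}) t j be : t <= T -> j < columns ->
  (forall c, sat_clause inc s c) ->
  exists t' j' a, [/\ t' <= T, j' < columns & literal t' j' a (value_at s t' j' a) t j be].
Proof.
move=> ht hj h; have lt := index_of_lt ht hj (index_pattern_lt be).
have [e1 e2 e3] := index_ofK t hj (index_pattern_lt be).
have /existsP[v] := h (Ordinal lt); rewrite /inc /incidence /= e1 e2 e3 pattern_atK value_atE.
move=> hv; exists (time_of_index #|cell| v), (column_of_index #|cell| v), (cell_at (v %% #|cell|)).
by split=> //; [apply: time_of_index_le | apply: column_of_index_lt].
Qed.

Lemma clauseP (s : {ffun 'I_num_vars -> bool}) (c : 'I_num_clauses) :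
  (exists t' j' a, [/\ t' <= T, j' < columns &
     literal t' j' a (value_at s t' j' a) (time_of_index #|pattern| c)
       (column_of_index #|pattern| c) (pattern_at (c %% #|pattern|))]) -> sat_clause inc s c.
Proof.
move=> [t [j [a [ht hj h]]]]; apply/existsP.
have lt := index_of_lt ht hj (index_cell_lt a).
exists (Ordinal lt); have [e1 e2 e3] := index_ofK t hj (index_cell_lt a).
by rewrite value_atE /inc /incidence /= e1 e2 e3 cell_atK.
Qed.

Definition tableau (y : word) : {ffun 'I_num_vars -> bool} :=
  [ffun v : 'I_num_vars => grid y (time_of_index #|cell| v) (column_of_index #|cell| v)
             == cell_at (v %% #|cell|)].

Lemma value_at_tableau y t j a : t <= T -> j < columns ->
  value_at (tableau y) t j a = (grid y t j == a).
Proof.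
move=> ht hj; rewrite /value_at.
have lt := index_of_lt ht hj (index_cell_lt a).
have [e1 e2 e3] := index_ofK t hj (index_cell_lt a).
case: insubP => [u _ eu|]; last by rewrite lt.
by rewrite ffunE eu e1 e2 e3 cell_atK.
Qed.

Lemma tableau_ext s y : (forall t j a, t <= T -> j < columns ->
    value_at s t j a = (grid y t j == a)) -> s = tableau y.
Proof.
move=> h; apply/ffunP => v; rewrite value_atE ffunE h ?column_of_index_lt //.
exact: time_of_index_le.
Qed.

(** Errors from the edges must not reach column [W] within [T] steps, and the whole input must fit
    to the right of it. *)
Hypothesis W_large : T + size (delimit x) + l.*2.+1 <= W.

Let W_lt : W < columns. Proof. by rewrite /columns; lia. Qed.

Lemma eq_or_neq (E : eqType) (a b : E) : a = b \/ a != b.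
Proof. by case: (eqVneq a b); [left | right]. Qed.

(** Each clause gets an explicit true literal. For the successor rule, if one of the four premise
    cells differs from the pattern, its negative literal is true; if all agree, the positive literal
    is true by the definition of [grid]. *)
Lemma tableau_sat (y : word) c : size y = l -> accepting (grid y T W) ->
  sat_clause inc (tableau y) c.
Proof.
move=> sy acc; apply: clauseP.
have hc := column_of_index_lt #|pattern| c; have ht := time_of_index_le (ltn_ord c).
move: (time_of_index _ _) (column_of_index _ _) ht hc => t j ht hj.
have lit t' j' a : t' <= T -> j' < columns ->
    literal t' j' a (grid y t' j' == a) t j (pattern_at (c %% #|pattern|)) ->
    exists t' j' a, [/\ t' <= T, j' < columns &
      literal t' j' a (value_at (tableau y) t' j' a) t j (pattern_at (c %% #|pattern|))].
  by move=> h1 h2 h3; exists t', j', a; rewrite value_at_tableau.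
move: lit; move: (pattern_at _) => [[[a1 a2]|[[[a1 a2] a3] a4]]|[[]|a1]] /= lit.
- case: (eq_or_neq a1 a2) => [e|ne].
    by apply: (lit t j a1) => //; rewrite e eqxx.
  case: (eq_or_neq (grid y t j) a1) => [e|n1].
    by apply: (lit t j a2) => //; rewrite e (negPf ne) !eqxx ?orbT.
  by apply: (lit t j a1) => //; rewrite (negPf n1) !eqxx ?orbT.
- have [hT|hT] : T <= t \/ t < T by case: (leqP T t); [left | right].
    by apply: (lit t j a1) => //; rewrite hT.
  have hj1 : j.-1 < columns by lia.
  have hj2 : minn j.+1 W.*2 < columns by rewrite /columns; lia.
  case: (eq_or_neq (grid y t j.-1) a1) => [e1|n]; last first.
    by apply: (lit t j.-1 a1) => //; rewrite (negPf n) !eqxx ?orbT.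
  case: (eq_or_neq (grid y t j) a2) => [e2|n]; last first.
    by apply: (lit t j a2) => //; rewrite (negPf n) !eqxx ?orbT.
  case: (eq_or_neq (grid y t (minn j.+1 W.*2)) a3) => [e3|n]; last first.
    by apply: (lit t (minn j.+1 W.*2) a3) => //; rewrite (negPf n) !eqxx ?orbT.
  case: (eq_or_neq (grid y t W) a4) => [e4|n]; last first.
    by apply: (lit t W a4) => //; rewrite (negPf n) !eqxx ?orbT.
  apply: (lit t.+1 j (update a1 a2 a3 a4)) => //.
  by rewrite (_ : grid y t.+1 j = update a1 a2 a3 a4) ?eqxx ?orbT // -e1 -e2 -e3 -e4.
- case: (eq_or_neq t 0) => [t0|n]; last by apply: (lit t j blank_cell) => //; rewrite n.
  by apply: (lit 0 j (grid y 0 j)) => //; rewrite !eqxx (grid0_initial _ sy) ?orbT.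
- have [h|] : [|| t != T, j != W | accepting a1] \/ ~~ [|| t != T, j != W | accepting a1].
    by apply/orP/orbN.
    apply: (lit t j blank_cell) => //; move: h; case/or3P => -> //; by rewrite ?orbT.
  rewrite !negb_or => /and3P[_ _ na]; apply: (lit T W a1) => //.
  case: (eq_or_neq (grid y T W) a1) => [e|n]; last by rewrite (negPf n) !eqxx ?orbT.
  by case/negP: na; rewrite -e; exact: acc.
Qed.

Section Satisfying.
Variable s : {ffun 'I_num_vars -> bool}.
Hypothesis sat : forall c, sat_clause inc s c.

Lemma at_most_one t j a1 a2 : t <= T -> j < columns ->
  value_at s t j a1 -> value_at s t j a2 -> a1 = a2.
Proof.
move=> ht hj h1 h2.
have [t' [j' [a [_ _ /=]]]] := @sat_clauseP s t j (inl (inl (a1, a2))) ht hj sat.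
case: eqP => //= _ /and4P[nv /eqP et /eqP ej /orP[/eqP ea|/eqP ea]].
  by move: nv; rewrite et ej ea h1.
by move: nv; rewrite et ej ea h2.
Qed.

Lemma initial_cell j : j < columns -> exists2 a, value_at s 0 j a & initial j a.
Proof.
move=> hj.
have [t' [j' [a [_ _ /=]]]] := @sat_clauseP s 0 j (inr (inl tt)) (leq0n T) hj sat.
by case/and4P => v /eqP et /eqP ej i; exists a => //; rewrite -et -ej.
Qed.

(** [delimit] puts a flag before every bit, so bit [k] stands at offset [k.*2.+1] behind the code of
    [x]. *)
Definition witness : l.-tuple bool :=
  [tuple [exists a, value_at s 0 (W + size (delimit x) + k.*2.+1) a &&
                    (a.1.2 ord0 == Some true)] | k < l].

(** By induction on the rows: the first-row clauses or the successor rule make some cell true at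
    every position, and [at_most_one] makes it the only one. Thus the witness bits determine the
    whole assignment. *)
Lemma sat_tableau : s = tableau witness.
Proof.
apply: tableau_ext => t j a; elim: t j a => [|t IH] j a ht hj.
  have [a0 h0 i0] := initial_cell hj.
  have -> : grid witness 0 j = a0.
    apply/esym/initial_grid0; rewrite ?size_tuple // => k kl ej.
    rewrite (_ : nth _ _ _ = tnth witness (Ordinal kl)) ?(tnth_nth false) //.
    rewrite -(tnth_nth false _ (Ordinal kl)) tnth_mktuple /= -ej.
    move: i0; rewrite /initial => /and4P[_ _ _].
    rewrite ifF; last by apply/negbTE; lia.
    rewrite /input_symbol ifF; last by apply/negbTE; lia.
    rewrite ifT; last by lia.
    rewrite ifT; last by rewrite ej (_ : _ - _ - _ = k.*2.+1) ?oddS ?odd_double //; lia.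
    case e: (a0.1.2 ord0) => [[]|] // _; congr Some; apply/esym.
      by apply/existsP; exists a0; rewrite h0 e eqxx.
    apply/negbTE/existsPn => a1; apply/negP => /andP[h1 /eqP e1].
    by move: e1; rewrite -(at_most_one _ hj h0 h1) ?e.
  apply/idP/eqP => [h|<-//]; exact: at_most_one h0 h.
have tT : t < T by [].
have hj1 : j.-1 < columns by lia.
have hj2 : minn j.+1 W.*2 < columns by rewrite /columns; lia.
set y := witness in IH *.
have h : value_at s t.+1 j (grid y t.+1 j).
  have [t' [j' [a' [_ _ /=]]]] := @sat_clauseP s t j (inl (inr (grid y t j.-1, grid y t j,
    grid y t (minn j.+1 W.*2), grid y t W))) (ltnW tT) hj sat.
  rewrite leqNgt tT /= => /orP[/and3P[nv /eqP et]|/and4P[v /eqP et /eqP ej /eqP ea]]; last first.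
    by move: v; rewrite et ej ea.
  rewrite et in nv; have tT' := ltnW tT.
  case/or4P => /andP[/eqP ej /eqP ea]; move: nv; rewrite ej ea IH ?eqxx //.
apply/idP/eqP => [h'|<-//]; exact: at_most_one h h'.
Qed.

Lemma sat_accepting : accepting (grid witness T W).
Proof.
apply/negPn/negP => na.
have [t' [j' [a' [_ _ /=]]]] :=
  @sat_clauseP s T W (inr (inr (grid witness T W))) (leqnn T) W_lt sat.
rewrite !eqxx (negPf na) /= => /and4P[nv /eqP et /eqP ej /eqP ea].
by move: nv; rewrite et ej ea {1}sat_tableau value_at_tableau // eqxx.
Qed.

End Satisfying.

Lemma tableau_inj (y y' : l.-tuple bool) : tableau y = tableau y' -> y = y'.
Proof.
move=> e; apply: eq_from_tnth => k; rewrite !(tnth_nth false).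
set j := W + size (delimit x) + k.*2.+1.
have hj : j < columns by have := ltn_ord k; rewrite /j /columns; lia.
have : grid y 0 j = grid y' 0 j.
  apply/eqP; rewrite -(value_at_tableau _ _ (leq0n T) hj) e value_at_tableau //.
move/(congr1 (fun a : cell => a.1.2 ord0)); rewrite !grid0 /= !ffunE eqxx /=.
rewrite (_ : W <= j); last by rewrite /j; lia.
rewrite !nth_input !size_tuple.
have -> : j - W = size (delimit x) + k.*2.+1 by rewrite /j; lia.
have hk : k.*2.+1 < l.*2 by have := ltn_ord k; lia.
rewrite ltnNge leq_addr /= addKn hk /= odd_double uphalf_double; by case.
Qed.

(** [tableau] is a bijection from accepted witnesses to satisfying assignments. The hypothesis is a
    disjunction because [T] bounds the running time only on inputs of the length that occurs
    here. *)
Lemma card_tableau V :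
  (forall u, outputs_within M id T u [:: V u] \/ size u <> size (input (nseq l false))) ->
  #|[set s : {ffun 'I_num_vars -> bool} | [forall c, sat_clause inc s c]]|
  = #|[set y : l.-tuple bool | V (input y)]|.
Proof.
move=> hV.
have acc (y : l.-tuple bool) : accepting (grid y T W) = V (input y).
  apply: grid_accepts; first by lia.
  by case: (hV (input y)) => // -[]; rewrite !size_input size_tuple size_nseq.
rewrite -[RHS](card_imset _ tableau_inj); apply: eq_card => s; rewrite !inE.
apply/forallP/imsetP => [sat|[y]].
  exists (witness s); last exact: sat_tableau.
  by rewrite inE -acc sat_accepting.
by rewrite inE -acc => hy -> c; apply: tableau_sat; rewrite ?size_tuple.
Qed.

(** The clause forbidding two different cells at one place, taken for twice the same cell, contains
    every literal by the definition of [literal]. *)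
Lemma tautological_clause : exists c : 'I_num_clauses, forall s, sat_clause inc s c.
Proof.
have lt := index_of_lt (leq0n T) W_lt (index_pattern_lt (inl (inl (blank_cell, blank_cell)))).
exists (Ordinal lt) => s; apply: clauseP; exists 0, W, blank_cell; split=> //.
have [_ _ e3] := index_ofK 0 W_lt (index_pattern_lt (inl (inl (blank_cell, blank_cell)))).
by rewrite /= e3 pattern_atK /= eqxx.
Qed.

End Tableau.

(** * Computing the encoded net *)

Lemma FPn_drop_env f k : FPn f -> FPn (fun xs => f (drop k xs)).
Proof. exact: FP_drop_env. Qed.

Lemma FPb_odd f : FPn f -> FPb (fun xs => odd (f xs)).
Proof.
move=> hf; apply: FPb_ext (FPb_eq (FPn_mod hf (FPn_const 2)) (FPn_const 1)) => xs.
by rewrite modn2; case: odd.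
Qed.

Lemma FPn_double f : FPn f -> FPn (fun xs => (f xs).*2).
Proof. by move=> hf; apply: FPn_ext (FPn_add hf hf) => xs; rewrite addnn. Qed.

Lemma FPb_if_const c (f g : bool) : FPb c -> FPb (fun xs => if c xs then f else g).
Proof. by move=> h; apply: FPb_if h (FPb_const f) (FPb_const g). Qed.

(* Kind, variable, polarity and clause of a node; components that a node does
   not have are 0. *)
Definition code := (nat * nat * nat * nat)%type.

Definition place_code n m (p : place n m) : code :=
  match p with
  | Source => (0, 0, 0, 0)
  | Sink => (1, 0, 0, 0)
  | Var v => (2, v : nat, 0, 0)
  | Lit v b c => (3, v : nat, b : nat, c : nat)
  | Arg v c => (4, v : nat, 0, c : nat)
  | Done c => (5, 0, 0, c : nat)
  end.

Definition transition_code n m (t : transition n m) : code :=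
  match t with
  | Start => (0, 0, 0, 0)
  | Choose v b => (1, v : nat, b : nat, 0)
  | Delay v b c => (2, v : nat, b : nat, c : nat)
  | Check c b => (3, 0, b : nat, c : nat)
  | Finish => (4, 0, 0, 0)
  end.

Definition code_arc_pt (kp vp bp cp kt vt bt ct : nat) : bool :=
  [|| (kp == 0) && (kt == 0), [&& kp == 2, kt == 1 & vp == vt],
      [&& kp == 3, kt == 2, vp == vt, bp == bt & cp == ct],
      [&& kp == 4, kt == 3 & cp == ct] | (kp == 5) && (kt == 4)].

Definition code_arc_tp (kt vt bt ct kp vp bp cp : nat) : bool :=
  [|| (kt == 0) && (kp == 2), [&& kt == 1, kp == 3, vt == vp & bt == bp],
      [&& kt == 2, kp == 4, vt == vp & ct == cp],
      [&& kt == 3, kp == 5 & ct == cp] | (kt == 4) && (kp == 1)].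

Definition uncurry4 (X : Type) (g : nat -> nat -> nat -> nat -> X) (c : code) : X :=
  g c.1.1.1 c.1.1.2 c.1.2 c.2.

Lemma arc_pt_code n m (p : place n m) t :
  arc_pt p t = uncurry4 (uncurry4 code_arc_pt (place_code p)) (transition_code t).
Proof.
case: p t => [||v|v b c|v c|c] [|v1 b1|v1 b1 c1|c1 b1|] //=;
  rewrite /uncurry4 /code_arc_pt /= ?orbF ?val_eqE //.
by case: b b1 => [] [].
Qed.

Lemma arc_tp_code n m (p : place n m) t :
  arc_tp t p = uncurry4 (uncurry4 code_arc_tp (transition_code t)) (place_code p).
Proof.
case: p t => [||v|v b c|v c|c] [|v1 b1|v1 b1 c1|c1 b1|] //=;
  rewrite /uncurry4 /code_arc_tp /= ?orbF ?val_eqE //.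
by case: b b1 => [] [].
Qed.

(** The list follows the enumeration of [place_sum], with [true] before [false], since the encoding
    lists nodes in that order. *)
Definition place_codes (n m : nat) : seq code :=
  [:: (0, 0, 0, 0); (1, 0, 0, 0)] ++ [seq (2, v, 0, 0) | v <- iota 0 n] ++
  flatten [seq [seq (3, v, 1, c) | c <- iota 0 m] ++ [seq (3, v, 0, c) | c <- iota 0 m]
          | v <- iota 0 n] ++
  flatten [seq [seq (4, v, 0, c) | c <- iota 0 m] | v <- iota 0 n] ++
  [seq (5, 0, 0, c) | c <- iota 0 m].

Definition transition_codes (n m : nat) : seq code :=
  [:: (0, 0, 0, 0)] ++ flatten [seq [:: (1, v, 1, 0); (1, v, 0, 0)] | v <- iota 0 n] ++
  flatten [seq [seq (2, v, 1, c) | c <- iota 0 m] ++ [seq (2, v, 0, c) | c <- iota 0 m]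
          | v <- iota 0 n] ++
  flatten [seq [:: (3, 0, 1, c); (3, 0, 0, c)] | c <- iota 0 m] ++ [:: (4, 0, 0, 0)].

Lemma enum_sum (A B : finType) :
  enum {: A + B} = [seq inl a | a <- enum A] ++ [seq inr b | b <- enum B].
Proof. by rewrite [LHS]enumT [@Finite.enum]unlock /= /sum_enum !enumT. Qed.

Lemma enum_prod (A B : finType) :
  enum {: A * B} = flatten [seq [seq (a, b) | b <- enum B] | a <- enum A].
Proof. by rewrite [LHS]enumT [@Finite.enum]unlock. Qed.

Lemma enum_bool_list : enum {: bool} = [:: true; false].
Proof. by rewrite [LHS]enumT [@Finite.enum]unlock. Qed.

Lemma enum_unit_list : enum {: unit} = [:: tt].
Proof. by rewrite [LHS]enumT [@Finite.enum]unlock. Qed.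

Lemma map_enum_ord (X : Type) n (f : nat -> X) :
  [seq f (i : 'I_n) | i <- enum 'I_n] = map f (iota 0 n).
Proof. by rewrite -val_enum_ord -map_comp. Qed.

Lemma flatten_flatten (X : Type) (sss : seq (seq (seq X))) :
  flatten (flatten sss) = flatten (map flatten sss).
Proof. by elim: sss => //= ss sss IH; rewrite flatten_cat IH. Qed.

Lemma map_enum_prod (X : Type) (A B : finType) (f : A * B -> X) :
  map f (enum {: A * B}) = flatten [seq [seq f (a, b) | b <- enum B] | a <- enum A].
Proof.
rewrite enum_prod map_flatten -map_comp; congr flatten; apply: eq_map => a /=.
by rewrite -map_comp.
Qed.

Lemma map_enum_val_enum (A : finType) : [seq enum_val i | i <- enum 'I_#|A|] = enum A.
Proof.
have [/card_gt0P[a _]|none] := ltnP 0 #|A|.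
  rewrite (eq_map (fun i => enum_val_nth a i)) (map_enum_ord _ (nth a (enum A))).
  by rewrite cardE map_nth_iota0 ?take_size.
have e : enum A = [::] by apply: size0nil; rewrite -cardE; apply/eqP; rewrite -leqn0.
by rewrite e; apply: size0nil; rewrite size_map size_enum_ord cardE e.
Qed.

Lemma map_map (A B C : Type) (f : B -> C) (g : A -> B) s :
  map f (map g s) = [seq f (g x) | x <- s].
Proof. by rewrite -map_comp. Qed.

Lemma map_place_code n m : [seq place_code (ord_place i) | i <- enum 'I_#|place_sum n m|]
  = place_codes n m.
Proof.
rewrite (_ : [seq _ | i <- _] = map (fun p : place_sum n m => place_code (sum_to_place p))
   (map enum_val (enum 'I_#|place_sum n m|))); last by rewrite -map_comp.
rewrite map_enum_val_enum.
have -> : enum (place_sum n m) = [seq inl u | u <- enum {: unit}] ++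
  [seq inr p | p <- [seq inl u | u <- enum {: unit}] ++
  [seq inr p | p <- [seq inl v | v <- enum 'I_n] ++
  [seq inr p | p <- [seq inl q | q <- enum {: 'I_n * bool * 'I_m}] ++
  [seq inr p | p <- [seq inl q | q <- enum {: 'I_n * 'I_m}] ++
  [seq inr c | c <- enum 'I_m]]]]].
  by rewrite -!enum_sum.
rewrite !map_cat !map_map -!enumT enum_unit_list /= !map_enum_prod flatten_flatten map_map.
rewrite /place_codes /=; congr [:: _, _ & _].
congr (_ ++ _); first exact: (map_enum_ord n (fun v => (2, v, 0, 0))).
congr (_ ++ _).
  rewrite -[in RHS](map_enum_ord n); congr flatten; apply: eq_map => v.
  rewrite enum_bool_list /= cats0.
  by rewrite -!(map_enum_ord m).
congr (_ ++ _).
  rewrite -[in RHS](map_enum_ord n); congr flatten; apply: eq_map => v.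
  by rewrite -!(map_enum_ord m).
exact: (map_enum_ord m (fun c => (5, 0, 0, c))).
Qed.

Lemma map_transition_code n m :
  [seq transition_code (ord_transition i) | i <- enum 'I_#|transition_sum n m|]
  = transition_codes n m.
Proof.
rewrite (_ : [seq _ | i <- _] =
   map (fun p : transition_sum n m => transition_code (sum_to_transition p))
   (map enum_val (enum 'I_#|transition_sum n m|))); last by rewrite -map_comp.
rewrite map_enum_val_enum.
have -> : enum (transition_sum n m) = [seq inl u | u <- enum {: unit}] ++
  [seq inr p | p <- [seq inl q | q <- enum {: 'I_n * bool}] ++
  [seq inr p | p <- [seq inl q | q <- enum {: 'I_n * bool * 'I_m}] ++
  [seq inr p | p <- [seq inl q | q <- enum {: 'I_m * bool}] ++
  [seq inr u | u <- enum {: unit}]]]].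
  by rewrite -!enum_sum.
rewrite !map_cat !map_map -!enumT enum_unit_list /= !map_enum_prod flatten_flatten map_map.
rewrite /transition_codes /=; congr [:: _ & _].
congr (_ ++ _).
  rewrite -[in RHS](map_enum_ord n); congr flatten; apply: eq_map => v.
  by rewrite enum_bool_list.
congr (_ ++ _).
  rewrite -[in RHS](map_enum_ord n); congr flatten; apply: eq_map => v.
  rewrite enum_bool_list /= cats0.
  by rewrite -!(map_enum_ord m).
congr (_ ++ _).
rewrite -[in RHS](map_enum_ord m); congr flatten; apply: eq_map => v.
by rewrite enum_bool_list.
Qed.

(* The environment [drop d ys] sits below [d] loop counters, from which the
   components of the code may be computed. *)
Definition FP_code (g : nat -> nat -> nat -> nat -> seq word -> word) : Prop :=
  forall d fk fv fb fc, FPn fk -> FPn fv -> FPn fb -> FPn fc ->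
    FP (fun ys => g (fk ys) (fv ys) (fb ys) (fc ys) (drop d ys)).

Definition over_codes (g : nat -> nat -> nat -> nat -> seq word -> word) (cs : seq code)
    (xs : seq word) : word :=
  flatten [seq uncurry4 (fun k v b c => g k v b c xs) p | p <- cs].

Definition FP_codes (cs : seq word -> seq code) : Prop :=
  forall g, FP_code g -> FP (fun xs => over_codes g (cs xs) xs).

(** Inside a loop the counter heads the environment and has to be hidden from [g]. *)
Lemma FP_code_behead g : FP_code g -> FP_code (fun k v b c ys => g k v b c (behead ys)).
Proof.
move=> hg d fk fv fb fc hk hv hb hc.
by apply: FP_ext (hg d.+1 fk fv fb fc hk hv hb hc) => ys; rewrite -drop1 drop_drop.
Qed.

Lemma FP_codes_single fk fv fb fc : FPn fk -> FPn fv -> FPn fb -> FPn fc ->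
  FP_codes (fun xs => [:: (fk xs, fv xs, fb xs, fc xs)]).
Proof.
move=> hk hv hb hc g hg; apply: FP_ext (hg 0 _ _ _ _ hk hv hb hc) => xs.
by rewrite drop0 /over_codes /= cats0.
Qed.

Lemma FP_codes_cat cs ds : FP_codes cs -> FP_codes ds -> FP_codes (fun xs => cs xs ++ ds xs).
Proof.
move=> hc hd g hg; apply: FP_ext (FP_cat (hc g hg) (hd g hg)) => xs.
by rewrite /over_codes map_cat flatten_cat.
Qed.

Lemma FP_codes_loop L F : FPn L -> FP_codes (fun ys => F (size (nth [::] ys 0)) (behead ys)) ->
  FP_codes (fun xs => flatten [seq F i xs | i <- iota 0 (L xs)]).
Proof.
move=> hL hF g hg.
have := @FP_flatten L (fun i xs => over_codes g (F i xs) xs) hL (hF _ (FP_code_behead hg)).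
apply: FP_ext => xs; rewrite /over_codes; elim: (iota _ _) => //= i l ->.
by rewrite map_cat flatten_cat.
Qed.

Lemma FP_codes_ext cs ds : cs =1 ds -> FP_codes cs -> FP_codes ds.
Proof. by move=> e h g hg; apply: FP_ext (h g hg) => xs; rewrite e. Qed.

Section CodeLists.
Variables N M : seq word -> nat.
Hypotheses (hN : FPn N) (hM : FPn M).

Let counter i : FPn (fun ys => size (nth [::] ys i)) := FPn_nth i.

Let outer : FPn (fun ys => size (nth [::] (behead ys) 0)) := FPn_shift (counter 0).

Let inner k b :
  FP_codes (fun ys => [seq (k, size (nth [::] ys 0), b, c) | c <- iota 0 (M (behead ys))]).
Proof.
apply: (@FP_codes_ext (fun ys => flatten [seq [:: (k, size (nth [::] ys 0), b, c)]
   | c <- iota 0 (M (behead ys))])) => [ys|]; first exact: flatten_map1.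
apply: (@FP_codes_loop (fun ys => M (behead ys))
  (fun c ys => [:: (k, size (nth [::] ys 0), b, c)])).
  exact: FPn_shift.
exact: FP_codes_single (FPn_const k) outer (FPn_const b) (counter 0).
Qed.

Let literals k : FP_codes (fun xs => flatten [seq [seq (k, v, 1, c) | c <- iota 0 (M xs)] ++
  [seq (k, v, 0, c) | c <- iota 0 (M xs)] | v <- iota 0 (N xs)]).
Proof.
apply: (@FP_codes_loop N (fun v xs => [seq (k, v, 1, c) | c <- iota 0 (M xs)] ++
  [seq (k, v, 0, c) | c <- iota 0 (M xs)])) => //.
by apply: FP_codes_cat.
Qed.

Let point k : FP_codes (fun=> [:: (k, 0, 0, 0)]).
Proof. by apply: FP_codes_single; exact: FPn_const. Qed.

Lemma FP_place_codes : FP_codes (fun xs => place_codes (N xs) (M xs)).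
Proof.
apply: FP_codes_cat (FP_codes_cat (point 0) (point 1)) _; apply: FP_codes_cat.
  apply: (@FP_codes_ext (fun xs => flatten [seq [:: (2, v, 0, 0)] | v <- iota 0 (N xs)])) => [xs|].
    exact: flatten_map1.
  apply: (@FP_codes_loop N (fun v _ => [:: (2, v, 0, 0)])) => //.
  exact: FP_codes_single (FPn_const 2) (counter 0) (FPn_const 0) (FPn_const 0).
apply: FP_codes_cat; first exact: literals.
apply: FP_codes_cat.
  exact: (@FP_codes_loop N (fun v xs => [seq (4, v, 0, c) | c <- iota 0 (M xs)])).
apply: (@FP_codes_ext (fun xs => flatten [seq [:: (5, 0, 0, c)] | c <- iota 0 (M xs)])) => [xs|].
  exact: flatten_map1.
apply: (@FP_codes_loop M (fun c _ => [:: (5, 0, 0, c)])) => //.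
exact: FP_codes_single (FPn_const 5) (FPn_const 0) (FPn_const 0) (counter 0).
Qed.

Lemma FP_transition_codes : FP_codes (fun xs => transition_codes (N xs) (M xs)).
Proof.
apply: FP_codes_cat (point 0) _; apply: FP_codes_cat.
  apply: (@FP_codes_loop N (fun v _ => [:: (1, v, 1, 0)] ++ [:: (1, v, 0, 0)])) => //.
  by apply: FP_codes_cat;
    apply: FP_codes_single (FPn_const _) (counter 0) (FPn_const _) (FPn_const _).
apply: FP_codes_cat; first exact: literals.
apply: FP_codes_cat (point 4).
apply: (@FP_codes_loop M (fun c _ => [:: (3, 0, 1, c)] ++ [:: (3, 0, 0, c)])) => //.
by apply: FP_codes_cat;
  apply: FP_codes_single (FPn_const _) (FPn_const _) (FPn_const _) (counter 0).
Qed.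

End CodeLists.

Lemma FPb_code_arc_pt kp vp bp cp kt vt bt ct : FPn kp -> FPn vp -> FPn bp -> FPn cp ->
  FPn kt -> FPn vt -> FPn bt -> FPn ct ->
  FPb (fun xs => code_arc_pt (kp xs) (vp xs) (bp xs) (cp xs) (kt xs) (vt xs) (bt xs) (ct xs)).
Proof.
by move=> *; do ?[apply: FPb_or | apply: FPb_and | apply: FPb_eq]; rewrite //; exact: FPn_const.
Qed.

Lemma FPb_code_arc_tp kp vp bp cp kt vt bt ct : FPn kp -> FPn vp -> FPn bp -> FPn cp ->
  FPn kt -> FPn vt -> FPn bt -> FPn ct ->
  FPb (fun xs => code_arc_tp (kt xs) (vt xs) (bt xs) (ct xs) (kp xs) (vp xs) (bp xs) (cp xs)).
Proof.
by move=> *; do ?[apply: FPb_or | apply: FPb_and | apply: FPb_eq]; rewrite //; exact: FPn_const.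
Qed.

Lemma FP_arc_words N M : FPn N -> FPn M ->
  FP (fun xs => over_codes (fun kp vp bp cp xs =>
        over_codes (fun kt vt bt ct _ => [:: code_arc_pt kp vp bp cp kt vt bt ct])
          (transition_codes (N xs) (M xs)) xs) (place_codes (N xs) (M xs)) xs) /\
  FP (fun xs => over_codes (fun kt vt bt ct xs =>
        over_codes (fun kp vp bp cp _ => [:: code_arc_tp kt vt bt ct kp vp bp cp])
          (place_codes (N xs) (M xs)) xs) (transition_codes (N xs) (M xs)) xs).
Proof.
move=> hN hM; split.
  apply: (FP_place_codes hN hM) => d fk fv fb fc hk hv hb hc.
  apply: (@FP_transition_codes (fun xs => N (drop d xs)) (fun xs => M (drop d xs)) _ _
    (fun kt vt bt ct ys => [:: code_arc_pt (fk ys) (fv ys) (fb ys) (fc ys) kt vt bt ct])).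
  - exact: FPn_drop_env.
  - exact: FPn_drop_env.
  - move=> d' fk' fv' fb' fc' hk' hv' hb' hc'.
    by apply: FPb_code_arc_pt => //; exact: FPn_drop_env.
apply: (FP_transition_codes hN hM) => d fk fv fb fc hk hv hb hc.
apply: (@FP_place_codes (fun xs => N (drop d xs)) (fun xs => M (drop d xs)) _ _
  (fun kp vp bp cp ys => [:: code_arc_tp (fk ys) (fv ys) (fb ys) (fc ys) kp vp bp cp])).
- exact: FPn_drop_env.
- exact: FPn_drop_env.
- move=> d' fk' fv' fb' fc' hk' hv' hb' hc'.
  by apply: FPb_code_arc_tp => //; exact: FPn_drop_env.
Qed.

Section TableauPolytime.
Variables (M : machine) (X : seq word -> word) (l T W v c : seq word -> nat) (b : seq word -> bool).
Hypotheses (hX : FP X) (hl : FPn l) (hT : FPn T) (hW : FPn W).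
Hypotheses (hv : FPn v) (hc : FPn c) (hb : FPb b).

Let hcst n : FPn (fun=> n) := FPn_const n.

Lemma FPb_input_symbol i s : FPn i -> FPb (fun xs => input_symbol (X xs) (l xs) (i xs) s).
Proof.
move=> hi; have hD := FP_delimit hX; have hd := FPn_size hD; have hi' := FPn_sub hi hd.
have hl2 := FPn_double hl.
apply: FPb_if (FPb_leq (FPn_succ hi) hd) _ _.
  case: s => [s|]; last exact: FPb_const.
  apply: FPb_ext (FPb_eqb (FPb_const s) (FPb_nth hi hD)) => xs //.
apply: FPb_if (FPb_leq (FPn_succ hi') hl2) _ _; first exact: FPb_if_const (FPb_odd hi').
exact: FPb_if_const (FPb_eq hi' hl2).
Qed.

Lemma FPb_initial j (a : cell M) : FPn j -> FPb (fun xs => initial (X xs) (l xs) (W xs) (j xs) a).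
Proof.
move=> hj; apply: FPb_and (FPb_const _) (FPb_and _ (FPb_and (FPb_const _) _)).
  exact: FPb_eqb (FPb_const _) (FPb_eq hj hW).
apply: FPb_if (FPb_leq (FPn_succ hj) hW) (FPb_const _) _.
exact: FPb_input_symbol (FPn_sub hj hW).
Qed.

Lemma FPb_literal t' j' t j (a : cell M) be : FPn t' -> FPn j' -> FPn t -> FPn j ->
  FPb (fun xs => literal (X xs) (l xs) (T xs) (W xs) (t' xs) (j' xs) a (b xs) (t xs) (j xs) be).
Proof.
move=> ht' hj' ht hj; have hnb := FPb_not hb; have hW2 := FPn_double hW.
have hm := FPn_min (FPn_succ hj) hW2; have hp := FPn_pred hj; have ht1 := FPn_succ ht.
have hs := FPn_succ ht; have hi := FPb_initial a hj.
case: be => [[[a1 a2]|[[[a1 a2] a3] a4]]|[[]|a1]] /=; rewrite /literal;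
by do ?[by [] | exact: FPb_const | apply: FPb_or | apply: FPb_and | apply: FPb_not
       | apply: FPb_leq | apply: FPb_eq]; rewrite //; exact: FPn_const.
Qed.

Lemma FPn_time_of_index q i : FPn i -> FPn (fun xs => time_of_index (W xs) q (i xs)).
Proof. by move=> hi; apply: FPn_div (FPn_div hi _) (FPn_succ (FPn_double hW)). Qed.

Lemma FPn_column_of_index q i : FPn i -> FPn (fun xs => column_of_index (W xs) q (i xs)).
Proof. by move=> hi; apply: FPn_mod (FPn_div hi _) (FPn_succ (FPn_double hW)). Qed.

(** Cell and pattern are residues modulo constants of the machine. Two uses of [FPb_switch] fix
    them, and what is left is arithmetic on times and columns. *)
Lemma FPb_incidence :
  FPb (fun xs => incidence M (X xs) (l xs) (T xs) (W xs) (v xs) (b xs) (c xs)).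
Proof.
have p0 : 0 < #|pattern M| by apply/card_gt0P; exists (inr (inl tt)).
have c0 : 0 < #|cell M| by apply/card_gt0P; exists (blank_cell M).
pose h1 i k xs := literal (X xs) (l xs) (T xs) (W xs)
  (time_of_index (W xs) #|cell M| (v xs)) (column_of_index (W xs) #|cell M| (v xs)) (cell_at M i)
  (b xs) (time_of_index (W xs) #|pattern M| (c xs)) (column_of_index (W xs) #|pattern M| (c xs))
  (pattern_at M k).
pose h2 i xs := (c xs %% #|pattern M| < #|pattern M|) && h1 i (c xs %% #|pattern M|) xs.
have H2 i : FPb (h2 i).
  apply: FPb_switch (FPn_mod hc _) _ => // k _.
  by apply: FPb_literal; [apply: FPn_time_of_index | apply: FPn_column_of_index
    | apply: FPn_time_of_index | apply: FPn_column_of_index].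
apply: FPb_ext (@FPb_switch #|cell M| h2 _ (FPn_mod hv (hcst #|cell M|)) (fun i _ => H2 i)) => xs.
by rewrite /h2 !ltn_mod p0 c0.
Qed.

End TableauPolytime.

Lemma rank_nth (A : finType) (a : A) i : i < size (enum A) -> nth a (enum A) i = a ->
  enum_rank a = i :> nat.
Proof.
move=> h e; have h' : i < #|A| by rewrite cardE.
suff -> : enum_rank a = Ordinal h' by [].
by apply: enum_val_inj; rewrite enum_rankK (enum_val_nth a) /= e.
Qed.

Lemma place_ord_ends n m :
  place_ord (Source : place n m) = 0 :> nat /\ place_ord (Sink : place n m) = 1 :> nat.
Proof.
have [r e] : exists r, enum (place_sum n m) = [:: inl tt, inr (inl tt) & r].
  by rewrite enum_sum enum_unit_list /= enum_sum enum_unit_list /=; eexists.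
by split; apply: rank_nth; rewrite e.
Qed.

(** Kind 2 is [Delay] and kind 3 is [Check]; no other transition takes time. *)
Definition tau_code (F : nat -> bool -> nat -> bool) (k v b c : nat) : bool :=
  if k == 2 then F v (b == 1) c else (k == 3) && (b == 1).

Lemma bits_bool (b : bool) : bits b = if b then [:: true] else [::].
Proof. by case: b. Qed.

Lemma encode_wordsD ws us : encode_words (ws ++ us) = encode_words ws ++ encode_words us.
Proof. by rewrite /encode_words map_cat flatten_cat. Qed.

Lemma encode_words_cons w ws : encode_words (w :: ws) = delimit w ++ encode_words ws.
Proof. by []. Qed.

(** The encoding is rewritten as a concatenation of [over_codes], the form to which [FP_codes]
    applies. *)
Lemma encode_clause_instance n m (F : nat -> bool -> nat -> bool) xs :
  encode (clause_instance (fun (v : 'I_n) b (c : 'I_m) => F v b c)) =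
  (delimit (bits (size (place_codes n m))) ++ delimit (bits (size (transition_codes n m))) ++
   delimit [::] ++ delimit [:: true] ++
   delimit (over_codes (fun kp vp bp cp xs =>
        over_codes (fun kt vt bt ct _ => [:: code_arc_pt kp vp bp cp kt vt bt ct])
          (transition_codes n m) xs) (place_codes n m) xs) ++
   delimit (over_codes (fun kt vt bt ct xs =>
        over_codes (fun kp vp bp cp _ => [:: code_arc_tp kt vt bt ct kp vp bp cp])
          (place_codes n m) xs) (transition_codes n m) xs)) ++
  over_codes (fun _ _ _ _ _ => delimit [:: true] ++ delimit [:: true]) (transition_codes n m) xs ++
  over_codes (fun k v b c _ => delimit (if tau_code F k v b c then [:: true] else [::]))
    (transition_codes n m) xs ++
  delimit [:: true] ++ delimit (nseq (n + m).+1 false ++ [:: true]).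
Proof.
set W := clause_instance _; rewrite /encode !encode_wordsD.
have [e0 e1] : source (wnet W) = 0 :> nat /\ sink (wnet W) = 1 :> nat := place_ord_ends n m.
have sp : nplaces W = size (place_codes n m).
  by rewrite -map_place_code size_map size_enum_ord.
have st : ntrans W = size (transition_codes n m).
  by rewrite -map_transition_code size_map size_enum_ord.
have over_t g ys : over_codes g (transition_codes n m) ys =
    flatten [seq uncurry4 (fun k v b c => g k v b c ys) (transition_code (ord_transition i))
            | i <- enum 'I_(ntrans W)].
  by rewrite /over_codes -map_transition_code map_map.
have over_p g ys : over_codes g (place_codes n m) ys =
    flatten [seq uncurry4 (fun k v b c => g k v b c ys) (place_code (ord_place i))
            | i <- enum 'I_(nplaces W)].
  by rewrite /over_codes -map_place_code map_map.
congr (_ ++ _).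
  rewrite !encode_words_cons e0 e1 cats0.
  congr (delimit (bits _) ++ (delimit (bits _) ++ (_ ++ (_ ++ (delimit _ ++ delimit _)))));
    rewrite ?map_allpairs //.
    rewrite over_p; congr flatten; apply: eq_map => p.
    rewrite /uncurry4 over_t -[LHS]flatten_map1; congr flatten.
    by apply: eq_map => t; rewrite inE /= arc_pt_code.
  rewrite over_t; congr flatten; apply: eq_map => t.
  rewrite /uncurry4 over_p -[LHS]flatten_map1; congr flatten.
  by apply: eq_map => p; rewrite inE /= arc_tp_code.
congr (_ ++ _).
  rewrite over_t /encode_words; elim: (enum _) => //= i s ->.
  by rewrite /uncurry4.
congr (_ ++ _).
  rewrite over_t /encode_words map_map; congr flatten; apply: eq_map => t /=.
  by rewrite /uncurry4 -bits_bool; case: (ord_transition t) => //= [v [] c|c []].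
rewrite !encode_words_cons cats0 -bits_exp2.
have k0 : 0 < 2 ^ (n + m).+1 by rewrite expn_gt0.
(* This fraction is in lowest terms, so its numerator and denominator can be read off. *)
have -> : eps W = (1%:~R / (2 ^ (n + m).+1)%:Z%:~R)%R by rewrite div1r.
rewrite coprimeq_num ?coprimeq_den ?coprime1n // gtr0_sg ?ltz_nat // eqz_nat gtn_eqF //.
Qed.

Lemma FPn_size_codes cs : FP_codes cs -> FPn (fun xs => size (cs xs)).
Proof.
move=> h; apply: FP_ext (h (fun _ _ _ _ _ => [:: true]) _) => [xs|d *]; last exact: FP_const.
by rewrite /over_codes; elim: (cs xs) => //= p s ->.
Qed.

Lemma FP_encode_clause_instance N M (F : nat -> bool -> nat -> seq word -> bool) :
  FPn N -> FPn M ->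
  (forall d fv fb fc, FPn fv -> FPb fb -> FPn fc ->
    FPb (fun ys => F (fv ys) (fb ys) (fc ys) (drop d ys))) ->
  FP (fun xs => encode (clause_instance (fun (v : 'I_(N xs)) b (c : 'I_(M xs)) => F v b c xs))).
Proof.
move=> hN hM hF.
have hp := FP_place_codes hN hM; have ht := FP_transition_codes hN hM.
have [h1 h2] := FP_arc_words hN hM.
apply: FP_ext => [xs|]; first exact: (esym (encode_clause_instance
  (N xs) (M xs) (fun v b c => F v b c xs) xs)).
have c1 w : FP (fun=> w) := FP_const w.
apply: FP_cat.
  apply: FP_cat (FP_delimit (FP_bits (FPn_size_codes hp))) _.
  apply: FP_cat (FP_delimit (FP_bits (FPn_size_codes ht))) _.
  apply: FP_cat (c1 _) (FP_cat (c1 _) (FP_cat (FP_delimit h1) (FP_delimit h2))).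
apply: FP_cat; first exact: (ht (fun _ _ _ _ _ => delimit [:: true] ++ delimit [:: true])
  (fun _ _ _ _ _ _ _ _ _ => FP_const _)).
apply: FP_cat.
  pose g k v b c xs :=
    delimit (if tau_code (fun v b c => F v b c xs) k v b c then [:: true] else [::]).
  apply: (ht g) => d fk fv fb fc hk hv hb hc.
  apply: FP_delimit; apply: FP_if (c1 _) (c1 _).
  have hb1 := FPb_eq hb (FPn_const 1).
  exact: FPb_if (FPb_eq hk (FPn_const 2)) (hF d _ _ _ hv hb1 hc)
    (FPb_and (FPb_eq hk (FPn_const 3)) hb1).
exact: FP_cat (c1 _) (FP_delimit (FP_cat (FP_nseq_false (FPn_succ (FPn_add hN hM))) (c1 _))).
Qed.

(** * The reduction *)

Lemma polyb_poly b : polyb b -> exists p : {poly nat}, forall n, b n <= p.[n]%R.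
Proof.
case=> a [k h]; exists (a%:P * ('X + 1%:P) ^+ k)%R => n.
apply: leq_trans (h n) _.
by rewrite hornerM hornerC horner_exp hornerD hornerX hornerC natrXE -[(n + 1)%R]/(n + 1)%N addn1.
Qed.

Lemma poly_polyb (p : {poly nat}) : polyb (fun n => p.[n]%R).
Proof.
rewrite /horner; elim: (polyseq p) => [|a s IH] /=; first exact: polyb_const.
exact: polyb_add (polyb_mul IH polyb_id) (polyb_const a).
Qed.

(** The program is fixed before the oracle is given; only the polynomial for its running time uses
    the length bound on the answers. *)
Lemma FP_oracle_query (query answer : seq word -> word) : FP query -> FP answer ->
  exists M : machine, forall O, poly_length O -> exists p : {poly nat},
    forall x, outputs_within M O p.[size x]%R x (answer [:: x; O (query [:: x])]).
Proof.
move=> [C1 [b1 [m1 p1 _ t1 e1]]] [C2 [b2 [m2 p2 _ t2 e2]]].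
(* Register 0 keeps the input, which [answer] still needs; register 1 holds the query and then the
   oracle's word; the result in register 2 is moved to 0, the output tape. *)
pose c := Seq (C1 [:: 0] 1 2) (Seq Ask (Seq (C2 [:: 0; 1] 2 3) (Seq (clear 0) (shift 2 0 3)))).
have c0 : 0 < max_reg c by rewrite /= !leq_max /= ?orbT.
exists (compile c) => O [q hq].
have [bq [mq pq tq]] := polyb_mono (poly_polyb q).
pose B n := b2 (n + bq (b1 n)).
have [p hp] : exists p : {poly nat}, forall n,
    b1 n + (1 + (B n + ((2 * n + 1) + (10 * B n + 2)))) <= p.[n]%R.
  by apply: polyb_poly; rewrite /B; polyb_tac.
exists p => x.
pose s0 : store := fun r => if r == 0 then x else [::].
set y := O (query [:: x]).
have hy : total [:: x; y] <= size x + bq (b1 (size x)).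
  rewrite /total /= addn0 leq_add2l; apply: leq_trans (hq _) _; apply: leq_trans (tq _) _.
  by apply: mq; have := t1 [:: x]; rewrite /total /= !addn0.
pose s1 := upd_reg (put s0 1 [:: query [:: x]]) 1 y.
pose s2 := put s1 2 [:: answer [:: x; y]].
have [n hn e] : does O c
    (b1 (size x) + (1 + (B (size x) + ((2 * size x + 1) + (10 * B (size x) + 2)))))
    s0 (upd_reg (upd_reg (upd_reg s2 0 [::]) 0 (answer [:: x; y])) 2 [::]).
  apply: does_seq.
    have r0 : ready [:: 0] 1 1 2 s0 by split=> // -[|[|r]].
    by apply: does_eq (e1 O _ _ _ _ r0) _ erefl; rewrite /total /= addn0.
  apply: does_seq; first by exists 1 => //; exact: ExecAsk.
  apply: does_seq.
    have r1 : ready [:: 0; 1] 2 1 3 s1.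
      by split=> // -[|[|[|r]]] //= _; rewrite /s1 /upd_reg /put /=.
    by apply: (does_eq (e2 O _ _ _ _ r1)) => //; apply: m2.
  apply: does_seq; first exact: does_clear.
  apply: does_eq (@does_shift O 2 0 3 (upd_reg s2 0 [::]) _ _ _ _ _) _ _ => //.
  rewrite leq_add2r leq_mul2l; apply: leq_trans (m2 _ _ hy).
  by have := t2 [:: x; y]; rewrite {1}/total /= addn0.
rewrite (_ : answer _ = upd_reg (upd_reg (upd_reg s2 0 [::]) 0 (answer [:: x; y])) 2 [::] 0) //.
exact: compile_outputs c0 e (leq_trans hn (hp _)).
Qed.

Theorem theorem4 (R : realType) : sharpP_hard (ET_approximation R).
Proof.
move=> f [V [p [[MV [pV [no_oracle hMV]]] hf]]].
pose l (x : word) := p.[size x]%R.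
(* The argument of [pV] is the length of [input x y] for a witness [y] of length [l x]; [W] is then
   the least value allowed by [W_large]. *)
pose T (x : word) := pV.[((size x).*2.+1 + (l x).*2.+1)%N]%R.
pose W (x : word) := T x + (size x).*2.+1 + (l x).*2.+1.
pose n (x : word) := num_vars MV (T x) (W x).
pose m0 (x : word) := num_clauses MV (T x) (W x).
(* At most [2 ^ n] assignments are counted, so the count is below [2 ^ K]. *)
pose K (x : word) := (n x).+1.
pose m (x : word) := K x * m0 x.
(* Reducing the clause index modulo [m0 x] repeats every clause [K x] times. *)
pose F v b c x := incidence MV x (l x) (T x) (W x) v b (c %% m0 x).
pose query (xs : seq word) := let x := nth [::] xs 0 in
  encode (clause_instance (fun (v : 'I_(n x)) b (c : 'I_(m x)) => F v b c x)).
pose answer (xs : seq word) := let x := nth [::] xs 0 in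
  extract (K x) (n x + m x) (nth [::] xs 1).
have hX : FP (fun xs => nth [::] xs 0) := FP_nth 0.
have hl : FPn (fun xs => l (nth [::] xs 0)) := FPn_poly p (FPn_size hX).
have hx2 := FPn_succ (FPn_double (FPn_size hX)).
have hl2 := FPn_succ (FPn_double hl).
have hT : FPn (fun xs => T (nth [::] xs 0)) := FPn_poly pV (FPn_add hx2 hl2).
have hW : FPn (fun xs => W (nth [::] xs 0)) := FPn_add (FPn_add hT hx2) hl2.
have hq (q : nat) : FPn (fun xs => (T (nth [::] xs 0)).+1 * columns (W (nth [::] xs 0)) * q).
  exact: FPn_mul (FPn_mul (FPn_succ hT) (FPn_succ (FPn_double hW))) (FPn_const q).
have hn : FPn (fun xs => n (nth [::] xs 0)) := hq _.
have hm0 : FPn (fun xs => m0 (nth [::] xs 0)) := hq _.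
have hK : FPn (fun xs => K (nth [::] xs 0)) := FPn_succ hn.
have hm : FPn (fun xs => m (nth [::] xs 0)) := FPn_mul hK hm0.
have hquery : FP query.
  apply: (@FP_encode_clause_instance _ _ (fun v b c xs => F v b c (nth [::] xs 0))) => //.
  move=> d fv fb fc hv hb hc.
  exact: (FPb_incidence MV (FP_drop_env d hX) (FPn_drop_env d hl) (FPn_drop_env d hT)
    (FPn_drop_env d hW) hv (FPn_mod hc (FPn_drop_env d hm0)) hb).
have hanswer : FP answer := FP_extract hK (FPn_add hn hm) (FP_nth 1).
have [Mc hMc] := FP_oracle_query hquery hanswer; exists Mc => O hO lO.
have [pc hpc] := hMc O lO; exists pc => x; exists (answer [:: x; O (query [:: x])]) => //.
have W_large : T x + size (delimit x) + (l x).*2.+1 <= W x by rewrite size_delimit.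
have hV u : outputs_within MV id (T x) u [:: V u] \/ size u <> size (input x (nseq (l x) false)).
  case: (eqVneq (size u) (size (input x (nseq (l x) false)))) => [e|/eqP]; [left | by right].
  by rewrite /T -(size_nseq (l x) false) -size_input -e; exact: hMV.
have [c0 taut] := tautological_clause MV W_large.
have card := card_tableau no_oracle W_large hV.
have m0_gt0 : 0 < m0 x := leq_ltn_trans (leq0n _) (ltn_ord c0).
have n_gt0 : 0 < n x.
  by rewrite !muln_gt0; apply/card_gt0P; exists (blank_cell MV).
have m_gt0 : 0 < m x by rewrite muln_gt0.
have c1_lt : c0 < m x by apply: leq_trans (ltn_ord c0) _; rewrite leq_pmull.
have taut1 (s : {ffun 'I_(n x) -> bool}) :
    sat_clause (fun (v : 'I_(n x)) b (c : 'I_(m x)) => F v b c x) s (Ordinal c1_lt).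
  by have := taut s; rewrite /sat_clause /F /= modn_small.
rewrite /answer /= (extract_answer n_gt0 m_gt0 taut1 _ (hO _)); last first.
  by rewrite ltnS leq_addr.
rewrite (violation_weight_repeat (n x) (m0 x) (K x)
  (fun v b c => incidence MV x (l x) (T x) (W x) v b c)) card hf modn_small //.
rewrite -card (leq_ltn_trans (max_card _)) // card_ffun card_ord card_bool.
by rewrite ltn_exp2l.
Qed.
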